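(* Let the environment $\omega=\{\omega_x\}_{x\in\mathbb Z}$ be i.i.d. under $P$ with $P(\omega_0=1)<1$ and $\kappa>2$. Let $F_{n,\omega}(x)=P_\omega\left(\frac{T_n-E_\omega[T_n]}{\sigma\sqrt n}\le x\right)$, $x\in\mathbb R$, where $\sigma^2=E[\operatorname{Var}_\omega(T_1)]$ (this is the quenched distribution of $T_n$ with environment-dependent centering and deterministic scaling). (1) If $\kappa>4$, then for any $\varepsilon>0$, $$\lim_{n\to\infty}n^{\frac12-\varepsilon}\left\|F_{n,\omega}-\Phi\right\|_\infty=0,\qquad P\text{-a.s.}$$ (2) If $\kappa\in(2,4]$, then for any $\varepsilon>0$, $$\lim_{n\to\infty}n^{1-\frac2\kappa-\varepsilon}\left\|F_{n,\omega}-\Phi\right\|_\infty=0,\qquad P\text{-a.s.}$$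
   Context: One-dimensional nearest-neighbor random walk in a random environment (RWRE). An environment is a random sequence $\omega=\{\omega_x\}_{x\in\mathbb Z}\in[0,1]^{\mathbb Z}$ with law $P$ (expectation $E$). Given $\omega$ and $x\in\mathbb Z$, $P_\omega^x$ (the quenched law) is the law of the Markov chain $\{X_n\}_{n\ge0}$ on $\mathbb Z$ with $P_\omega^x(X_0=x)=1$ and $P_\omega^x(X_{n+1}=y+1\mid X_n=y)=1-P_\omega^x(X_{n+1}=y-1\mid X_n=y)=\omega_y$. Write $P_\omega=P_\omega^0$, with expectation $E_\omega$ and variance $\operatorname{Var}_\omega(Z)=E_\omega[Z^2]-E_\omega[Z]^2$. Let $\rho_x=\frac{1-\omega_x}{\omega_x}$ and $\kappa=\sup\{p>0: E[\rho_0^p]<1\}\in(0,\infty]$ (when this set is nonempty); for i.i.d. environments, the condition $\kappa>2$ is equivalent to $E[\rho_0^{2+\delta}]<1$ for some $\delta>0$. Hitting times: $T_n=\inf\{k\ge0:X_k=n\}$. Under the stated assumptions $\sigma^2\in(0,\infty)$. $\Phi$ is the standard normal c.d.f. and $\|F\|_\infty=\sup_{x\in\mathbb R}|F(x)|$. *)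

(* Defs.v *)
From HB Require Import structures.
From mathcomp Require Import all_boot all_order all_algebra.
From mathcomp Require Import all_classical all_reals all_analysis.

Set Implicit Arguments.
Unset Strict Implicit.
Unset Printing Implicit Defensive.

Import Order.TTheory GRing.Theory Num.Theory.
Import numFieldNormedType.Exports.

Local Open Scope classical_set_scope.
Local Open Scope ring_scope.

Definition iid (d : measure_display) (Omega : measurableType d) (R : realType)
    (P : probability Omega R) (omega : int -> {RV P >-> R}) : Prop :=
  (forall (x : int) (B : set R), measurable B ->
     P (omega x @^-1` B) = P (omega 0 @^-1` B)) /\
  (forall (s : seq int) (B : int -> set R), uniq s ->
     (forall x, measurable (B x)) ->
     P (\bigcap_(x in [set` s]) (omega x @^-1` B x)) =
     (\prod_(x <- s) P (omega x @^-1` B x))%E).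
Arguments iid {d Omega R} P omega.

(* Division is that of the extended reals, where (0%:E)^-1 = +oo, so that
   [rho 0 = +oo]. *)
Definition rho (R : realType) (w : R) : \bar R := ((1 - w)%:E / w%:E)%E.

(* The supremum of the empty set is -oo, so that [2 < kappa _] entails that the
   set is nonempty. *)
Definition kappa (d : measure_display) (Omega : measurableType d)
    (R : realType) (P : probability Omega R) (omega : int -> {RV P >-> R})
    : \bar R :=
  ereal_sup [set p%:E | p in
    [set p : R | 0 < p /\ (\int[P]_u (rho (omega 0%R u) `^ p) < 1)%E]].
Arguments kappa {d Omega R} P omega.

Definition step_prob (R : realType) (w : int -> R) (y z : int) : R :=
  if z == y + 1 then w y else if z == y - 1 then 1 - w y else 0.

(* Under Q, the process X is the Markov chain on int started at x with
   transition probabilities [step_prob w]; the Markov property is written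
   multiplicatively, without dividing by the probability of the past. *)
Record is_walk (d : measure_display) (S : measurableType d) (R : realType)
    (X : nat -> S -> int) (w : int -> R) (x : int) (Q : probability S R)
    : Prop := IsWalk {
  walk_measurable : forall (n : nat) (y : int),
    measurable [set t | X n t = y] ;
  walk_start : Q [set t | X 0%N t = x] = 1%E ;
  walk_step : forall (n : nat) (z : nat -> int),
    Q [set t | forall k, (k <= n.+1)%N -> X k t = z k] =
    (Q [set t | forall k, (k <= n)%N -> X k t = z k] *
     (step_prob w (z n) (z n.+1))%:E)%E }.

(* A realization, on a common sample space S with common coordinate process X,
   of all the quenched laws [Pq w x] (for instance S = int^nat). *)
Definition quenched_laws (d : measure_display) (S : measurableType d)
    (R : realType) (X : nat -> S -> int)
    (Pq : (int -> R) -> int -> probability S R) : Prop :=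
  forall (w : int -> R) (x : int),
    (forall y, 0 <= w y <= 1) -> is_walk X w x (Pq w x).

(* Equal to +oo if the walk never visits n. *)
Definition hitting_time (S : Type) (R : realType) (X : nat -> S -> int)
    (n : nat) (t : S) : \bar R :=
  ereal_inf [set k%:R%:E | k in [set k : nat | X k t = n%:Z]].
Arguments hitting_time {S} R X n t.

Definition mean (d : measure_display) (S : measurableType d) (R : realType)
    (Q : probability S R) (Z : S -> \bar R) : \bar R :=
  (\int[Q]_t Z t)%E.

(* The library's variance is restricted to real-valued functions, whereas
   hitting times may be infinite. *)
Definition var (d : measure_display) (S : measurableType d) (R : realType)
    (Q : probability S R) (Z : S -> \bar R) : \bar R :=
  (mean Q (fun t => Z t ^+ 2) - mean Q Z ^+ 2)%E.

Definition sigma2 (d d' : measure_display) (Omega : measurableType d)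
    (S : measurableType d') (R : realType) (P : probability Omega R)
    (omega : int -> {RV P >-> R}) (X : nat -> S -> int)
    (Pq : (int -> R) -> int -> probability S R) : \bar R :=
  (\int[P]_u var (Pq (fun x => omega x u) 0%R) (hitting_time R X 1))%E.
Arguments sigma2 {d d' Omega S R} P omega X Pq.

Definition hitting_cdf (d : measure_display) (S : measurableType d)
    (R : realType) (X : nat -> S -> int) (Q : probability S R) (sigma : R)
    (n : nat) (x : R) : R :=
  fine (Q [set t | ((hitting_time R X n t - mean Q (hitting_time R X n)) /
                    (sigma * Num.sqrt n%:R)%:E <= x%:E)%E]).

Definition Phi (R : realType) (x : R) : R :=
  fine (normal_prob (0 : R) (1 : R) `]-oo, x]).

Definition supnorm (R : realType) (F : R -> R) : R :=
  sup [set `|F x| | x in [set: R]].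

(* Main.v *)
(** Given the environment, T_n is a sum of independent crossing times, so a
    Berry-Esseen bound (Stein's method with a leave-one-out concentration
    inequality, applied to truncated laws) controls the distance between F_n and
    Phi by the sum of the third moments over Var_w(T_n)^(3/2), up to replacing
    Var_w(T_n) by n sigma^2 in the scaling. The moments of the crossing times at
    x satisfy recursions of the form Y_x <= rho_x Y_(x-1) + B_x with Y_(x-1)
    independent of rho_x, which yields E[mean^p], E[var^(p/2)] and
    E[third moment^(p/3)] < oo as soon as E[rho^p] < 1. Summing the exact
    recursions of the mean and of the variance writes Var_w(T_n) - n sigma^2 as a
    combination of martingales with increments (h(rho_x) - E h(rho)) Y_(x-1),
    whose p/2-th moments grow linearly; dyadic chaining then bounds them by
    n^((2/p)(1 + e)) almost surely. The third moments are summable after raising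
    to the power min(p,3)/3 <= 1. This gives the rate n^(1 - 2/p - e) for every
    p in (2,4] with E[rho^p] < 1. *)
Require Import Defs.
From HB Require Import structures.
From mathcomp Require Import all_boot all_order all_algebra.
From mathcomp Require Import all_classical all_reals all_analysis.
From mathcomp Require Import measurable_realfun.
From mathcomp Require Import ring lra zify.

Set Implicit Arguments.
Unset Strict Implicit.
Unset Printing Implicit Defensive.

Import Order.TTheory GRing.Theory Num.Theory.
Import numFieldNormedType.Exports.

Local Open Scope classical_set_scope.
Local Open Scope ring_scope.

(** * Power inequalities *)

(** A recursion Y_x <= rho_x Y_(x-1) + B_x says nothing while Y may be infinite, and no moment of a
    crossing time is known to be finite at the outset. Moments are therefore truncated at time N:
    they are then at most N^j, the contraction E[rho^s] < 1 can be iterated until the unknown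
    initial value dies out, and the bounds, uniform in N, pass to the limit by monotone convergence.
    The same mechanism shows that every site to the right is almost surely reached. Of the two
    errors, the scaling decides the rate: up to n^e, the Berry-Esseen term is n^(3/p - 3/2) for p <=
    3 and n^(-1/2) beyond, while replacing Var_w(T_n) by n sigma^2 costs n^(2/p - 1), which is never
    smaller for p in (2,4]. The cap p <= 4 comes from the martingales: the expansion of |a + b|^s
    that makes their s-th moments, s = p/2, grow linearly stops at s = 2. With p = 4 the exponent is
    1/2, the case kappa > 4; otherwise p approaches kappa, a supremum that need not be attained, and
    the loss goes into epsilon. *)

Lemma le_of_eq {disp} {T : porderType disp} (x y : T) : x = y -> (x <= y)%O.
Proof. by move=> ->. Qed.

Section PowerInequalities.
Context {R : realType}.
Implicit Types (a b s t h : R).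

(** Young's inequality for t^s and 1 with conjugate exponents 1/s and 1/(1-s). It serves as
    Bernoulli's inequality with a fractional exponent and as the interpolation that yields E[rho^s]
    < 1 from E[rho^p] < 1. *)
Lemma powR_bernoulli t s : 0 <= t -> 0 <= s <= 1 -> t `^ s <= 1 + s * (t - 1).
Proof.
move=> t0 /andP[s0 s1].
have [->|s_n0] := eqVneq s 0; first by rewrite powRr0 mul0r addr0.
have [->|s_n1] := eqVneq s 1; first by rewrite powRr1//; lra.
have sgt0 : 0 < s by rewrite lt_neqAle eq_sym s_n0.
have slt1 : 0 < 1 - s by rewrite subr_gt0 lt_neqAle s_n1.
have := @conjugate_powR R (t `^ s) 1 s^-1 (1 - s)^-1 (powR_ge0 _ _) ler01.
rewrite !invr_gt0 !invrK -powRrM mulfV// powR1 mulr1 powRr1//.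
move=> /(_ sgt0 slt1) hh.
have e : s + (1 - s) = 1 by ring.
by apply: (le_trans (hh e)); nra.
Qed.

(** Either b <= h a or a <= b / h, and one term suffices. Taking h small keeps the coefficient of
    a^s close to 1, so that a contraction factor E[rho^s] < 1 survives the additive perturbation
    b. *)
Lemma powRD_le s h a b : 0 <= s -> 0 < h -> 0 <= a -> 0 <= b ->
  (a + b) `^ s <= (1 + h) `^ s * a `^ s + (1 + h^-1) `^ s * b `^ s.
Proof.
move=> s0 h0 a0 b0; have hi0 : 0 < h^-1 by rewrite invr_gt0.
rewrite -!powRM//; try lra.
have [bha|abh] := leP b (h * a).
  apply: (@le_trans _ _ (((1 + h) * a) `^ s)); last by rewrite lerDl powR_ge0.
  by apply: ge0_ler_powR => //; rewrite ?nnegrE; nra.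
apply: (@le_trans _ _ (((1 + h^-1) * b) `^ s)); last by rewrite lerDr powR_ge0.
have ahb : a <= h^-1 * b by rewrite mulrC ler_pdivlMr// mulrC ltW.
by apply: ge0_ler_powR => //; rewrite ?nnegrE; nra.
Qed.

Lemma powRD_subadd s a b : 0 < s <= 1 -> 0 <= a -> 0 <= b ->
  (a + b) `^ s <= a `^ s + b `^ s.
Proof.
move=> /andP[s0 s1] a0 b0.
have [ab0|ab_n0] := eqVneq (a + b) 0.
  have -> : a = 0 by lra.
  have -> : b = 0 by lra.
  by rewrite addr0 powR0 ?gt_eqF// addr0.
have ab0 : 0 < a + b by rewrite lt_neqAle eq_sym ab_n0 addr_ge0.
have ab1 : 0 <= (a + b)^-1 by rewrite invr_ge0 ltW.
(* Each share x / (a + b) of the total lies in [0, 1] and so is at most its own s-th power; the two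
   shares add up to 1. *)
have part (x : R) : 0 <= x -> x <= a + b ->
    x / (a + b) * (a + b) `^ s <= x `^ s.
  move=> x0 xab.
  have -> : x `^ s = (x / (a + b)) `^ s * (a + b) `^ s.
    by rewrite -powRM ?divfK// ?(ltW ab0)// mulr_ge0.
  rewrite ler_wpM2r ?powR_ge0//.
  have [->|x_n0] := eqVneq x 0; first by rewrite mul0r powR_ge0.
  apply: ger1_powR => //; apply/andP; split.
    by rewrite divr_gt0// lt_neqAle eq_sym x_n0.
  by rewrite ler_pdivrMr// mul1r.
apply: le_trans (lerD (part a a0 _) (part b b0 _)); try lra.
by rewrite -mulrDl -mulrDl divff// mul1r.
Qed.

Lemma powR_sum_subadd s (n : nat) (f : nat -> R) : 0 < s <= 1 ->
  (forall i, 0 <= f i) ->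
  (\sum_(i < n) f i) `^ s <= \sum_(i < n) f i `^ s.
Proof.
move=> s01 f0; elim: n => [|n IHn].
  by rewrite !big_ord0 powR0// gt_eqF//; case/andP: s01.
rewrite !big_ord_recr/=; apply: le_trans (lerD IHn (lexx _)).
by apply: powRD_subadd => //; apply: sumr_ge0.
Qed.

Lemma powR_le1D s a : 0 <= s <= 1 -> 0 <= a -> a `^ s <= 1 + a.
Proof.
move=> /andP[s0 s1] a0; apply: le_trans (powR_bernoulli a0 _) _.
  by rewrite s0.
nra.
Qed.

(* For [1 + t >= 0], write [(1+t)^s = (1+t)(1+t)^(s-1)] and use Bernoulli. *)
Lemma powR_normD1_le s t : 1 < s <= 2 ->
  `|1 + t| `^ s <= 1 + s * t + 13 * `|t| `^ s.
Proof.
move=> /andP[s1 s2].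
have s0 : 0 <= s by lra.
have tt0 := normr_ge0 t.
have [tle|tgt] := leP `|t| (1/2).
  have tb : -(1/2) <= t <= 1/2 by rewrite -ler_norml.
  have h1 : `|1 + t| = 1 + t by rewrite ger0_norm//; lra.
  rewrite h1.
  have -> : (1 + t) `^ s = (1 + t) * (1 + t) `^ (s - 1).
    by rewrite mulr_powRB1//; lra.
  have hB : (1 + t) `^ (s - 1) <= 1 + (s - 1) * t.
    have -> : 1 + (s - 1) * t = 1 + (s - 1) * (1 + t - 1) by ring.
    by apply: powR_bernoulli; lra.
  have hsq : t ^+ 2 <= `|t| `^ s.
    rewrite -real_normK ?num_real//.
    have [->|tn0] := eqVneq `|t| 0; first by rewrite expr0n/= powR_ge0.
    rewrite -powR_mulrn//; apply: ger_powR => //.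
    by rewrite lt_neqAle eq_sym tn0 tt0/=; lra.
  have p0 := powR_ge0 `|t| s.
  have : (1 + t) * (1 + t) `^ (s - 1) <= (1 + t) * (1 + (s - 1) * t).
    by rewrite ler_wpM2l//; lra.
  nra.
(* Away from 0 everything is compared with |t|^s: |1 + t| <= 3 |t| costs 9, and the possibly
   negative s t costs 2 * 2, whence the constant 13. *)
have h3 : `|1 + t| `^ s <= 9 * `|t| `^ s.
  have e9 : (3 : R) `^ s <= 9.
    have -> : (9 : R) = 3 `^ (2%:R) by rewrite powR_mulrn//; lra.
    by apply: ler_powR => //; lra.
  apply: (@le_trans _ _ ((3 * `|t|) `^ s)).
    have nD := ler_normD 1 t; rewrite normr1 in nD.
    by apply: ge0_ler_powR => //; rewrite ?nnegrE//; lra.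
  rewrite powRM//.
  by rewrite ler_wpM2r ?powR_ge0.
have h4 : `|t| <= 2 * `|t| `^ s.
  have tgt0 : 0 < `|t| by lra.
  have -> : `|t| `^ s = `|t| * `|t| `^ (s - 1) by rewrite mulr_powRB1//; lra.
  suff : 1 <= 2 * `|t| `^ (s - 1) by nra.
  apply: (@le_trans _ _ ((2 * `|t|) `^ (s - 1))).
    by rewrite -[leLHS](powRr0 (2 * `|t|)); apply: ler_powR; [lra|rewrite subr_ge0 ltW].
  rewrite powRM//; try lra.
  rewrite ler_wpM2r ?powR_ge0//.
  by rewrite ler1_powR//; lra.
have h5 : - `|t| <= t by rewrite lerNl -normrN ler_norm.
have p0 := powR_ge0 `|t| s.
nra.
Qed.

(** Homogeneity reduces to a = 1. The middle term is the derivative of |a|^s times b; it vanishes in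
    the mean when b is centered given a, which makes the s-th moments of a martingale grow
    additively. *)
Lemma powR_normD_le s a b : 1 < s <= 2 ->
  `|a + b| `^ s <=
  `|a| `^ s + s * (Num.sg a * `|a| `^ (s - 1)) * b + 13 * `|b| `^ s.
Proof.
move=> s12; have /andP[s1 s2] := s12.
have [->|a0] := eqVneq a 0.
  rewrite add0r normr0 sgr0 !mul0r mulr0 mul0r powR0 ?gt_eqF//; last lra.
  by rewrite !add0r; have := powR_ge0 `|b| s; lra.
have na0 : 0 < `|a| by rewrite normr_gt0.
have -> : `|a + b| = `|a| * `|1 + b / a|.
  by rewrite -normrM mulrDr mulr1 mulrCA divff// mulr1.
rewrite powRM//.
have := powR_normD1_le (b / a) s12.
have ha := powR_gt0 s na0.
rewrite -(ler_pM2l ha) => /le_trans; apply.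
have eb : `|b| = `|a| * `|b / a| by rewrite -normrM mulrCA divff// mulr1.
rewrite eb powRM// !mulrDr mulr1 [`|a| `^ s * (13 * _)]mulrCA lerD2r lerD2l.
have -> : `|a| `^ s = `|a| * `|a| `^ (s - 1) by rewrite mulr_powRB1//; lra.
have -> : `|a| * `|a| `^ (s - 1) * (s * (b / a)) =
          s * ((`|a| / a) * `|a| `^ (s - 1)) * b by ring.
suff -> : `|a| / a = Num.sg a by [].
by apply: (mulIf a0); rewrite divfK// normrEsg.
Qed.

End PowerInequalities.

(** * The normal distribution and Stein's equation *)

Section Gaussian.
Context {R : realType}.
Implicit Types (w x y z : R).

Lemma is_derive_MVT (f df : R -> R) x y : x < y ->
  (forall z, x <= z <= y -> is_derive z 1 f (df z)) ->
  exists2 c, x < c < y & f y - f x = df c * (y - x).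
Proof.
move=> xy dfE.
have [||c + ->] := @MVT R f df x y xy.
- by move=> z; rewrite in_itv/= => /andP[xz zy]; apply: dfE; rewrite !ltW.
- apply/continuous_within_itvP => //; split.
  + move=> z; rewrite in_itv/= => /andP[xz zy].
    have d := dfE z; apply/differentiable_continuous/derivable1_diffP.
    by have [] := d _ => //; rewrite !ltW.
  + apply: cvg_at_right_filter.
    apply/differentiable_continuous/derivable1_diffP.
    by have [] := dfE x _ => //; rewrite lexx ltW.
  + apply: cvg_at_left_filter.
    apply/differentiable_continuous/derivable1_diffP.
    by have [] := dfE y _ => //; rewrite lexx ltW.
- by rewrite in_itv/= => cxy; exists c.
Qed.

Definition gpdf x : R := normal_pdf 0 1 x.
Let c0 : R := normal_peak (1 : R).

Lemma gpdfE x : gpdf x = normal_peak 1 * expR (- (x ^+ 2 / 2)).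
Proof.
rewrite /gpdf normal_pdfE ?oner_neq0//; congr (_ * expR _).
by rewrite subr0 expr1n mulNr.
Qed.

Let c0_gt0 : 0 < c0. Proof. by rewrite normal_peak_gt0 ?oner_neq0. Qed.

Lemma gpdf_gt0 x : 0 < gpdf x.
Proof. by rewrite gpdfE mulr_gt0// expR_gt0. Qed.

Lemma gpdfN x : gpdf (- x) = gpdf x.
Proof. by rewrite !gpdfE sqrrN. Qed.

Lemma gpdf_le_peak x : gpdf x <= normal_peak 1.
Proof. by rewrite /gpdf; apply: normal_pdf_ub; rewrite oner_neq0. Qed.

Lemma gpdf_decr x y : `|x| <= `|y| -> gpdf y <= gpdf x.
Proof.
move=> xy; rewrite !gpdfE ler_pM2l// ler_expR lerN2.
by rewrite ler_wpM2r// -(real_normK (num_real x)) -(real_normK (num_real y)) lerXn2r// nnegrE.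
Qed.

Lemma is_derive_gpdf x : is_derive x 1 gpdf (- x * gpdf x).
Proof.
have -> : gpdf = (fun x => normal_peak 1 * expR (- (x ^+ 2 / 2))).
  by apply/funext => t; rewrite gpdfE.
have h : is_derive x 1 (fun x : R => - (x ^+ 2 / 2)) (- x).
  have -> : (fun x : R => - (x ^+ 2 / 2)) = - (2^-1 *: (@id R ^+ 2)).
    by apply/funext => t; rewrite !fctE /GRing.scale/= mulrC.
  by apply: is_derive_eq; rewrite /GRing.scale/=; field.
have h1 := @is_derive1_comp _ expR (fun x => - (x ^+ 2 / 2)) x _ _
  (is_derive_expR _) h.
have -> : (fun x => normal_peak 1 * expR (- (x ^+ 2 / 2))) =
   normal_peak 1 *: (expR \o (fun x : R => - (x ^+ 2 / 2))).
  by apply/funext => t; rewrite !fctE.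
by apply: is_derive_eq; rewrite /GRing.scale/=; ring.
Qed.

Lemma is_derive_Phi x : is_derive x 1 (@Phi R) (gpdf x).
Proof.
have [||||dfx <-] := @continuous_FTC1 R gpdf -oo%O x (x + 1).
- by rewrite ltrDl.
- apply: (@integrableS _ _ _ _ setT) => //.
  exact: integrable_normal_pdf.
- by rewrite ltNyr.
- exact: (continuous_normal_pdf (oner_neq0 _)).
- rewrite derive1E; exact/derivableP.
Qed.

(** [Phi] is the distribution function of the identity under the normal law; packing the identity as
    a random variable gives the limits of [Phi] at both infinities. *)
Let idR : measurableTypeR R -> R := idfun.
HB.instance Definition _ :=
  @isMeasurableFun.Build _ _ _ _ idR (@measurable_id _ _ setT).

Let cdf_idR x : cdf (P := normal_prob (0 : R) (1 : R)) (idR : {RV _ >-> R}) x =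
  (Phi x)%:E.
Proof. by rewrite /cdf /distribution/= /pushforward preimage_id fineK// fin_num_measure. Qed.

Lemma cvg_Phiy : Phi x @[x --> +oo] --> (1 : R).
Proof.
have := cvg_cdfy1 (P := normal_prob (0 : R) (1 : R)) (idR : {RV _ >-> R}).
rewrite (_ : cdf _ = EFin \o @Phi R); last by apply/funext => x; rewrite cdf_idR.
by move/fine_cvgP => [].
Qed.

Lemma cvg_PhiNy : Phi x @[x --> -oo] --> (0 : R).
Proof.
have := cvg_cdfNy0 (P := normal_prob (0 : R) (1 : R)) (idR : {RV _ >-> R}).
rewrite (_ : cdf _ = EFin \o @Phi R); last by apply/funext => x; rewrite cdf_idR.
by move/fine_cvgP => [].
Qed.

Lemma Phi_ge0 x : 0 <= Phi x.
Proof. by rewrite /Phi fine_ge0. Qed.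

Lemma Phi_le1 x : Phi x <= 1.
Proof.
by rewrite -lee_fin fineK ?probability_le1// fin_num_measure.
Qed.

Lemma is_derive_PhiN x : is_derive x 1 (fun y => Phi (- y)) (- gpdf x).
Proof.
have h : is_derive x 1 (-%R : R -> R) (- 1) by exact: is_deriveNid.
have := @is_derive1_comp _ (@Phi R) -%R x _ _ (is_derive_Phi (- x)) h.
by rewrite gpdfN mulrN1.
Qed.

Lemma is_derive_PhiC x : is_derive x 1 (fun y => 1 - Phi y) (- gpdf x).
Proof.
have h := is_derive_Phi x.
have -> : (fun y => 1 - Phi y) = cst 1 - @Phi R by [].
by apply: is_derive_eq; rewrite sub0r.
Qed.

Lemma cvg_PhiNy0 : Phi (- x) @[x --> +oo] --> (0 : R).
Proof. by have := cvg_PhiNy; rewrite cvgNy_compNP. Qed.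

Lemma cvg_PhiCy0 : 1 - Phi x @[x --> +oo] --> (0 : R).
Proof.
rewrite -(subrr 1); apply: cvgB; [exact: cvg_cst|exact: cvg_Phiy].
Qed.

Lemma Phi_homo x y : x <= y -> Phi x <= Phi y.
Proof.
rewrite le_eqVlt => /predU1P[->//|xy].
have [c _ e] := is_derive_MVT xy (fun z _ => is_derive_Phi z).
have := gpdf_gt0 c; nra.
Qed.

(** * Mills ratio bounds for the normal tails *)

Section Mills.
Variable K : R -> R.
Hypothesis dK : forall x, is_derive x 1 K (- gpdf x).
Hypothesis K0 : K x @[x --> +oo] --> (0 : R).

Let K_noninc x y : x <= y -> K y <= K x.
Proof.
rewrite le_eqVlt => /predU1P[->//|xy].
have [c _ e] := is_derive_MVT xy (fun z _ => dK z).
have := gpdf_gt0 c; nra.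
Qed.

Let K_ge0 x : 0 <= K x.
Proof.
apply: (cvgr_to_le K0); near=> y; apply: K_noninc.
by near: y; apply: nbhs_pinfty_ge; rewrite num_real.
Unshelve. all: by end_near. Qed.

(** [K] stands for either tail, y |-> 1 - Phi y or y |-> Phi (- y). The difference gpdf z / z - K z
    has derivative - gpdf z / z^2 < 0 and tends to 0 at +oo, so it is nonnegative. *)
Lemma mills_ratio y : 0 < y -> y * K y <= gpdf y.
Proof.
move=> y0.
pose H z := gpdf z / z - K z.
suff H0 : 0 <= H y by move: H0; rewrite /H subr_ge0 ler_pdivlMr// mulrC.
have Hcvg : H x @[x --> +oo] --> (0 : R).
  rewrite -(subr0 0); apply: cvgB => //.
  apply: (@squeeze_cvgr _ _ _ _ (fun=> 0) (fun x => normal_peak 1 * x^-1)).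
  - near=> x; have x0 : 0 < x.
      by near: x; apply: nbhs_pinfty_gt; rewrite num_real.
    rewrite divr_ge0 ?(ltW x0) ?(ltW (gpdf_gt0 x))//=.
    by rewrite ler_wpM2r ?gpdf_le_peak// invr_ge0 ltW.
  - exact: cvg_cst.
  - rewrite -(mulr0 (normal_peak 1)); apply: cvgM; first exact: cvg_cst.
    apply/gtr0_cvgV0; last exact: cvg_id.
    by apply: nbhs_pinfty_gt; rewrite num_real.
apply: (cvgr_to_le Hcvg); near=> x.
have yx : y < x by near: x; apply: nbhs_pinfty_gt; rewrite num_real.
have dH z : y <= z <= x -> is_derive z 1 H (- gpdf z / z ^+ 2).
  move=> /andP[yz _]; have z0 : z != 0 by rewrite gt_eqF// (lt_le_trans y0).
  have := is_derive_gpdf z => h1; have := dK z => h2.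
  have h3 := @is_deriveV _ (@id R) z 1 1 z0 (is_derive_id z 1).
  have -> : H = gpdf * (fun y => (id y)^-1) - K by [].
  by apply: is_derive_eq; rewrite /GRing.scale/=; field.
have [c /andP[yc cx] e] := is_derive_MVT yx dH.
rewrite -subr_le0 e; have := gpdf_gt0 c => g0.
rewrite mulNr mulNr oppr_le0 mulr_ge0 ?subr_ge0 ?ltW// divr_gt0// exprn_gt0//.
exact: lt_trans yc.
Unshelve. all: by end_near. Qed.

Hypothesis K1 : forall x, K x <= 1.

(** Below 1 the tail is at most 1 <= gpdf y / gpdf 1; above 1, K y <= y K y. This is the origin of
    the constant in the Berry-Esseen bound. *)
Lemma mills_bound y : 0 <= y -> K y <= (1 + (gpdf 1)^-1) * gpdf y.
Proof.
move=> y0; have g1 := gpdf_gt0 1; have gy := gpdf_gt0 y.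
have [y1|y1] := leP y 1.
  have : gpdf 1 <= gpdf y by apply: gpdf_decr; rewrite normr1 ger0_norm.
  rewrite -[X in X <= _]mulr1 -ler_pdivlMl// => h; have := K1 y; rewrite mulrDl mul1r; lra.
have yK : K y <= y * K y by rewrite ler_peMl// ltW.
rewrite mulrDl mul1r (le_trans yK)// (le_trans (mills_ratio _))//; first lra.
by rewrite lerDl mulr_ge0 ?invr_ge0 ?ltW.
Qed.

End Mills.

Lemma Phi_le w : w <= 0 -> Phi w <= (1 + (gpdf 1)^-1) * gpdf w.
Proof.
move=> w0; rewrite -(opprK w) gpdfN.
apply: (@mills_bound (fun y => Phi (- y))); last by rewrite oppr_ge0.
- exact: is_derive_PhiN.
- exact: cvg_PhiNy0.
- by move=> x; exact: Phi_le1.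
Qed.

Lemma mulPhi_le w : w <= 0 -> - w * Phi w <= gpdf w.
Proof.
rewrite le_eqVlt => /predU1P[->|w0]; first by rewrite oppr0 mul0r ltW// gpdf_gt0.
rewrite -{2}(opprK w) -(gpdfN w).
apply: (@mills_ratio (fun y => Phi (- y))); last by rewrite oppr_gt0.
- exact: is_derive_PhiN.
- exact: cvg_PhiNy0.
Qed.

Lemma PhiC_le w : 0 <= w -> 1 - Phi w <= (1 + (gpdf 1)^-1) * gpdf w.
Proof.
apply: (@mills_bound (fun y => 1 - Phi y)).
- exact: is_derive_PhiC.
- exact: cvg_PhiCy0.
- by move=> x; have := Phi_ge0 x; lra.
Qed.

Lemma mulPhiC_le w : 0 <= w -> w * (1 - Phi w) <= gpdf w.
Proof.
rewrite le_eqVlt => /predU1P[<-|w0]; first by rewrite mul0r ltW// gpdf_gt0.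
apply: (@mills_ratio (fun y => 1 - Phi y)) => //.
- exact: is_derive_PhiC.
- exact: cvg_PhiCy0.
Qed.

(** * Bounds on the solution of Stein's equation *)

Section SteinSolution.
Variable z : R.

Let C := 1 + (gpdf (1 : R))^-1.
Let f1 w := (1 - Phi z) * (Phi w / gpdf w).
Let f2 w := Phi z * ((1 - Phi w) / gpdf w).

(** The bounded solution of Stein's equation f'(w) - w f(w) = 1{w <= z} - Phi z, with one smooth
    branch on each side of z; the branches agree at z. *)
Definition stein w : R := if w <= z then f1 w else f2 w.
(** Stein's equation solved for f', so that the equation holds everywhere by definition; at the kink
    z this is the left derivative. *)
Definition dstein w : R := w * stein w + (w <= z)%R%:R - Phi z.

Let Phi_nondecr x y : x <= y -> Phi x <= Phi y.
Proof. exact: Phi_homo. Qed.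

Let f1_bound w : w <= z -> 0 <= f1 w <= C.
Proof.
move=> wz; have g0 := gpdf_gt0 w; have p0 := Phi_ge0 w; have p1 := Phi_le1 w.
have z0 := Phi_ge0 z; have z1 := Phi_le1 z.
rewrite /f1 mulrA; apply/andP; split.
  by rewrite divr_ge0// ?(ltW g0)//; nra.
rewrite ler_pdivrMr//; have [w0|w0] := leP w 0.
  by apply: le_trans (Phi_le w0); nra.
have := PhiC_le (ltW w0); have := Phi_nondecr wz; rewrite -/C; nra.
Qed.

Let f2_bound w : z <= w -> 0 <= f2 w <= C.
Proof.
move=> wz; have g0 := gpdf_gt0 w; have p0 := Phi_ge0 w; have p1 := Phi_le1 w.
have z0 := Phi_ge0 z; have z1 := Phi_le1 z.
rewrite /f2 mulrA; apply/andP; split.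
  by rewrite divr_ge0// ?(ltW g0)//; nra.
rewrite ler_pdivrMr//; have [w0|w0] := leP w 0; last first.
  by apply: le_trans (PhiC_le (ltW w0)); nra.
have := Phi_le w0; have := Phi_nondecr wz; rewrite -/C; nra.
Qed.

Let wf1_bound w : w <= z -> -1 <= w * f1 w <= 1.
Proof.
move=> wz; have g0 := gpdf_gt0 w; have p0 := Phi_ge0 w; have p1 := Phi_le1 w.
have z0 := Phi_ge0 z; have z1 := Phi_le1 z.
have e : w * f1 w = (w * (1 - Phi z) * Phi w) / gpdf w by rewrite /f1; ring.
rewrite e ler_pdivrMr// ler_pdivlMr//.
have [w0|w0] := leP w 0.
  have := mulPhi_le w0.
  have : 0 <= Phi z * (- w * Phi w) by apply: mulr_ge0 => //; nra.
  nra.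
have h := mulPhiC_le (ltW w0); have := Phi_nondecr wz => h2.
have h3 : w * (1 - Phi z) <= w * (1 - Phi w) by rewrite ler_wpM2l ?(ltW w0)//; lra.
have : 0 <= w * (1 - Phi z) by apply: mulr_ge0; lra.
nra.
Qed.

Let wf2_bound w : z <= w -> -1 <= w * f2 w <= 1.
Proof.
move=> wz; have g0 := gpdf_gt0 w; have p0 := Phi_ge0 w; have p1 := Phi_le1 w.
have z0 := Phi_ge0 z; have z1 := Phi_le1 z.
have e : w * f2 w = (w * (1 - Phi w) * Phi z) / gpdf w by rewrite /f2; ring.
rewrite e ler_pdivrMr// ler_pdivlMr//.
have [w0|w0] := leP w 0; last first.
  have := mulPhiC_le (ltW w0).
  have : 0 <= w * (1 - Phi w) by apply: mulr_ge0; lra.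
  nra.
have h := mulPhi_le w0; have := Phi_nondecr wz => h2.
have h3 : - w * Phi z <= - w * Phi w by rewrite ler_wpM2l//; lra.
have : 0 <= - w * Phi z by apply: mulr_ge0; lra.
nra.
Qed.

Lemma stein_norm_le w : `|stein w| <= C.
Proof.
rewrite /stein; case: ifPn => [/f1_bound|]; last rewrite -ltNge => /ltW/f2_bound.
all: by move=> /andP[h0 h1]; rewrite ger0_norm.
Qed.

Lemma dstein_norm_le w : `|dstein w| <= 2.
Proof.
have z0 := Phi_ge0 z; have z1 := Phi_le1 z.
rewrite /dstein /stein ler_norml.
case: ifPn => [/wf1_bound|]; last rewrite -ltNge => /ltW/wf2_bound.
all: move=> /andP[h0 h1] /=; lra.
Qed.

Let df1 w : is_derive w 1 f1 (w * f1 w + 1 - Phi z).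
Proof.
have g0 : gpdf w != 0 by rewrite gt_eqF// gpdf_gt0.
have h1 := is_derive_gpdf w; have h2 := is_derive_Phi w.
apply: is_derive_eq; rewrite /f1 /GRing.scale/=; field.
by rewrite g0.
Qed.

Let df2 w : is_derive w 1 f2 (w * f2 w - Phi z).
Proof.
have g0 : gpdf w != 0 by rewrite gt_eqF// gpdf_gt0.
have h1 := is_derive_gpdf w; have h2 := is_derive_Phi w.
apply: is_derive_eq; rewrite /f2 /GRing.scale/=; field.
by rewrite g0.
Qed.

Let f12 : f1 z = f2 z.
Proof. by rewrite /f1 /f2; ring. Qed.

(** Restricted to intervals that do not straddle z, where the derivative jumps. *)
Lemma stein_MVT a b : a < b -> b <= z \/ z <= a ->
  exists2 c, a < c < b & stein b - stein a = dstein c * (b - a).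
Proof.
move=> ab [bz|za].
  have [c /andP[ac cb] e] := is_derive_MVT ab (fun w _ => df1 w).
  exists c; first by rewrite ac.
  rewrite /dstein /stein bz (le_trans (ltW ab) bz) (le_trans (ltW cb) bz) e.
  by rewrite /=; ring.
have [c /andP[ac cb] e] := is_derive_MVT ab (fun w _ => df2 w).
exists c; first by rewrite ac.
rewrite /dstein /stein !leNgt (le_lt_trans za ab) (le_lt_trans za ac)/=.
move: za; rewrite le_eqVlt => /predU1P[za|->]/=; last by rewrite e addr0.
have -> : (if ~~ (z < a) then f1 a else f2 a) = f2 a by rewrite -za ltxx.
by rewrite e addr0.
Qed.

Let stein_lip_lt a b : a < b -> `|stein b - stein a| <= 2 * (b - a).
Proof.
have side x y : x < y -> y <= z \/ z <= x ->
    `|stein y - stein x| <= 2 * (y - x).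
  move=> xy /(stein_MVT xy)[c _ ->]; rewrite normrM (gtr0_norm (_ : 0 < y - x)).
    by rewrite ler_wpM2r ?dstein_norm_le// subr_ge0 ltW.
  by rewrite subr_gt0.
move=> ab; have [bz|zb] := leP b z; first by apply: side => //; left.
have [za|az] := leP z a; first by apply: side => //; right.
have -> : stein b - stein a = (stein b - stein z) + (stein z - stein a) by ring.
have h1 := side _ _ zb (or_intror (lexx z)).
have h2 := side _ _ az (or_introl (lexx z)).
by have := ler_normD (stein b - stein z) (stein z - stein a); lra.
Qed.

Lemma stein_lip a b : `|stein b - stein a| <= 2 * `|b - a|.
Proof.
have [ab|ba|->] := ltgtP a b.
- by rewrite (gtr0_norm (_ : 0 < b - a)) ?subr_gt0// stein_lip_lt.
- by rewrite distrC (distrC b) (gtr0_norm (_ : 0 < a - b)) ?subr_gt0// stein_lip_lt.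
- by rewrite !subrr normr0 mulr0.
Qed.

Let dstein_diff w s t :
  `|dstein (w + s) - dstein (w + t)| <=
  (2 * `|w| + C) * (`|s| + `|t|) + (`|w - z| <= `|s| + `|t|)%R%:R.
Proof.
have C0 : 0 <= C by rewrite addr_ge0// invr_ge0 ltW// gpdf_gt0.
rewrite /dstein.
set i1 := (w + s <= z)%R%:R; set i2 := (w + t <= z)%R%:R.
have -> : (w + s) * stein (w + s) + i1 - Phi z -
  ((w + t) * stein (w + t) + i2 - Phi z) =
  w * (stein (w + s) - stein (w + t)) +
  (s * stein (w + s) - t * stein (w + t)) + (i1 - i2) by ring.
apply: le_trans (ler_normD _ _) _; apply: lerD; last first.
  have [h|h] := leP `|w - z| (`|s| + `|t|).
    by rewrite /i1 /i2; case: (w + s <= z); case: (w + t <= z);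
      rewrite /= ?subrr ?normr0 ?subr0 ?sub0r ?normrN ?normr1 ?ler01.
  suff -> : i1 = i2 by rewrite subrr normr0.
  congr ((nat_of_bool _)%:R).
  have := ler_norm s; have := ler_norm t.
  have := ler_norm (- s); have := ler_norm (- t); rewrite !normrN => *.
  have := normr_ge0 s; have := normr_ge0 t => *.
  move: h; case: (leP 0 (w - z)) => wz.
    rewrite (ger0_norm wz) => h; apply/idP/idP => ?; lra.
  by rewrite (ltr0_norm wz) => h; apply/idP/idP => ?; lra.
apply: le_trans (ler_normD _ _) _.
have h1 := stein_lip (w + t) (w + s).
have e1 : `|w + s - (w + t)| <= `|s| + `|t|.
  have -> : w + s - (w + t) = s - t by ring.
  exact: ler_normB.
have h2 := ler_normB (s * stein (w + s)) (t * stein (w + t)).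
have h3 := stein_norm_le (w + s); have h4 := stein_norm_le (w + t).
rewrite !normrM in h2 *.
have ws0 := normr_ge0 w; have t0 := normr_ge0 t; have s0 := normr_ge0 s.
have h5 : `|w| * `|stein (w + s) - stein (w + t)| <= `|w| * (2 * (`|s| + `|t|)).
  by rewrite ler_wpM2l//; lra.
have h6 : `|s| * `|stein (w + s)| <= `|s| * C by rewrite ler_wpM2l.
have h7 : `|t| * `|stein (w + t)| <= `|t| * C by rewrite ler_wpM2l.
nra.
Qed.

(** The Taylor remainder is small only if z is not within |s| + |u| of w, because f' jumps there.
    The indicator charges that event; [concentration_Wo] bounds its probability. *)
Lemma stein_increment w s u :
  `|u * dstein (w + s) - (stein (w + u) - stein w)| <=
  `|u| * ((2 * `|w| + C) * (`|s| + `|u|) +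
          4 * (`|w - z| <= `|s| + `|u|)%R%:R).
Proof.
have C0 : 0 <= C by rewrite addr_ge0// invr_ge0 ltW// gpdf_gt0.
have u0 := normr_ge0 u; have s0 := normr_ge0 s; have w0 := normr_ge0 w.
have A0 : 0 <= (2 * `|w| + C) * (`|s| + `|u|) by rewrite mulr_ge0//; lra.
have [->|un0] := eqVneq u 0; first by rewrite addr0 subrr !mul0r subr0 normr0 mul0r.
(* Holds wherever z lies: 2 from the bound on [dstein] and 2 from the Lipschitz constant of
   [stein]. *)
have crude : `|u * dstein (w + s) - (stein (w + u) - stein w)| <= 4 * `|u|.
  have h1 := ler_normB (u * dstein (w + s)) (stein (w + u) - stein w).
  have h2 := dstein_norm_le (w + s).
  have := stein_lip w (w + u); rewrite (_ : w + u - w = u); last by ring.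
  rewrite normrM in h1; have : `|u| * `|dstein (w + s)| <= `|u| * 2 by rewrite ler_wpM2l.
  lra.
have [h|h] := leP `|w - z| (`|s| + `|u|).
  apply: le_trans crude _; rewrite mulrC ler_wpM2l// mulr1.
  by rewrite lerDr.
suff [t tu e] : exists2 t, `|t| <= `|u| & stein (w + u) - stein w = u * dstein (w + t).
  rewrite e -mulrBr normrM ler_wpM2l// mulr0 addr0.
  apply: le_trans (dstein_diff _ _ _) _.
  have -> : (`|w - z| <= `|s| + `|t|) = false.
    by apply/negbTE; rewrite -ltNge; lra.
  by rewrite addr0 ler_wpM2l//; lra.
have hz : w + u <= z /\ w <= z \/ z <= w + u /\ z <= w.
  have := ler_norm u; have := ler_norm (- u); rewrite !normrN => *.
  move: h; case: (leP 0 (w - z)) => wz.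
    by rewrite (ger0_norm wz) => h; right; split; lra.
  by rewrite (ltr0_norm wz) => h; left; split; lra.
have [u_lt0|u_gt0|] := ltgtP u 0; last by move/eqP; rewrite (negbTE un0).
- have [||c /andP[c1 c2] e] := @stein_MVT (w + u) w; first by lra.
    by case: hz => -[? ?]; [left|right].
  exists (c - w); first by rewrite (ltr0_norm u_lt0) ltr0_norm; lra.
  by rewrite (_ : w + (c - w) = c) -?(opprB (stein w)) ?e; ring.
- have [||c /andP[c1 c2] e] := @stein_MVT w (w + u); first by lra.
    by case: hz => -[? ?]; [left|right].
  exists (c - w); first by rewrite (gtr0_norm u_gt0) gtr0_norm; lra.
  by rewrite (_ : w + (c - w) = c) ?e; ring.
Qed.

End SteinSolution.

End Gaussian.

(** * Berry-Esseen bound *)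

Section FiniteProduct.
Context {R : realType}.
Variables (K : nat) (p x : nat -> nat -> R).
Hypothesis p_ge0 : forall i k, 0 <= p i k.
Hypothesis p_sum1 : forall i, \sum_(k < K) p i k = 1.
Implicit Types (F G : (nat -> R) -> R) (f : nat -> R).

Definition upd f (i : nat) (v : R) : nat -> R := fun j => if j == i then v else f j.

(* Expectation of [F] over the first [n] coordinates, independent and equal to
   [x i k] with probability [p i k]; the other coordinates are 0. *)
Fixpoint Ex n F : R :=
  if n is m.+1 then \sum_(k < K) p m k * Ex m (fun f => F (upd f m (x m k)))
  else F (fun=> 0).

Definition Ei i (g : R -> R) : R := \sum_(k < K) p i k * g (x i k).

Lemma upd_upd f i v w : upd (upd f i v) i w = upd f i w.
Proof. by apply/funext => j; rewrite /upd; case: eqP. Qed.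

Lemma updC f i j v w : i != j -> upd (upd f i v) j w = upd (upd f j w) i v.
Proof.
move=> ij; apply/funext => k; rewrite /upd.
by have [->|//] := eqVneq k j; rewrite eq_sym (negbTE ij).
Qed.

Lemma eq_Ex n F G : F =1 G -> Ex n F = Ex n G.
Proof. by move=> /funext ->. Qed.

Lemma ExD n F G : Ex n (fun f => F f + G f) = Ex n F + Ex n G.
Proof.
elim: n F G => [//|n IHn] F G /=.
by rewrite -big_split/=; apply: eq_bigr => k _; rewrite IHn mulrDr.
Qed.

Lemma ExZ n c F : Ex n (fun f => c * F f) = c * Ex n F.
Proof.
elim: n F => [//|n IHn] F /=.
by rewrite mulr_sumr; apply: eq_bigr => k _; rewrite IHn mulrCA.
Qed.

Lemma ExN n F : Ex n (fun f => - F f) = - Ex n F.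
Proof. by rewrite -mulN1r -ExZ; apply: eq_Ex => f; rewrite mulN1r. Qed.

Lemma ExB n F G : Ex n (fun f => F f - G f) = Ex n F - Ex n G.
Proof. by rewrite ExD ExN. Qed.

Lemma Ex_cst n c : Ex n (fun=> c) = c.
Proof.
elim: n => [//|n IHn] /=.
by under eq_bigr do rewrite IHn; rewrite -mulr_suml p_sum1 mul1r.
Qed.

Lemma Ex_sum (I : Type) (r : seq I) (P : pred I) n (F : I -> (nat -> R) -> R) :
  Ex n (fun f => \sum_(i <- r | P i) F i f) = \sum_(i <- r | P i) Ex n (F i).
Proof.
elim: r => [|i r IHr].
  by rewrite big_nil -[RHS](Ex_cst n); apply: eq_Ex => f; rewrite big_nil.
rewrite big_cons -IHr; case: ifPn => Pi; rewrite -?ExD; apply: eq_Ex => f.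
  by rewrite big_cons Pi.
by rewrite big_cons (negbTE Pi).
Qed.

Lemma Ex_le n F G : (forall f, F f <= G f) -> Ex n F <= Ex n G.
Proof.
elim: n F G => [|n IHn] F G FG /=; first exact: FG.
by apply: ler_sum => k _; rewrite ler_wpM2l//; apply: IHn => f.
Qed.

Lemma Ex_norm n F : `|Ex n F| <= Ex n (fun f => `|F f|).
Proof.
rewrite ler_norml -ExN; apply/andP; split; apply: Ex_le => f.
  by rewrite lerNl -normrN ler_norm.
exact: ler_norm.
Qed.

(** Fubini in coordinate i: the old value is overwritten by an independent one, which separates that
    coordinate from the sum of the others. *)
Lemma Ex_resample n i F : (i < n)%N ->
  Ex n F = \sum_(k < K) p i k * Ex n (fun f => F (upd f i (x i k))).
Proof.
elim: n F => [//|n IHn] F; rewrite ltnS leq_eqVlt => /predU1P[->|ni] /=.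
  apply: eq_bigr => k _; congr (_ * _).
  rewrite -[LHS]mul1r -(p_sum1 n) mulr_suml; apply: eq_bigr => l _.
  by congr (_ * _); apply: eq_Ex => f; rewrite upd_upd.
under eq_bigr do rewrite IHn// mulr_sumr.
rewrite exchange_big/=; apply: eq_bigr => k _.
rewrite mulr_sumr; apply: eq_bigr => l _; rewrite mulrCA; do 2 congr (_ * _).
by apply: eq_Ex => f; rewrite updC// ltn_eqF.
Qed.

Lemma Ei_cst i c : Ei i (fun=> c) = c.
Proof. by rewrite /Ei -mulr_suml p_sum1 mul1r. Qed.

Lemma EiD i (g h : R -> R) : Ei i (fun t => g t + h t) = Ei i g + Ei i h.
Proof. by rewrite -big_split/=; apply: eq_bigr => k _; rewrite mulrDr. Qed.

Lemma EiZ i c (g : R -> R) : Ei i (fun t => c * g t) = c * Ei i g.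
Proof. by rewrite mulr_sumr; apply: eq_bigr => k _; rewrite mulrCA. Qed.

Lemma Ei_le i (g h : R -> R) : (forall t, g t <= h t) -> Ei i g <= Ei i h.
Proof. by move=> gh; apply: ler_sum => k _; rewrite ler_wpM2l. Qed.

Lemma Ex_sum_sqr n (g : nat -> R -> R) : (forall i, Ei i (g i) = 0) ->
  Ex n (fun f => (\sum_(i < n) g i (f i)) ^+ 2) =
  \sum_(i < n) Ei i (fun t => g i t ^+ 2).
Proof.
move=> g0; elim: n => [|n IHn] /=; first by rewrite !big_ord0 expr0n.
have upd_low f k : \sum_(i < n) g i (upd f n (x n k) i) = \sum_(i < n) g i (f i).
  by apply: eq_bigr => i _; rewrite /upd ltn_eqF.
set S := fun f : nat -> R => \sum_(i < n) g i (f i).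
transitivity (\sum_(k < K) (p n k * Ex n (fun f => S f ^+ 2)
  + (2 * Ex n S) * (p n k * g n (x n k)) + p n k * g n (x n k) ^+ 2)).
  apply: eq_bigr => k _.
  transitivity (p n k * Ex n (fun f => S f ^+ 2 + (2 * g n (x n k) * S f + g n (x n k) ^+ 2))).
    congr (_ * _); apply: eq_Ex => f.
    rewrite big_ord_recr/= upd_low [upd f n _ n]/upd eqxx -/(S f); ring.
  by rewrite !ExD ExZ Ex_cst; ring.
rewrite !big_split/= -mulr_suml p_sum1 mul1r IHn big_ord_recr/=; congr (_ + _).
by rewrite -mulr_sumr -/(Ei n (g n)) g0 mulr0 addr0.
Qed.

End FiniteProduct.

(** * Berry-Esseen bound for finitely supported summands *)

Section BerryEsseenFinite.
Context {R : realType}.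
Variables (K : nat) (p x : nat -> nat -> R) (n : nat) (delta : R).
Hypothesis p_ge0 : forall i k, 0 <= p i k.
Hypothesis p_sum1 : forall i, \sum_(k < K) p i k = 1.
Local Notation Ex := (Ex K p x n).
Local Notation Ei := (Ei K p x).
Hypothesis mean0 : forall i, Ei i id = 0.
Hypothesis var1 : \sum_(i < n) Ei i (fun t => t ^+ 2) = 1.
Hypothesis delta_gt0 : 0 < delta.
Hypothesis third : \sum_(i < n) Ei i (fun t => `|t| ^+ 3) <= delta.

Let W (f : nat -> R) : R := \sum_(i < n) f i.
Let Wo (i : nat) (f : nat -> R) : R := \sum_(j < n) (if j == i :> nat then 0 else f j).

Let W_split i f : (i < n)%N -> W f = Wo i f + f i.
Proof.
move=> ni; rewrite /W /Wo (bigD1 (Ordinal ni))//= [in RHS](bigD1 (Ordinal ni))//=.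
rewrite eqxx add0r addrC; congr (_ + _); apply: eq_bigr => j ji.
by rewrite ifF//; apply: contra_neqF ji => /eqP ji; apply: val_inj.
Qed.

Let Wo_upd i f v : Wo i (upd f i v) = Wo i f.
Proof. by apply: eq_bigr => j _; rewrite /upd; case: eqP. Qed.

Let W_upd i f v : (i < n)%N -> W (upd f i v) = Wo i f + v.
Proof. by move=> ni; rewrite (W_split _ ni) Wo_upd /upd eqxx. Qed.

Let Ei_ge0 i (g : R -> R) : (forall t, 0 <= g t) -> 0 <= Ei i g.
Proof. by move=> g0; apply: sumr_ge0 => k _; rewrite mulr_ge0. Qed.

Let norm_le_sqr (t : R) : `|t| <= 2^-1 * (1 + t ^+ 2).
Proof. by rewrite -(real_normK (num_real t)); have := sqr_ge0 (`|t| - 1); nra. Qed.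

Let s2_le1 i : (i < n)%N -> Ei i (fun t => t ^+ 2) <= 1.
Proof.
move=> ni; rewrite -var1 (bigD1 (Ordinal ni))//= lerDl sumr_ge0// => j _.
by apply: Ei_ge0 => t; rewrite sqr_ge0.
Qed.

Let Ex_Wo_sqr i : Ex (fun f => Wo i f ^+ 2) <= 1.
Proof.
rewrite (@Ex_sum_sqr _ _ _ x p_sum1 n (fun j t => if j == i then 0 else t)).
  rewrite -var1; apply: ler_sum => j _; apply: Ei_le => // t.
  by case: eqP => // _; rewrite expr0n sqr_ge0.
by move=> j; case: eqP => // _; rewrite Ei_cst.
Qed.

Let Ex_Wo_norm i : Ex (fun f => `|Wo i f|) <= 1.
Proof.
apply: (@le_trans _ _ (Ex (fun f => 2^-1 * (1 + Wo i f ^+ 2)))).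
  by apply: Ex_le => // f; exact: norm_le_sqr.
rewrite ExZ ExD Ex_cst//; have := Ex_Wo_sqr i; lra.
Qed.

Section Concentration.
Variables (i : nat) (a b : R).
Hypotheses (ni : (i < n)%N) (ab : a <= b) (delta4 : delta <= 4^-1).

Let h := (b - a) / 2 + delta.
(* Concentration: test against a clipped linear function whose slope is 1 around
   [a, b], so that the truncated increments [eta] are counted. *)
Let phi (w : R) : R := Num.max (- h) (Num.min h (w - (a + b) / 2)).
Let eta (t : R) : R := `|t| * Num.min delta `|t|.

Let h_ge0 : 0 <= h. Proof. by have := delta_gt0; have := ab; rewrite /h => *; lra. Qed.

Let phi_norm w : `|phi w| <= h.
Proof.
rewrite ler_norml /phi le_max lexx/= ge_max ge_min lexx/= andbT.
by have := h_ge0; lra.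
Qed.

Let phi_homo w v : w <= v -> phi w <= phi v.
Proof.
move=> wv; rewrite /phi ge_max le_max lexx/= le_max; apply/orP; right.
by rewrite le_min ge_min lexx/= ge_min lerD2r wv orbT.
Qed.

Let phi_lin (w : R) : a - delta <= w <= b + delta -> phi w = w - (a + b) / 2.
Proof.
by move=> wab; rewrite /phi /h min_r ?max_r//; lra.
Qed.

Let phi_mono (w t : R) : 0 <= t * (phi w - phi (w - t)).
Proof.
have [t0|t0] := leP 0 t.
  by rewrite mulr_ge0// subr_ge0 phi_homo//; lra.
by rewrite nmulr_rge0// subr_le0 phi_homo//; lra.
Qed.

Let phi_step w t : a <= w <= b -> eta t <= t * (phi w - phi (w - t)).
Proof.
move=> wab; rewrite /eta (phi_lin (w := w)); last by have := delta_gt0; lra.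
have [td|td] := leP `|t| delta.
  rewrite ler_norml in td; rewrite phi_lin; last by lra.
  by rewrite -expr2 real_normK ?num_real//; nra.
have [t0|t0] := leP 0 t.
  rewrite (ger0_norm t0) in td *.
  have /phi_homo : w - t <= w - delta by lra.
  rewrite (phi_lin (w := w - delta)); last by have := delta_gt0; lra.
  by move=> hh; rewrite ler_wpM2l//; lra.
rewrite (ltr0_norm t0) in td *.
have /phi_homo : w + delta <= w - t by lra.
rewrite (phi_lin (w := w + delta)); last by have := delta_gt0; lra.
by move=> hh; rewrite mulNr -mulrN ler_wnM2l//; [exact: ltW|lra].
Qed.

(** For |t| > delta this is (2 delta - |t|)^2 >= 0 in disguise. It bounds the truncated second
    moments from below through the third moments. *)
Let eta_lower t : t ^+ 2 - (4 * delta)^-1 * `|t| ^+ 3 <= eta t.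
Proof.
rewrite /eta -(real_normK (num_real t)); have t0 := normr_ge0 t.
set u := `|t| in t0 *.
have d4 : 0 < 4 * delta by have := delta_gt0; lra.
have e4 : (4 * delta)^-1 * (4 * delta) = 1 by rewrite mulVf ?gt_eqF.
have i0 : 0 <= (4 * delta)^-1 by rewrite invr_ge0 ltW.
have [ud|ud] := leP u delta.
  have : 0 <= (4 * delta)^-1 * u ^+ 3 by rewrite mulr_ge0// exprn_ge0.
  by rewrite -expr2; lra.
rewrite -subr_ge0.
have -> : u * delta - (u ^+ 2 - (4 * delta)^-1 * u ^+ 3) =
  u * (4 * delta)^-1 * ((4 * delta) * delta - (4 * delta) * u + u ^+ 2).
  have dn : delta != 0 by rewrite gt_eqF.
  by field.
have -> : 4 * delta * delta - 4 * delta * u + u ^+ 2 = (2 * delta - u) ^+ 2 by ring.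
by rewrite mulr_ge0 ?sqr_ge0// mulr_ge0.
Qed.

Let eta_ge0 t : 0 <= eta t.
Proof. by rewrite mulr_ge0// le_min normr_ge0 ltW. Qed.

Let eta_le t : eta t <= delta * `|t|.
Proof. by rewrite /eta mulrC ler_wpM2r// ge_min lexx. Qed.

Let H (f : nat -> R) : R := \sum_(j < n) (if j == i :> nat then 0 else eta (f j)).
Let mu : R := \sum_(j < n) (if j == i :> nat then 0 else Ei j eta).

(** By [eta_lower] the full sum is at least 1 - delta / (4 delta) = 3/4, and the omitted term i is
    at most delta <= 1/4. *)
Let mu_ge : 2^-1 <= mu.
Proof.
have e1 : \sum_(j < n) Ei j eta = mu + Ei i eta.
  rewrite /mu (bigD1 (Ordinal ni))//= [in RHS](bigD1 (Ordinal ni))//=.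
  rewrite eqxx add0r addrC; congr (_ + _); apply: eq_bigr => j ji.
  by rewrite ifF//; apply: contra_neqF ji => /eqP ji; apply: val_inj.
have e2 : Ei i eta <= 4^-1.
  apply: (@le_trans _ _ (Ei i (fun t => delta * (2^-1 * (1 + t ^+ 2))))).
    apply: Ei_le => // t; apply: le_trans (eta_le _) _.
    by apply: ler_wpM2l; [exact: ltW|exact: norm_le_sqr].
  rewrite !EiZ EiD Ei_cst//; apply: le_trans delta4.
  by rewrite ler_piMr ?(ltW delta_gt0)//; have := s2_le1 ni => *; lra.
have e3 : 1 - (4 * delta)^-1 * delta <= \sum_(j < n) Ei j eta.
  rewrite -{1}var1; apply: (@le_trans _ _ (\sum_(j < n)
      Ei j (fun t => t ^+ 2 - (4 * delta)^-1 * `|t| ^+ 3))).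
    have -> : \sum_(j < n) Ei j (fun t => t ^+ 2 - (4 * delta)^-1 * `|t| ^+ 3) =
      \sum_(j < n) Ei j (fun t => t ^+ 2) -
      (4 * delta)^-1 * \sum_(j < n) Ei j (fun t => `|t| ^+ 3).
      rewrite mulr_sumr -sumrB; apply: eq_bigr => j _.
      rewrite -mulNr -EiZ -EiD; congr Ei.
      by apply/funext => t; rewrite mulNr.
    rewrite lerD2l lerN2 ler_wpM2l// invr_ge0; have := delta_gt0; lra.
  by apply: ler_sum => j _; apply: Ei_le.
have e4 : (4 * delta)^-1 * delta = 4^-1.
  by rewrite invfM -mulrA mulVf ?mulr1// gt_eqF.
lra.
Qed.

(** As eta <= delta |t|, the variance of [H] is at most delta^2 times the total variance 1; |u| <=
    (delta + u^2 / delta) / 2 turns this into a first moment. *)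
Let Ex_H_dev : Ex (fun f => `|H f - mu|) <= delta.
Proof.
have dn : delta != 0 by rewrite gt_eqF.
pose g j t := if j == i :> nat then 0 else eta t - Ei j eta.
have Hg f : H f - mu = \sum_(j < n) g j (f j).
  by rewrite /H /mu -sumrB; apply: eq_bigr => j _; rewrite /g; case: eqP => // _; rewrite subrr.
have g0 j : Ei j (g j) = 0.
  rewrite /g; case: eqP => _; first by rewrite Ei_cst.
  by rewrite EiD Ei_cst// subrr.
apply: (@le_trans _ _ (Ex (fun f => 2^-1 * (delta + delta^-1 * (H f - mu) ^+ 2)))).
  apply: Ex_le => // f; rewrite -(real_normK (num_real (H f - mu))).
  set u := `|_|; have i0 : 0 < delta^-1 by rewrite invr_gt0.
  have : 0 <= delta^-1 * (u - delta) ^+ 2 by rewrite mulr_ge0 ?sqr_ge0 ?ltW.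
  have -> : delta^-1 * (u - delta) ^+ 2 = delta^-1 * u ^+ 2 - 2 * u + delta by field.
  lra.
rewrite ExZ ExD ExZ Ex_cst//.
have -> : Ex (fun f => (H f - mu) ^+ 2) = \sum_(j < n) Ei j (fun t => g j t ^+ 2).
  by rewrite -(Ex_sum_sqr (x := x) p_sum1)//; apply: eq_Ex => f; rewrite Hg.
have : \sum_(j < n) Ei j (fun t => g j t ^+ 2) <= delta ^+ 2.
  rewrite -[leRHS]mulr1 -var1 mulr_sumr; apply: ler_sum => j _; rewrite /g.
  case: eqP => _.
    rewrite expr0n Ei_cst// mulr_ge0 ?sqr_ge0//.
    by apply: Ei_ge0 => t; rewrite sqr_ge0.
  apply: (@le_trans _ _ (Ei j (fun t => eta t ^+ 2))).
    have -> : Ei j (fun t => (eta t - Ei j eta) ^+ 2) =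
       Ei j (fun t => eta t ^+ 2) - Ei j eta ^+ 2.
      transitivity (Ei j (fun t => eta t ^+ 2 + ((- 2 * Ei j eta) * eta t + Ei j eta ^+ 2))).
        by congr Ei; apply/funext => t; ring.
      by rewrite !EiD EiZ Ei_cst//; ring.
    by rewrite gerBl sqr_ge0.
  rewrite -EiZ; apply: Ei_le => // t.
  rewrite -(real_normK (num_real t)) -exprMn; have := eta_le t; have := eta_ge0 t.
  by move=> *; rewrite lerXn2r// nnegrE// mulr_ge0// ltW.
have i0 : 0 < delta^-1 by rewrite invr_gt0.
rewrite -(ler_pM2l i0) expr2 mulKf//; lra.
Qed.

(** Since f j is centered and independent of Wo - f j, E[Wo phi(Wo)] is the sum of the means of f j
    (phi(Wo) - phi(Wo - f j)). These are nonnegative, and at least eta (f j) when Wo lies in [a, b];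
    on the other side, |phi| <= h and E|Wo| <= 1. *)
Let Ex_phi : Ex (fun f => (a <= Wo i f <= b)%R%:R * H f) <= h.
Proof.
apply: (@le_trans _ _ (Ex (fun f => Wo i f * phi (Wo i f)))); last first.
  apply: (@le_trans _ _ (Ex (fun f => h * `|Wo i f|))).
    apply: Ex_le => // f; apply: le_trans (ler_norm _) _.
    by rewrite normrM mulrC ler_wpM2r.
  by rewrite ExZ ler_piMr ?h_ge0 ?Ex_Wo_norm.
have -> : Ex (fun f => Wo i f * phi (Wo i f)) = Ex (fun f => \sum_(j < n)
   (if j == i :> nat then 0 else f j * (phi (Wo i f) - phi (Wo i f - f j)))).
  rewrite Ex_sum//.
  transitivity (\sum_(j < n) Ex (fun f => if j == i :> nat then 0 else f j * phi (Wo i f))).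
    rewrite -Ex_sum//; apply: eq_Ex => f; rewrite {1}/Wo mulr_suml.
    by apply: eq_bigr => j _; case: eqP => // _; rewrite mul0r.
  apply: eq_bigr => j _; have [_|ji] := eqVneq (j : nat) i; first by [].
  rewrite -[RHS]addr0 -[in RHS](_ : Ex (fun f => f j * phi (Wo i f - f j)) = 0).
    by rewrite -ExD; apply: eq_Ex => f; ring.
  rewrite (Ex_resample x p_sum1 _ (ltn_ord j)).
  have e f v : Wo i (upd f j v) - v = \sum_(l < n) (if (l == i :> nat) || (l == j) then 0 else f l).
    rewrite /Wo (bigD1 j)//= (negbTE ji) /upd eqxx addrAC subrr add0r.
    rewrite [in RHS](bigD1 j)//= eqxx orbT add0r; apply: eq_bigr => l lj.
    by rewrite (negbTE (lj : l != j :> nat)) (negbTE lj) orbF.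
  under eq_bigr do under eq_Ex do rewrite /upd eqxx -/(upd _ _ _) e.
  under eq_bigr do rewrite ExZ mulrA.
  rewrite -mulr_suml -/(Ei j id) mean0 mul0r //.
apply: Ex_le => // f; rewrite /H mulr_sumr; apply: ler_sum => j _.
case: eqP => _; first by rewrite mulr0.
case: (boolP (a <= Wo i f <= b)) => [wab|_] /=; first by rewrite mul1r phi_step.
by rewrite mul0r phi_mono.
Qed.

(** Replacing the random weight [H] by its mean costs delta; as mu >= 1/2, the probability is at
    most 2 (h + delta) = (b - a) + 4 delta. *)
Lemma concentration_Wo :
  Ex (fun f => (a <= Wo i f <= b)%R%:R) <= (b - a) + 4 * delta.
Proof.
set Pr := Ex _.
have Pr0 : 0 <= Pr by rewrite -(Ex_cst x p_sum1 n 0); apply: Ex_le.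
have : mu * Pr <= h + delta.
  apply: (@le_trans _ _ (Ex (fun f => (a <= Wo i f <= b)%R%:R * H f + `|H f - mu|))).
    rewrite /Pr -ExZ; apply: Ex_le => // f.
    have := ler_norm (mu - H f); rewrite distrC.
    by case: (_ <= _ <= _) => /=; have := normr_ge0 (H f - mu); lra.
  by rewrite ExD lerD ?Ex_phi ?Ex_H_dev.
have := mu_ge; rewrite /h; nra.
Qed.

End Concentration.

Let Cst : R := 1 + (gpdf (1 : R))^-1.

Let Cst_ge0 : 0 <= Cst.
Proof. by rewrite addr_ge0// invr_ge0 ltW// gpdf_gt0. Qed.

(** The left side is E[f'(W) - W f(W)] for the Stein solution f. The first term is distributed over
    i with the variances as weights; in the second, f(Wo) may be subtracted because coordinate i is
    centered. Here x i u is a copy of coordinate i independent of f i. *)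
Let Ex_ind z : Ex (fun f => (W f <= z)%R%:R) - Phi z =
  \sum_(i < n) \sum_(u < K) p i u * (x i u * Ex (fun f =>
    x i u * dstein z (Wo i f + f i) - (stein z (Wo i f + x i u) - stein z (Wo i f)))).
Proof.
transitivity (Ex (fun f => dstein z (W f)) - Ex (fun f => W f * stein z (W f))).
  rewrite -ExB -{1}[Phi z](Ex_cst x p_sum1 n) -ExB.
  by apply: eq_Ex => f; rewrite /dstein; ring.
rewrite -[Ex (fun f => dstein z (W f))]mul1r -var1 mulr_suml.
have -> : Ex (fun f => W f * stein z (W f)) =
  \sum_(i < n) Ex (fun f => f i * stein z (W f)).
  by rewrite -Ex_sum//; apply: eq_Ex => f; rewrite /W mulr_suml.
rewrite -sumrB; apply: eq_bigr => i _.
have e : Ex (fun f => f i * stein z (W f)) =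
    \sum_(u < K) p i u * (x i u * Ex (fun f => stein z (Wo i f + x i u) - stein z (Wo i f))).
  rewrite (Ex_resample x p_sum1 _ (ltn_ord i)).
  transitivity (\sum_(u < K) (p i u * (x i u * Ex (fun f => stein z (Wo i f + x i u) - stein z
    (Wo i f)))
     + p i u * x i u * Ex (fun f => stein z (Wo i f)))).
    apply: eq_bigr => u _; rewrite -[p i u * x i u * _]mulrA -!mulrDr; congr (_ * _);
      rewrite -ExD -ExZ.
    apply: eq_Ex => f; rewrite W_upd// /upd eqxx; congr (_ * _); ring.
  by rewrite big_split/= -mulr_suml -/(Ei i id) mean0 mul0r addr0.
rewrite e [Ei i _ * _]mulr_suml -sumrB; apply: eq_bigr => u _.
rewrite [in RHS]ExB [in RHS]ExZ !mulrBr; congr (_ - _).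
rewrite expr2 -!mulrA; do 3 congr (_ * _).
by apply: eq_Ex => f; rewrite (W_split f (ltn_ord i)).
Qed.

Let window i (z r : R) : (i < n)%N -> delta <= 4^-1 -> 0 <= r ->
  Ex (fun f => (`|Wo i f - z| <= r)%R%:R) <= 2 * r + 4 * delta.
Proof.
move=> ni d4 r0.
have := @concentration_Wo i (z - r) (z + r) ni _ d4.
rewrite (_ : z + r - (z - r) = 2 * r); last by ring.
move=> /(_ ltac:(lra)); apply: le_trans.
by apply: Ex_le => // f; rewrite ler_distl.
Qed.

Lemma berry_esseen_finite z :
  `|Ex (fun f => (W f <= z)%R%:R) - Phi z| <= (36 + 2 * Cst) * delta.
Proof.
have C0 := Cst_ge0.
(* For delta > 1/4 the right side exceeds 1 and the bound is trivial; the concentration inequality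
   needs the other case. *)
have [d4|d4] := leP delta 4^-1; last first.
  have h1 : 0 <= Ex (fun f => (W f <= z)%R%:R).
    by rewrite -(Ex_cst x p_sum1 n 0); apply: Ex_le.
  have h2 : Ex (fun f => (W f <= z)%R%:R) <= 1.
    by rewrite -[leRHS](Ex_cst x p_sum1 n); apply: Ex_le => // f; rewrite lern1 leq_b1.
  have := Phi_ge0 z; have := Phi_le1 z => h3 h4.
  apply: (@le_trans _ _ 1); last by nra.
  by rewrite ler_norml; lra.
rewrite Ex_ind.
(* [stein_increment] averaged over Wo: with r = |x i s| + |x i u|, E|Wo| <= 1 gives (2 + Cst) r and
   the window of radius r gives 4 (2 r + 4 delta). *)
pose T i u s := (10 + Cst) * (`|x i s| + `|x i u|) + 16 * delta.
apply: (@le_trans _ _ (\sum_(i < n) \sum_(u < K) \sum_(s < K)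
    p i u * (p i s * (x i u ^+ 2 * T i u s)))).
  apply: le_trans (ler_norm_sum _ _ _) _; apply: ler_sum => i _.
  apply: le_trans (ler_norm_sum _ _ _) _; apply: ler_sum => u _.
  rewrite normrM (ger0_norm (p_ge0 _ _)) -mulr_sumr ler_wpM2l// normrM.
  apply: (@le_trans _ _ (`|x i u| * Ex (fun f => `|x i u| *
     ((2 * `|Wo i f| + Cst) * (`|f i| + `|x i u|) +
          4 * (`|Wo i f - z| <= `|f i| + `|x i u|)%R%:R)))).
    rewrite ler_wpM2l//; apply: le_trans; first exact: Ex_norm.
    by apply: Ex_le => // f; exact: stein_increment.
  rewrite ExZ mulrA -expr2 real_normK ?num_real//.
  rewrite (Ex_resample x p_sum1 _ (ltn_ord i)) mulr_sumr; apply: ler_sum => s _.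
  rewrite mulrCA ler_wpM2l// ler_wpM2l ?sqr_ge0//.
  have r0 : 0 <= `|x i s| + `|x i u| by rewrite addr_ge0.
  have w := window z (ltn_ord i) d4 r0.
  apply: (@le_trans _ _ (Ex (fun f =>
     (2 * (`|x i s| + `|x i u|)) * `|Wo i f| + (Cst * (`|x i s| + `|x i u|)
          + 4 * (`|Wo i f - z| <= `|x i s| + `|x i u|)%R%:R)))).
    by apply: Ex_le => // f; rewrite Wo_upd /upd eqxx; lra.
  rewrite !ExD !ExZ Ex_cst// /T.
  have := Ex_Wo_norm i => w1.
  have : 2 * (`|x i s| + `|x i u|) * Ex (fun f => `|Wo i f|) <= 2 * (`|x i s| + `|x i u|) * 1.
    by rewrite ler_wpM2l// mulr_ge0.
  nra.
apply: (@le_trans _ _ (\sum_(i < n) ((20 + 2 * Cst) * Ei i (fun t => `|t| ^+ 3)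
     + 16 * delta * Ei i (fun t => t ^+ 2)))); last first.
  rewrite big_split/= -!mulr_sumr var1 mulr1.
  have : (20 + 2 * Cst) * (\sum_(i < n) Ei i (fun t => `|t| ^+ 3)) <= (20 + 2 * Cst) * delta.
    by rewrite ler_wpM2l//; lra.
  lra.
apply: ler_sum => i _.
(* Young's inequality A^2 B <= (2 A^3 + B^3) / 3 decouples the coordinate from its copy: A^2 (A + B)
   <= (5 A^3 + B^3) / 3, and 5/3 + 1/3 = 2 third moments remain. *)
apply: (@le_trans _ _ (\sum_(u < K) \sum_(s < K) p i u * (p i s *
   ((10 + Cst) * (3^-1 * (5 * `|x i u| ^+ 3 + `|x i s| ^+ 3)) + 16 * delta * x i u ^+ 2)))).
  apply: ler_sum => u _; apply: ler_sum => s _.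
  do 2 rewrite ler_wpM2l//.
  rewrite /T mulrDr [_ * (16 * _)]mulrC lerD2r mulrCA ler_wpM2l//; first lra.
  rewrite -(real_normK (num_real (x i u))).
  have a0 := normr_ge0 (x i u); have b0 := normr_ge0 (x i s).
  set A := `|x i u| in a0 *; set B := `|x i s| in b0 *.
  have : 0 <= (A - B) ^+ 2 * (2 * A + B) by rewrite mulr_ge0 ?sqr_ge0//; lra.
  nra.
have Ei3 : Ei i (fun t => `|t| ^+ 3) = \sum_(k < K) p i k * `|x i k| ^+ 3 by [].
have Ei2 : Ei i (fun t => t ^+ 2) = \sum_(k < K) p i k * x i k ^+ 2 by [].
apply: (@le_trans _ _ (\sum_(u < K) (p i u * ((10 + Cst) * (3^-1 * 5 * `|x i u| ^+ 3) + 16 *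
  delta * x i u ^+ 2)
   + p i u * ((10 + Cst) * 3^-1 * Ei i (fun t => `|t| ^+ 3))))).
  apply: le_of_eq; apply: eq_bigr => u _.
  transitivity (p i u * \sum_(s < K) (p i s * ((10 + Cst) * (3^-1 * 5 * `|x i u| ^+ 3) + 16 *
    delta * x i u ^+ 2)
    + (10 + Cst) * 3^-1 * (p i s * `|x i s| ^+ 3))).
    by rewrite mulr_sumr; apply: eq_bigr => s _; ring.
  by rewrite big_split/= -mulr_suml p_sum1 mul1r -mulr_sumr -Ei3 mulrDr.
rewrite big_split/= -mulr_suml p_sum1 mul1r.
have -> : \sum_(u < K) p i u * ((10 + Cst) * (3^-1 * 5 * `|x i u| ^+ 3) + 16 * delta * x i u ^+ 2) =
  (10 + Cst) * (3^-1 * 5) * Ei i (fun t => `|t| ^+ 3) + 16 * delta * Ei i (fun t => t ^+ 2).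
  by rewrite Ei3 Ei2 !mulr_sumr -big_split/=; apply: eq_bigr => u _; ring.
lra.
Qed.

End BerryEsseenFinite.

(** * Extension to laws on the natural numbers by truncation *)

Section BerryEsseenNat.
Context {R : realType}.
Implicit Types (a b q : nat -> R).

Definition convol a b (k : nat) : R := \sum_(j < k.+1) a j * b (k - j)%N.

Fixpoint iconvol (q : nat -> nat -> R) n : nat -> R :=
  if n is m.+1 then convol (q m) (iconvol q m) else fun k => (k == 0)%N%:R.

Lemma convol_cdf a b N (y : R) : y < N%:R ->
  \sum_(l < N) (l%:R <= y)%R%:R * convol a b l =
  \sum_(j < N) a j * \sum_(i < N) (i%:R <= y - j%:R)%R%:R * b i.
Proof.
move=> yN; pose G l j : R := (l%:R <= y)%R%:R * (a j * b (l - j)%N).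
transitivity (\sum_(l < N) \sum_(j < N | (j <= l)%N) G l j).
  apply: eq_bigr => l _; rewrite /convol mulr_sumr.
  by rewrite (big_ord_widen N (fun j => G l j)).
rewrite (exchange_big_dep xpredT)//=; apply: eq_bigr => j _; rewrite mulr_sumr.
transitivity (\sum_(j <= l < N) G l j).
  by rewrite big_geq_mkord.
rewrite -{1}[j : nat]add0n big_addn big_mkord.
rewrite (big_ord_widen N (fun l => G (l + j)%N j)) ?leq_subr// big_mkcond/=.
apply: eq_bigr => i _; rewrite /G addnK.
case: ifPn => [_|]; first by rewrite natrD lerBrDr mulrCA.
rewrite -leqNgt leq_subLR => Nij.
rewrite [(i%:R <= _)%R](_ : _ = false) ?mul0r ?mulr0//.
by apply/negbTE; rewrite -ltNge ltrBlDr -natrD (lt_le_trans yN)// ler_nat addnC.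
Qed.

Lemma cvg_ord_sum n (f : nat -> nat -> R) (l : nat -> R) :
  (forall i, f i N @[N --> \oo] --> l i) ->
  \sum_(i < n) f i N @[N --> \oo] --> \sum_(i < n) l i.
Proof.
move=> fl; elim: n => [|n IHn].
  by under eq_fun do rewrite big_ord0; rewrite big_ord0; exact: cvg_cst.
under eq_fun do rewrite big_ord_recr/=; rewrite big_ord_recr/=.
by apply: cvgD => //; exact: fl.
Qed.

Section Truncation.
Variable q : nat -> R.
Hypothesis q_ge0 : forall k, 0 <= q k.
Hypothesis q_sum1 : series q @ \oo --> (1 : R).

(** The mass of [N, oo) is moved to the atom N. The masses below N are unchanged, and the moments
    increase towards those of [q] without exceeding them. *)
Definition trunc N k : R := if (k < N)%N then q k else 1 - series q N.

Lemma trunc_ge0 N k : 0 <= trunc N k.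
Proof.
rewrite /trunc; case: ifP => // _; rewrite subr_ge0.
apply: (cvgr_to_ge q_sum1); near=> M.
rewrite -subr_ge0 sub_series_geq; last by near: M; exact: nbhs_infty_ge.
by apply: sumr_ge0.
Unshelve. all: by end_near. Qed.

Lemma trunc_sum1 N : \sum_(k < N.+1) trunc N k = 1.
Proof.
rewrite big_ord_recr/= {2}/trunc ltnn /series/= big_mkord.
rewrite (eq_bigr (fun k : 'I_N => q k)); first by ring.
by move=> k _; rewrite /trunc ltn_ord.
Qed.

Lemma cvg_trunc_moment (j : nat) (mu : R) :
  series (fun k => k%:R ^+ j * q k) @ \oo --> mu ->
  (forall N, \sum_(k < N.+1) k%:R ^+ j * trunc N k <= mu) /\
  \sum_(k < N.+1) k%:R ^+ j * trunc N k @[N --> \oo] --> mu.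
Proof.
move=> mucvg; set t := fun N : nat => _.
have tE N : \sum_(k < N.+1) k%:R ^+ j * trunc N k =
    series (fun k => k%:R ^+ j * q k) N + N%:R ^+ j * (1 - series q N).
  rewrite big_ord_recr/= [trunc N N]/trunc ltnn; congr (_ + _).
  by rewrite /series/= big_mkord; apply: eq_bigr => k _; rewrite /trunc ltn_ord.
have tle N : \sum_(k < N.+1) k%:R ^+ j * trunc N k <= mu.
  rewrite tE -lerBrDl.
  have h1 : N%:R ^+ j * (series q M - series q N) @[M --> \oo] -->
      N%:R ^+ j * (1 - series q N).
    by apply: cvgMr; apply: cvgB => //; exact: cvg_cst.
  have h2 : series (fun k => k%:R ^+ j * q k) M - series (fun k => k%:R ^+ j * q k) N
      @[M --> \oo] --> mu - series (fun k => k%:R ^+ j * q k) N.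
    by apply: cvgB => //; exact: cvg_cst.
  apply: (ler_cvg_to h1 h2); near=> M.
  have NM : (N <= M)%N by near: M; exact: nbhs_infty_ge.
  rewrite !sub_series_geq// mulr_sumr big_nat [leRHS]big_nat.
  apply: ler_sum => k /andP[Nk _]; rewrite ler_wpM2r// lerXn2r ?nnegrE//.
  by rewrite ler_nat.
split => //; apply: (squeeze_cvgr _ mucvg (cvg_cst mu)).
near=> N; rewrite /t tle andbT tE lerDl mulr_ge0 ?exprn_ge0//.
by have := trunc_ge0 N N; rewrite /trunc ltnn.
Unshelve. all: by end_near. Qed.

End Truncation.

Variables (q : nat -> nat -> R) (n : nat) (m1 m2 m3 : nat -> R).
Hypothesis q_ge0 : forall i k, 0 <= q i k.
Hypothesis q_sum1 : forall i, series (q i) @ \oo --> (1 : R).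
Hypothesis q_m1 : forall i, series (fun k => k%:R * q i k) @ \oo --> m1 i.
Hypothesis q_m2 : forall i, series (fun k => k%:R ^+ 2 * q i k) @ \oo --> m2 i.
Hypothesis q_m3 : forall i, series (fun k => k%:R ^+ 3 * q i k) @ \oo --> m3 i.

Let p N i := trunc (q i) N.
Let mu N i : R := \sum_(k < N.+1) k%:R * p N i k.
Let mu2 N i : R := \sum_(k < N.+1) k%:R ^+ 2 * p N i k.
Let V N : R := \sum_(i < n) (mu2 N i - mu N i ^+ 2).

Let p_ge0 N i k : 0 <= p N i k. Proof. exact: trunc_ge0. Qed.
Let p_sum1 N i : \sum_(k < N.+1) p N i k = 1. Proof. exact: trunc_sum1. Qed.

Let Ex_cdf N m (s y : R) : 0 < s -> y < N%:R ->
  Ex N.+1 (p N) (fun i k => (k%:R - mu N i) / s) m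
    (fun f => (\sum_(i < m) f i <= (y - \sum_(i < m) mu N i) / s)%R%:R) =
  \sum_(l < N) (l%:R <= y)%R%:R * iconvol q m l.
Proof.
move=> s0; elim: m y => [|m IHm] y yN.
  rewrite /= !big_ord0 subr0 pmulr_lge0 ?invr_gt0//.
  case: N yN => [|N] yN; first by rewrite big_ord0 leNgt yN.
  by rewrite big_ord_recl/= mulr1 big1 ?addr0// => i _; rewrite mulr0.
rewrite [iconvol]lock /= -lock [iconvol _ _]/(convol (q m) (iconvol q m)) convol_cdf//.
transitivity (\sum_(k < N.+1) p N m k * \sum_(l < N) (l%:R <= y - k%:R)%R%:R * iconvol q m l).
  apply: eq_bigr => k _; congr (_ * _); rewrite -IHm; last first.
    by rewrite ltrBlDr (lt_le_trans yN)// lerDl.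
  apply: eq_Ex => f; congr ((nat_of_bool _)%:R).
  rewrite !big_ord_recr/= [upd f m _ m]/upd eqxx.
  have -> : \sum_(i < m) upd f m ((k%:R - mu N m) / s) i = \sum_(i < m) f i.
    by apply: eq_bigr => i _; rewrite /upd ltn_eqF.
  by rewrite -lerBrDr -mulrBl; congr (_ <= _ / s); ring.
rewrite big_ord_recr/= [X in _ + X](_ : _ = 0) ?addr0.
  by apply: eq_bigr => k _; rewrite /p /trunc ltn_ord.
rewrite big1 ?mulr0// => l _; rewrite [(_ <= _)%R](_ : _ = false) ?mul0r//.
by apply/negbTE; rewrite -ltNge (lt_le_trans (_ : _ < 0))// subr_lt0.
Qed.

Let cvg_mu i : mu N i @[N --> \oo] --> m1 i.
Proof. by have [] := @cvg_trunc_moment _ (q_ge0 i) (@q_sum1 i) 1%N _ (@q_m1 i). Qed.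

Let cvg_mu2 i : mu2 N i @[N --> \oo] --> m2 i.
Proof. by have [] := @cvg_trunc_moment _ (q_ge0 i) (@q_sum1 i) 2%N _ (@q_m2 i). Qed.

Let mu_le i N : mu N i <= m1 i.
Proof. have [h _] := @cvg_trunc_moment _ (q_ge0 i) (@q_sum1 i) 1%N _ (@q_m1 i).
exact: h N. Qed.

Let mu_ge0 i N : 0 <= mu N i.
Proof. by apply: sumr_ge0 => k _; rewrite mulr_ge0. Qed.

Let mu3_le i N : \sum_(k < N.+1) k%:R ^+ 3 * p N i k <= m3 i.
Proof. by have [] := @cvg_trunc_moment _ (q_ge0 i) (@q_sum1 i) 3%N _ (@q_m3 i). Qed.

Let cvg_V : V N @[N --> \oo] --> \sum_(i < n) (m2 i - m1 i ^+ 2).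
Proof.
apply: (@cvg_ord_sum n (fun i N => mu2 N i - mu N i ^+ 2) (fun i => m2 i - m1 i ^+ 2)) => i.
by apply: cvgB => //; rewrite -[m1 i ^+ 2]/(m1 i * m1 i); apply: cvgM.
Qed.

Let norm_sub_cube (a b : R) : 0 <= a -> 0 <= b -> `|a - b| ^+ 3 <= a ^+ 3 + b ^+ 3.
Proof.
move=> a0 b0; have [ab|ba] := leP a b.
  rewrite ler0_norm ?subr_le0// opprB.
  have h1 : 0 <= a * b * (b - a) by rewrite !mulr_ge0// subr_ge0.
  have h2 : 0 <= a ^+ 3 by rewrite exprn_ge0.
  nra.
have ba' := ltW ba; rewrite ger0_norm ?subr_ge0//.
have : 0 <= a * b * (a - b) by rewrite !mulr_ge0// subr_ge0.
have : 0 <= b ^+ 3 by rewrite exprn_ge0.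
nra.
Qed.

Variables (B : R).
Hypothesis B_gt0 : 0 < B.
Hypothesis third : \sum_(i < n) (m3 i + m1 i ^+ 3) <= B.
Let Vl : R := \sum_(i < n) (m2 i - m1 i ^+ 2).
Hypothesis Vl_gt0 : 0 < Vl.

Let truncated_bound N (y : R) : 0 < V N -> y < N%:R ->
  `|\sum_(l < N) (l%:R <= y)%R%:R * iconvol q n l -
    Phi ((y - \sum_(i < n) mu N i) / Num.sqrt (V N))| <=
  (36 + 2 * (1 + (gpdf (1 : R))^-1)) * (B / Num.sqrt (V N) ^+ 3).
Proof.
move=> V0 yN; set s := Num.sqrt (V N).
have s0 : 0 < s by rewrite sqrtr_gt0.
have sn0 : s != 0 by rewrite gt_eqF.
rewrite -(Ex_cdf n s0 yN).
have EiE i (g : R -> R) : Ei N.+1 (p N) (fun i k => (k%:R - mu N i) / s) i g =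
  \sum_(k < N.+1) p N i k * g ((k%:R - mu N i) / s) by [].
apply: berry_esseen_finite => //.
- move=> i; rewrite EiE; transitivity ((mu N i - mu N i * \sum_(k < N.+1) p N i k) / s).
    rewrite mulr_sumr -sumrB mulr_suml; apply: eq_bigr => k _; ring.
  by rewrite p_sum1 mulr1 subrr mul0r.
- have -> : \sum_(i < n) Ei N.+1 (p N) (fun i k => (k%:R - mu N i) / s) i (fun t => t ^+ 2)
     = V N / s ^+ 2.
    rewrite /V mulr_suml; apply: eq_bigr => i _; rewrite EiE.
    transitivity (\sum_(k < N.+1) (k%:R ^+ 2 * p N i k + (- 2 * mu N i) * (k%:R * p N i k)
        + mu N i ^+ 2 * p N i k) / s ^+ 2).
      by apply: eq_bigr => k _; field.
    rewrite -mulr_suml !big_split/= -!mulr_sumr p_sum1 -/(mu N i) -/(mu2 N i).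
    by congr (_ / _); ring.
  by rewrite sqr_sqrtr ?divff ?gt_eqF// ltW.
- by rewrite divr_gt0// exprn_gt0.
- apply: (@le_trans _ _ (\sum_(i < n) (m3 i + m1 i ^+ 3) / s ^+ 3)); last first.
    by rewrite -mulr_suml ler_wpM2r// invr_ge0 exprn_ge0// ltW.
  apply: ler_sum => i _; rewrite EiE.
  apply: (@le_trans _ _ ((\sum_(k < N.+1) k%:R ^+ 3 * p N i k +
       mu N i ^+ 3 * \sum_(k < N.+1) p N i k) / s ^+ 3)); last first.
    rewrite p_sum1 mulr1 ler_wpM2r ?invr_ge0 ?exprn_ge0 ?(ltW s0)//.
    by apply: lerD; [exact: mu3_le|rewrite lerXn2r ?nnegrE ?mu_le// (le_trans _ (mu_le i N))].
  rewrite mulr_sumr -big_split/= mulr_suml; apply: ler_sum => k _.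
  rewrite normrM normfV (gtr0_norm s0) expr_div_n mulrA ler_wpM2r//.
    by rewrite invr_ge0 exprn_ge0// ltW.
  by rewrite mulrC -mulrDl ler_wpM2r// norm_sub_cube.
Qed.

(** The finite bound is applied at truncation level N. Once N >= L the distribution function no
    longer depends on N, and the argument of Phi and the bound converge. *)
Theorem berry_esseen_nat L (y : R) : y < L%:R ->
  `|\sum_(l < L) (l%:R <= y)%R%:R * iconvol q n l -
    Phi ((y - \sum_(i < n) m1 i) / Num.sqrt Vl)| <=
  (36 + 2 * (1 + (gpdf (1 : R))^-1)) * (B / Num.sqrt Vl ^+ 3).
Proof.
move=> yL.
have cvg_s : Num.sqrt (V N) @[N --> \oo] --> Num.sqrt Vl.
  by apply: continuous_cvg; [exact: sqrt_continuous|exact: cvg_V].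
have s0 : Num.sqrt Vl != 0 by rewrite gt_eqF// sqrtr_gt0.
have cvg_l : `|\sum_(l < L) (l%:R <= y)%R%:R * iconvol q n l -
    Phi ((y - \sum_(i < n) mu N i) / Num.sqrt (V N))| @[N --> \oo] -->
    `|\sum_(l < L) (l%:R <= y)%R%:R * iconvol q n l -
    Phi ((y - \sum_(i < n) m1 i) / Num.sqrt Vl)|.
  apply: cvg_norm; apply: cvgB; first exact: cvg_cst.
  apply: continuous_cvg.
    apply/differentiable_continuous/derivable1_diffP.
    by have [] := is_derive_Phi ((y - \sum_(i < n) m1 i) / Num.sqrt Vl).
  apply: cvgM; last exact: cvgV.
  apply: cvgB; first exact: cvg_cst.
  by apply: (@cvg_ord_sum n (fun i N => mu N i)) => i.
have cvg_r : (36 + 2 * (1 + (gpdf (1 : R))^-1)) * (B / Num.sqrt (V N) ^+ 3)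
   @[N --> \oo] --> (36 + 2 * (1 + (gpdf (1 : R))^-1)) * (B / Num.sqrt Vl ^+ 3).
  apply: cvgMr; apply: cvgMr; apply: cvgV; first by rewrite expf_neq0.
  by apply: (@continuous_cvg _ _ _ _ _ _ (fun x : R => x ^+ 3)) => //; exact: exprn_continuous.
apply: (ler_cvg_to cvg_l cvg_r); near=> N.
have LN : (L <= N)%N by near: N; exact: nbhs_infty_ge.
have -> : \sum_(l < L) (l%:R <= y)%R%:R * iconvol q n l =
   \sum_(l < N) (l%:R <= y)%R%:R * iconvol q n l.
  rewrite (big_ord_widen N (fun l : nat => (l%:R <= y)%R%:R * iconvol q n l))// big_mkcond/=.
  apply: eq_bigr => l _; case: ifPn => //; rewrite -leqNgt => Ll.
  rewrite [(_ <= _)%R](_ : _ = false) ?mul0r//.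
  by apply/negbTE; rewrite -ltNge (lt_le_trans yL)// ler_nat.
apply: truncated_bound; last by rewrite (lt_le_trans yL)// ler_nat.
near: N; exact: (cvgr_gt _ cvg_V).
Unshelve. all: by end_near. Qed.

End BerryEsseenNat.

(** * First passage of a nearest-neighbor walk *)

Section FirstPassage.
Context {R : realType}.
Variable w : int -> R.

(* Probability that the walk started at [y] visits [n] for the first time at
   time [k]. *)
Fixpoint fpass (n : int) (k : nat) (y : int) : R :=
  if k is k'.+1 then
    if y == n then 0 else w y * fpass n k' (y + 1) + (1 - w y) * fpass n k' (y - 1)
  else (y == n)%:R.

(* Law of the crossing time from [x] to [x + 1]. *)
Definition pmf (x : int) (k : nat) : R := fpass (x + 1) k x.

Lemma fpass_at n k : fpass n k n = (k == 0)%N%:R.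
Proof. by case: k => [|k] /=; rewrite eqxx. Qed.

Lemma convolC (a b : nat -> R) k : convol a b k = convol b a k.
Proof.
rewrite /convol (reindex_inj rev_ord_inj)/=; apply: eq_bigr => j _.
by rewrite subSS mulrC subKn// -ltnS.
Qed.

(** A nearest-neighbor walk cannot jump over m on its way from y to n. The strong Markov property at
    the passage time of m is obtained by induction on time, through the first step. *)
Lemma fpass_convol (n m : int) k (y : int) : y <= m -> m <= n ->
  fpass n k y = convol (fpass m ^~ y) (fpass n ^~ m) k.
Proof.
move=> + mn; elim: k y => [|k IHk] y; rewrite le_eqVlt => /predU1P[->|ym].
- by rewrite /convol big_ord_recl big_ord0 addr0/= eqxx mul1r.
- rewrite /convol big_ord_recl big_ord0 addr0/= [y == m]lt_eqF// mul0r.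
  by rewrite lt_eqF// (lt_le_trans ym).
- rewrite /convol big_ord_recl fpass_at mul1r subn0 big1 ?addr0// => i _.
  by rewrite fpass_at mul0r.
- rewrite /convol big_ord_recl/= [y == m]lt_eqF// mul0r add0r [y == n]lt_eqF ?(lt_le_trans ym)//.
  rewrite !IHk; [|lia..]; rewrite /convol !mulr_sumr -big_split/=.
  apply: eq_bigr => i _; have -> : (k.+1 - bump 0 i = k - i)%N by rewrite /bump; lia.
  have -> : (0 + i = i :> nat)%N by [].
  ring.
Qed.

Lemma fpass_iconvol n k : fpass n%:Z k 0 = iconvol (fun i => pmf i%:Z) n k.
Proof.
elim: n k => [|n IHn] k; first exact: fpass_at.
rewrite (@fpass_convol _ n%:Z); [|lia..]; rewrite convolC.
have -> : fpass n ^~ 0 = iconvol (fun i => pmf i%:Z) n by apply/funext => j.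
by rewrite /= /pmf (_ : n.+1%:Z = n%:Z + 1)//; lia.
Qed.

Lemma pmf0 x : pmf x 0 = 0.
Proof. by rewrite /pmf/= lt_eqF//; lia. Qed.

(** A step to the right ends the crossing; a step to the left must be followed by crossings from x -
    1 and then from x. *)
Lemma pmfS x k :
  pmf x k.+1 = w x * (k == 0)%N%:R + (1 - w x) * convol (pmf (x - 1)) (pmf x) k.
Proof.
rewrite /pmf/= lt_eqF ?fpass_at; last by lia.
by rewrite (@fpass_convol (x + 1) x k (x - 1)) ?subrK//; lia.
Qed.

Hypothesis w01 : forall x, 0 <= w x <= 1.

Lemma fpass_ge0 n k y : 0 <= fpass n k y.
Proof.
elim: k y => [|k IHk] y //=; case: ifP => // _.
by have /andP[? ?] := w01 y; rewrite addr_ge0// mulr_ge0// subr_ge0.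
Qed.

Lemma pmf_ge0 x k : 0 <= pmf x k.
Proof. exact: fpass_ge0. Qed.

Lemma fpass_sum_le1 n N y : \sum_(k < N) fpass n k y <= 1.
Proof.
elim: N y => [|N IHN] y; first by rewrite big_ord0.
rewrite big_ord_recl/=; case: eqP => _; first by rewrite big1 ?addr0.
rewrite add0r big_split/= -!mulr_sumr.
have /andP[w0 w1] := w01 y; have := IHN (y + 1); have := IHN (y - 1).
by move=> *; nra.
Qed.

End FirstPassage.

(** * Law of the hitting times under the quenched measure *)

Section HittingLaw.
Context {R : realType} {d : measure_display} {S : measurableType d}.
Variables (X : nat -> S -> int) (w : int -> R) (Q : probability S R).
Hypothesis w01 : forall x, 0 <= w x <= 1.
Hypothesis walk : is_walk X w 0 Q.

Let prefix (z : nat -> int) m := [set t | forall k, (k <= m)%N -> X k t = z k].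

Let hit m k (n : int) :=
  [set t | (forall j, (m <= j < m + k)%N -> X j t <> n) /\ X (m + k)%N t = n].

Let measurable_Xeq m y : measurable [set t | X m t = y].
Proof. exact: (walk_measurable walk). Qed.

Let measurable_prefix z m : measurable (prefix z m).
Proof.
have -> : prefix z m = \bigcap_(k in [set k | (k <= m)%N]) [set t | X k t = z k].
  by apply/seteqP; split.
by apply: bigcap_measurable => //; exists 0%N.
Qed.

Let measurable_hit m k n : measurable (hit m k n).
Proof.
have -> : hit m k n = (\bigcap_(j in [set j | (m <= j < m + k)%N]) ~` [set t | X j t = n])
   `&` [set t | X (m + k)%N t = n].
  by apply/seteqP; split.
apply: measurableI => //; have [->|k0] := posnP k.
  rewrite (_ : [set j | _] = set0) ?bigcap_set0//.
  by apply/seteqP; split => // j/=; lia.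
by apply: bigcap_measurable; [exists m => /=; lia|move=> j _; exact: measurableC].
Qed.

Let next (z : nat -> int) m (y : int) : nat -> int :=
  fun j => if (j <= m)%N then z j else y.

Let prefix_next z m y :
  prefix (next z m y) m.+1 = prefix z m `&` [set t | X m.+1 t = y].
Proof.
apply/seteqP; split => t /=; rewrite /prefix/= /next.
  by move=> h; split => [k km|]; rewrite h ?km// ?ltnn//; lia.
move=> [h1 h2] k; rewrite leq_eqVlt => /predU1P[->|]; first by rewrite ltnn.
by rewrite ltnS => km; rewrite km h1.
Qed.

Let Q_next z m y :
  Q (prefix (next z m y) m.+1) = (Q (prefix z m) * (step_prob w (z m) y)%:E)%E.
Proof.
rewrite (walk_step walk) /next leqnn ltnn; congr (Q _ * _)%E.
by apply/seteqP; split => t /= h k km; rewrite h// km.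
Qed.

(** The two neighbors of z m already carry the whole mass of the prefix. *)
Let Q_other z m :
  Q (prefix z m `\` [set t | X m.+1 t = z m + 1] `\` [set t | X m.+1 t = z m - 1]) = 0%E.
Proof.
set A := prefix z m; set P := [set t | _ = z m + 1]; set M := [set t | _ = z m - 1].
have mA : measurable A by exact: measurable_prefix.
have mP : measurable P by exact: measurable_Xeq.
have mM : measurable M by exact: measurable_Xeq.
have h1 : Q A = (Q (A `\` P) + Q (A `&` P))%E := measureDI Q mA mP.
have h2 : Q (A `\` P) = (Q (A `\` P `\` M) + Q ((A `\` P) `&` M))%E
  := measureDI Q (measurableD mA mP) mM.
have h3 : (A `\` P) `&` M = A `&` M.
  apply/seteqP; split => t; first by move=> [[At _] Mt].
  move=> [At Mt]; split => //; split => // Pt.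
  by move: Mt Pt; rewrite /M /P/= => ->; lia.
have /andP[w0 w1] := w01 (z m).
have hP : Q (A `&` P) = (Q A * (step_prob w (z m) (z m + 1))%:E)%E.
  by rewrite -Q_next prefix_next.
have hM : Q (A `&` M) = (Q A * (step_prob w (z m) (z m - 1))%:E)%E.
  by rewrite -Q_next prefix_next.
move: h1; rewrite h2 h3 hP hM /step_prob eqxx.
rewrite [z m - 1 == _]lt_eqF ?eqxx; last by lia.
rewrite -/A; set o := Q (A `\` P `\` M).
have fo : o \is a fin_num by rewrite fin_num_measure//; do 2 apply: measurableD => //.
have fA : Q A \is a fin_num by rewrite fin_num_measure.
rewrite -(fineK fo) -(fineK fA) -!EFinM -!EFinD => -[h].
by congr (_%:E); lra.
Qed.

(** The Markov property at time m for hitting events. As [walk_step] speaks of path prefixes only,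
    the event is split by the next position, up to the null set of [Q_other], and the prefix grows
    along the induction on k. *)
Let Q_prefix_hit n k m z :
  Q (prefix z m `&` hit m k n) = (Q (prefix z m) * (fpass w n k (z m))%:E)%E.
Proof.
elim: k m z => [|k IHk] m z /=.
  have [zn|/eqP zn] := eqVneq (z m) n.
    rewrite mule1; congr (Q _); apply/setIidPl => t /= /(_ m (leqnn _)) Xm.
    by split => [j|]; [lia|rewrite addn0 Xm].
  rewrite mule0 (_ : _ `&` _ = set0) ?measure0//; apply/seteqP; split => // t.
  by move=> [/= /(_ m (leqnn _)) Xm [_]]; rewrite addn0 Xm.
have [zn|/eqP zn] := eqVneq (z m) n.
  rewrite mule0 (_ : _ `&` _ = set0) ?measure0//; apply/seteqP; split => // t.
  by move=> [Am [h _]]; apply: (h m); [lia|rewrite (Am m (leqnn _))].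
set A := prefix z m; set E := A `&` _.
set P := [set t | X m.+1 t = z m + 1]; set M := [set t | X m.+1 t = z m - 1].
have mP : measurable P by exact: measurable_Xeq.
have mM : measurable M by exact: measurable_Xeq.
have mE : measurable E.
  by apply: measurableI; [exact: measurable_prefix|exact: measurable_hit].
have -> : Q E = (Q (E `\` P `\` M) + Q ((E `\` P) `&` M) + Q (E `&` P))%E.
  by rewrite (measureDI Q mE mP) (measureDI Q (measurableD mE mP) mM).
have EP y : E `&` [set t | X m.+1 t = y] = prefix (next z m y) m.+1 `&` hit m.+1 k n.
  rewrite prefix_next -/A; apply/seteqP; split => t.
    move=> [[At [h1 h2]] Xy]; split => //; split => [j jm|]; first by apply: h1; lia.
    by rewrite addSnnS.
  move=> [[At Xy] [h1 h2]]; split => //; split => //; split => [j /andP[mj jk]|];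
    last by rewrite -addSnnS.
  move: mj; rewrite leq_eqVlt => /predU1P[<-|mj]; first by rewrite (At m).
  by apply: h1; lia.
have -> : (E `\` P) `&` M = E `&` M.
  apply/seteqP; split => t; first by move=> [[Et _] Mt].
  by move=> [Et Mt]; split => //; split => //; move: Mt; rewrite /P /M/= => ->; lia.
rewrite [X in (X + _ + _)%E](_ : _ = 0%E); last first.
  apply: (subset_measure0 _ _ _ (Q_other z m)) => //.
  - by apply: measurableD => //; exact: measurableD.
  - apply: measurableD; last exact: measurable_Xeq.
    by apply: measurableD; [exact: measurable_prefix|exact: measurable_Xeq].
  - by apply: setSD; apply: setSD => t [].
rewrite add0e [E `&` M]EP [E `&` P]EP !IHk !Q_next /next ltnn /step_prob eqxx.
rewrite [z m - 1 == _]lt_eqF ?eqxx; last by lia.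
have fA : Q A \is a fin_num by rewrite fin_num_measure//; exact: measurable_prefix.
rewrite -/A -(fineK fA) -!EFinM -EFinD; congr (_%:E); ring.
Qed.

Definition first_hit (n : nat) (k : nat) : set S := hit 0 k n%:Z.

Lemma measurable_first_hit n k : measurable (first_hit n k).
Proof. exact: measurable_hit. Qed.

Lemma Q_first_hit n k : Q (first_hit n k) = (fpass w n%:Z k 0)%:E.
Proof.
have m0 : measurable [set t | X 0 t = 0] by [].
have e0 : [set t | X 0 t = 0] = prefix (fun=> 0) 0.
  by apply/seteqP; split => [t Xt j|t /(_ 0%N (leqnn _))//]; rewrite leqn0 => /eqP ->.
have := Q_prefix_hit n%:Z k 0 (fun=> 0); rewrite -e0 (walk_start walk) mul1e => <-.
rewrite (measureDI Q (measurable_first_hit n k) m0) [X in (X + _)%E](_ : _ = 0%E).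
  by rewrite add0e setIC.
apply: (subset_measure0 (B := ~` [set t | X 0 t = 0])) => //.
- by apply: measurableD => //; exact: measurable_first_hit.
- exact: measurableC.
- by have := probability_setC Q m0; rewrite (walk_start walk) subee.
Qed.

Lemma first_hitE n k t : first_hit n k t -> hitting_time R X n t = k%:R%:E.
Proof.
move=> [h1 h2]; apply/eqP; rewrite eq_le; apply/andP; split.
  by apply: ereal_inf_lbound; exists k.
apply: le_ereal_inf_tmp => _ [j Xj <-]; rewrite lee_fin ler_nat leqNgt.
by apply/negP => jk; apply: (h1 j) => //; lia.
Qed.

Lemma hitting_timeP n t : (exists2 k, first_hit n k t & hitting_time R X n t = k%:R%:E) \/
  ((forall k, ~ first_hit n k t) /\ hitting_time R X n t = +oo%E).
Proof.
have [[k Xk]|nX] := pselect (exists k, X k t == n%:Z).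
  left; have exX : exists k, X k t == n%:Z by exists k.
  have [j /eqP Xj jmin] := ex_minnP exX.
  have hj : first_hit n j t.
    by split => // i /andP[_ ij] /eqP Xi; have := jmin _ Xi; lia.
  by exists j => //; exact: first_hitE.
right; split => [k [_ Xk]|]; first by apply: nX; exists k; apply/eqP.
rewrite /hitting_time (_ : [set k | _] = set0) ?image_set0 ?ereal_inf0//.
by apply/seteqP; split => // k Xk; apply: nX; exists k; apply/eqP.
Qed.

Lemma trivIset_first_hit n : trivIset setT (first_hit n).
Proof.
move=> i j _ _ [t [/first_hitE hi /first_hitE]]; rewrite hi => -[] /eqP.
by rewrite eqr_nat => /eqP.
Qed.

Definition never_hit n : set S := ~` \bigcup_k first_hit n k.

Lemma measurable_never_hit n : measurable (never_hit n).
Proof.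
by apply: measurableC; apply: bigcup_measurable => k _; exact: measurable_first_hit.
Qed.

Lemma Q_never_hit n : Q (never_hit n) = (1 - \sum_(k <oo) (fpass w n%:Z k 0)%:E)%E.
Proof.
rewrite probability_setC; last first.
  by apply: bigcup_measurable => k _; exact: measurable_first_hit.
congr (_ - _)%E; rewrite measure_semi_bigcup.
- by apply: eq_eseriesr => k _; exact: Q_first_hit.
- by move=> k; exact: measurable_first_hit.
- exact: trivIset_first_hit.
- by apply: bigcup_measurable => k _; exact: measurable_first_hit.
Qed.

Lemma integral_hitting_time n (g : \bar R -> \bar R) : (forall e, 0 <= e -> 0 <= g e)%E ->
  (\int[Q]_t g (hitting_time R X n t) =
   \sum_(k <oo) (g k%:R%:E * (fpass w n%:Z k 0)%:E) +
   g +oo * (1 - \sum_(k <oo) (fpass w n%:Z k 0)%:E))%E.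
Proof.
(* A partition indexed with a shift: index 0 is the event that n is never hit, index k + 1 that it
   is first hit at time k. *)
move=> g0; pose F k := if k is k'.+1 then first_hit n k' else never_hit n.
have mF k : measurable (F k).
  by case: k => [|k]; [exact: measurable_never_hit|exact: measurable_first_hit].
have tF : trivIset setT F.
  move=> [|i] [|j] _ _ [t [Fi Fj]] //.
  - by exfalso; apply: Fi; exists j.
  - by exfalso; apply: Fj; exists i.
  - by congr _.+1; apply: (@trivIset_first_hit n) => //; exists t.
have T0 t : (0 <= hitting_time R X n t)%E.
  by case: (hitting_timeP n t) => [[k _ ->]|[_ ->]].
have FT : \bigcup_k F k = setT.
  apply/seteqP; split => // t _; case: (hitting_timeP n t) => [[k hk _]|[nh _]].
    by exists k.+1.
  by exists 0%N => // -[k _]; exact: nh.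
have gF k t : F k t -> g (hitting_time R X n t) = if k is k'.+1 then g k'%:R%:E else g +oo%E.
  case: k => [nh|k /first_hitE ->//].
  by case: (hitting_timeP n t) => [[k hk _]|[_ ->//]]; exfalso; apply: nh; exists k.
have intF k : (\int[Q]_(t in F k) g (hitting_time R X n t) =
    (if k is k'.+1 then g k'%:R%:E else g +oo) * Q (F k))%E.
  rewrite -integral_cst//; apply: eq_integral => t; rewrite inE => Ft.
  by rewrite (gF _ _ Ft).
rewrite -FT ge0_integral_bigcup//; last 2 first.
- apply/measurable_fun_bigcup => // k.
  have h : {in F k, cst (if k is k'.+1 then g k'%:R%:E else g +oo%E) =1
      (fun t => g (hitting_time R X n t))}.
    by move=> t; rewrite inE => /gF ->.
  have mc : measurable_fun (F k) (cst (if k is k'.+1 then g k'%:R%:E else g +oo%E)).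
    exact: measurable_cst.
  exact: (eq_measurable_fun _ h mc).
- by move=> t _; exact: g0.
under eq_eseriesr do rewrite intF.
rewrite [LHS](nneseries_recl (P := xpredT))//; last first.
  by move=> [|k] _; rewrite mule_ge0// g0.
rewrite Q_never_hit addeC; congr (_ + _)%E.
rewrite -(@nneseries_addn _ _ 1); last first.
  by move=> [|k]; rewrite mule_ge0// g0.
by apply: eq_eseriesr => k _; rewrite addn1 /= Q_first_hit.
Qed.

Lemma Q_hitting_le n L (y : R) : y < L%:R ->
  Q [set t | (hitting_time R X n t <= y%:E)%E] =
  (\sum_(k < L) (k%:R <= y)%R%:R * fpass w n%:Z k 0)%:E.
Proof.
move=> yL.
have -> : [set t | (hitting_time R X n t <= y%:E)%E] =
    \bigcup_(k in [set k | (k < L)%N]) (if k%:R <= y then first_hit n k else set0).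
  apply/seteqP; split => t /=.
    case: (hitting_timeP n t) => [[k hk ->]|[_ ->]]; last by rewrite leye_eq.
    rewrite lee_fin => ky; exists k; last by rewrite ky.
    by rewrite /= -(ltr_nat R) (le_lt_trans ky).
  by move=> [k _]; case: ifP => // ky /first_hitE ->; rewrite lee_fin.
rewrite bigcup_mkord.
rewrite (@measure_bigsetU _ _ _ Q (fun k => if k%:R <= y then first_hit n k else set0));
  last 2 first.
- by move=> k; case: ifP => // _; exact: measurable_first_hit.
- move=> i j _ _ [t []]; case: ifP => // _; case: ifP => // _ hi hj.
  by apply: (@trivIset_first_hit n) => //; exists t.
rewrite -sumEFin; apply: eq_bigr => k _.
case: ifP => _; first by rewrite mul1r; exact: Q_first_hit.
by rewrite measure0 mul0r.
Qed.

End HittingLaw.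

(** * Moments of the crossing times *)

Section ConvolutionSums.
Context {R : realType}.
Implicit Types a b h : nat -> R.

Lemma sum_convol h a b N :
  \sum_(l < N) h l * convol a b l =
  \sum_(j < N) \sum_(i < N) (i + j < N)%N%:R * (h (i + j)%N * (a j * b i)).
Proof.
pose G l j : R := h l * (a j * b (l - j)%N).
transitivity (\sum_(l < N) \sum_(j < N | (j <= l)%N) G l j).
  apply: eq_bigr => l _; rewrite /convol mulr_sumr.
  by rewrite (big_ord_widen N (fun j => G l j)).
rewrite (exchange_big_dep xpredT)//=; apply: eq_bigr => j _.
transitivity (\sum_(j <= l < N) G l j).
  by rewrite big_geq_mkord.
rewrite -{1}[j : nat]add0n big_addn big_mkord.
rewrite (big_ord_widen N (fun l => G (l + j)%N j)) ?leq_subr// big_mkcond/=.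
apply: eq_bigr => i _; rewrite /G addnK.
rewrite (_ : (i < N - j)%N = (i + j < N)%N); last by lia.
by case: ifP => _; rewrite ?mul1r ?mul0r.
Qed.

Variables (h a b : nat -> R).
Hypotheses (h0 : forall i, 0 <= h i) (a0 : forall i, 0 <= a i) (b0 : forall i, 0 <= b i).

(** The triangle i + j < N lies in the square of side N, which in turn lies in the triangle of size
    2N, as [sum_convol_ge] uses. Truncated moments of a convolution are thus squeezed between
    products of truncated moments. *)
Lemma sum_convol_le N :
  \sum_(l < N) h l * convol a b l <= \sum_(j < N) \sum_(i < N) h (i + j)%N * (a j * b i).
Proof.
rewrite sum_convol; apply: ler_sum => j _; apply: ler_sum => i _.
by case: (_ < _)%N; rewrite ?mul1r ?mul0r// !mulr_ge0.
Qed.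

Lemma sum_convol_ge N :
  \sum_(j < N) \sum_(i < N) h (i + j)%N * (a j * b i) <=
  \sum_(l < N.*2) h l * convol a b l.
Proof.
rewrite sum_convol; have N2 : (N <= N.*2)%N by lia.
pose G (j i : nat) := h (i + j)%N * (a j * b i).
have G0 j i : 0 <= G j i by rewrite !mulr_ge0.
rewrite (big_ord_widen _ (fun j => \sum_(i < N) h (i + j)%N * (a j * b i)) N2) big_mkcond/=.
apply: ler_sum => j _; case: ifPn => jN; last first.
  by apply: sumr_ge0 => i _; rewrite mulr_ge0//; exact: G0.
rewrite (big_ord_widen _ (fun i => h (i + j)%N * (a j * b i)) N2) big_mkcond/=.
apply: ler_sum => i _; case: ifPn => iN; last by rewrite mulr_ge0//; exact: G0.
by rewrite (_ : (i + j < N.*2)%N = true) ?mul1r//; lia.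
Qed.

End ConvolutionSums.

(** * Recursions for the moments of the crossing times *)

Section CrossingMoments.
Context {R : realType}.
Variable w : int -> R.
Hypothesis w01 : forall x, 0 < w x <= 1.

Let w01' x : 0 <= w x <= 1.
Proof. by have /andP[w0 ->] := w01 x; rewrite ltW. Qed.

(** Truncated so as to be finite, at most N^j: the recursions below cancel a moment on both sides
    before its convergence is known. *)
Definition pmom (j N : nat) (x : int) : R := \sum_(k < N) k%:R ^+ j * pmf w x k.

Definition odds (x : int) : R := (1 - w x) / w x.

Lemma odds_ge0 x : 0 <= odds x.
Proof. by have /andP[w0 w1] := w01 x; rewrite divr_ge0 ?subr_ge0// ltW. Qed.

Lemma invw_odds x : (w x)^-1 = 1 + odds x.
Proof.
by rewrite /odds; have /andP[w0 w1] := w01 x; have wn0 : w x != 0; [rewrite gt_eqF|field].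
Qed.

Lemma pmom_ge0 j N x : 0 <= pmom j N x.
Proof. by apply: sumr_ge0 => k _; rewrite mulr_ge0 ?exprn_ge0// pmf_ge0. Qed.

Lemma pmom_homo j x : {homo pmom j ^~ x : m n / (m <= n)%N >-> m <= n}.
Proof.
move=> m n mn; rewrite /pmom (big_ord_widen _ (fun k : nat => k%:R ^+ j * pmf w x k) mn).
rewrite big_mkcond/=; apply: ler_sum => k _; case: ifP => // _.
by rewrite mulr_ge0 ?exprn_ge0// pmf_ge0.
Qed.

Lemma pmom0_le1 N x : pmom 0 N x <= 1.
Proof.
rewrite /pmom; apply: le_trans (fpass_sum_le1 w01' (x + 1) N x).
by apply: ler_sum => k _; rewrite expr0 mul1r.
Qed.

Lemma pmom_le_pow j N x : pmom j N x <= N%:R ^+ j.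
Proof.
apply: (@le_trans _ _ (N%:R ^+ j * pmom 0 N x)).
  rewrite /pmom mulr_sumr; apply: ler_sum => k _; rewrite expr0 mul1r.
  by rewrite ler_wpM2r ?pmf_ge0// lerXn2r ?nnegrE// ler_nat ltnW.
by rewrite ler_piMr ?exprn_ge0// pmom0_le1.
Qed.

(* Moments of [1 + T' + T''] with [T'] and [T''] independent crossing times from
   [x - 1] and [x]: a step to the left is followed by these two crossings. *)
Let box j N x := \sum_(i < N) \sum_(l < N)
  (i.+1 + l)%:R ^+ j * (pmf w (x - 1) i * pmf w x l).

Let pmomS j N x : (0 < N)%N -> pmom j N.+1 x =
  w x + (1 - w x) * \sum_(l < N) l.+1%:R ^+ j * convol (pmf w (x - 1)) (pmf w x) l.
Proof.
move=> N0; rewrite /pmom big_ord_recl pmf0 mulr0 add0r.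
under eq_bigr do rewrite lift0 pmfS mulrDr.
rewrite big_split/=; congr (_ + _); last first.
  by rewrite mulr_sumr; apply: eq_bigr => i _; rewrite mulrCA.
case: N N0 => // N _; rewrite big_ord_recl/= expr1n mul1r mulr1 big1 ?addr0// => i _.
by rewrite mulr0 mulr0.
Qed.

Let pmom_le_box j N x : pmom j N x <= w x + (1 - w x) * box j N x.
Proof.
have /andP[w0 w1] := w01' x; case: N => [|N].
  by rewrite /pmom /box !big_ord0 mulr0 addr0.
apply: le_trans (pmom_homo j x (leqnSn _)) _; rewrite pmomS// lerD2l ler_wpM2l ?subr_ge0//.
apply: le_trans (@sum_convol_le _ (fun l => l.+1%:R ^+ j) _ _ _ _ _ _) _.
- by move=> i; rewrite exprn_ge0.
- exact: pmf_ge0.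
- exact: pmf_ge0.
- by apply: ler_sum => i _; apply: ler_sum => l _; rewrite addSn addnC.
Qed.

Let box_le_pmom j N x : (0 < N)%N ->
  w x + (1 - w x) * box j N x <= pmom j N.*2.+1 x.
Proof.
move=> N0; have /andP[w0 w1] := w01' x.
rewrite pmomS; last by rewrite double_gt0.
rewrite lerD2l ler_wpM2l ?subr_ge0//.
apply: le_trans; last first.
  apply: (@sum_convol_ge _ (fun l => l.+1%:R ^+ j)).
  - by move=> i; rewrite exprn_ge0.
  - exact: pmf_ge0.
  - exact: pmf_ge0.
by apply: ler_sum => i _; apply: ler_sum => l _; rewrite addSn addnC.
Qed.

Local Notation M j N x := (pmom j N x).

Let pmomM i j N x y :
  \sum_(k < N) \sum_(l < N) (k%:R ^+ i * l%:R ^+ j) * (pmf w x k * pmf w y l) =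
  M i N x * M j N y.
Proof.
rewrite /pmom mulr_suml; apply: eq_bigr => k _; rewrite mulr_sumr.
by apply: eq_bigr => l _; ring.
Qed.

Let box0 N x : box 0 N x = M 0 N (x - 1) * M 0 N x.
Proof.
rewrite -pmomM; apply: eq_bigr => i _; apply: eq_bigr => l _.
by rewrite !expr0; ring.
Qed.

Let box1 N x : box 1 N x =
  M 0 N (x - 1) * M 0 N x + M 1 N (x - 1) * M 0 N x + M 0 N (x - 1) * M 1 N x.
Proof.
rewrite -!pmomM -!big_split/=; apply: eq_bigr => i _.
rewrite -!big_split/=; apply: eq_bigr => l _.
by rewrite natrD -natr1; ring.
Qed.

Let box2 N x : box 2 N x =
  M 0 N (x - 1) * M 0 N x + 2 * (M 1 N (x - 1) * M 0 N x) +
  2 * (M 0 N (x - 1) * M 1 N x) + 2 * (M 1 N (x - 1) * M 1 N x) +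
  M 2 N (x - 1) * M 0 N x + M 0 N (x - 1) * M 2 N x.
Proof.
rewrite -!pmomM ![2 * _]mulr_sumr -!big_split/=.
apply: eq_bigr => i _.
rewrite ![2 * _]mulr_sumr -!big_split/=; apply: eq_bigr => l _.
by rewrite natrD -natr1; ring.
Qed.

Let box3 N x : box 3 N x =
  M 0 N (x - 1) * M 0 N x + 3 * (M 1 N (x - 1) * M 0 N x) +
  3 * (M 0 N (x - 1) * M 1 N x) + 6 * (M 1 N (x - 1) * M 1 N x) +
  3 * (M 2 N (x - 1) * M 0 N x) + 3 * (M 0 N (x - 1) * M 2 N x) +
  3 * (M 2 N (x - 1) * M 1 N x) + 3 * (M 1 N (x - 1) * M 2 N x) +
  M 3 N (x - 1) * M 0 N x + M 0 N (x - 1) * M 3 N x.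
Proof.
rewrite -!pmomM ![3 * _]mulr_sumr ![6 * _]mulr_sumr -!big_split/=.
apply: eq_bigr => i _.
rewrite ![3 * _]mulr_sumr ![6 * _]mulr_sumr -!big_split/=; apply: eq_bigr => l _.
by rewrite natrD -natr1; ring.
Qed.

Let M0M j N x y : M 0 N x * M j N y <= M j N y.
Proof. by rewrite ler_piMl ?pmom_ge0 ?pmom0_le1. Qed.

Let MM0 j N x y : M j N x * M 0 N y <= M j N x.
Proof. by rewrite ler_piMr ?pmom_ge0 ?pmom0_le1. Qed.

(** The moment m returns on the right with weight 1 - w y, because a walk that steps left must cross
    from y again. Cancelling it and dividing by w y turns the step probabilities into odds. *)
Let div_w (a b m x : R) (y : int) : m <= w y + (1 - w y) * (1 + a + b + m) ->
  m <= odds y * (a + b) + (1 + odds y).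
Proof.
have /andP[w0 w1] := w01 y => h.
rewrite -invw_odds /odds -(ler_pM2l w0) mulrDr divff ?gt_eqF//.
have -> : w y * ((1 - w y) / w y * (a + b)) = (1 - w y) * (a + b).
  by field; rewrite gt_eqF.
lra.
Qed.

Lemma pmom1_rec N x : M 1 N x <= odds x * M 1 N (x - 1) + (1 + odds x).
Proof.
have /andP[w0 w1] := w01' x.
have h : M 1 N x <= w x + (1 - w x) * (1 + M 1 N (x - 1) + 0 + M 1 N x).
  apply: le_trans (pmom_le_box _ _ _) _; rewrite lerD2l ler_wpM2l ?subr_ge0// box1.
  have := MM0 1 N (x - 1) x; have := M0M 1 N (x - 1) x.
  have := MM0 0 N (x - 1) x; have := pmom0_le1 N (x - 1); lra.
by have := div_w 0 h; rewrite addr0.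
Qed.

Lemma pmom1_le N x : M 1 N x <= (1 + odds x) * (1 + M 1 N (x - 1)).
Proof.
apply: le_trans (pmom1_rec _ _) _.
by have := pmom_ge0 1 N (x - 1); have := odds_ge0 x; nra.
Qed.

Lemma pmom2_rec N x :
  M 2 N x <= odds x * M 2 N (x - 1) + 5 * ((1 + odds x) * (1 + M 1 N (x - 1))) ^+ 2.
Proof.
have /andP[w0 w1] := w01' x.
set m := M 1 N (x - 1); set m' := M 1 N x; set u := 1 + odds x.
have m0 : 0 <= m by exact: pmom_ge0.
have m'0 : 0 <= m' by exact: pmom_ge0.
have u1 : 1 <= u by rewrite lerDl odds_ge0.
have h : M 2 N x <= w x + (1 - w x) *
    (1 + (M 2 N (x - 1)) + (2 * m + 2 * m' + 2 * (m * m')) + M 2 N x).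
  apply: le_trans (pmom_le_box _ _ _) _; rewrite lerD2l ler_wpM2l ?subr_ge0// box2.
  have := MM0 1 N (x - 1) x; have := M0M 1 N (x - 1) x.
  have := MM0 2 N (x - 1) x; have := M0M 2 N (x - 1) x.
  have := MM0 0 N (x - 1) x; have := pmom0_le1 N (x - 1).
  by rewrite -/m -/m'; lra.
apply: le_trans (div_w 0 h) _; rewrite mulrDr -addrA lerD2l.
have hm' : m' <= u * (1 + m) by exact: pmom1_le.
have o1 : odds x <= u by rewrite lerDr.
have o0 := odds_ge0 x.
apply: (@le_trans _ _ (u * (2 * m + 2 * m' + 2 * (m * m')) + u)).
  by rewrite lerD2r ler_wpM2r// !addr_ge0// mulr_ge0// mulr_ge0.
rewrite exprMn.
apply: (@le_trans _ _ (u * (2 * m + 2 * (u * (1 + m)) + 2 * (m * (u * (1 + m)))) + u)).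
  by rewrite lerD2r ler_wpM2l//; nra.
have um : m <= u * (1 + m) by nra.
have e1 : 2 * (m * (u * (1 + m))) + 2 * (u * (1 + m)) = 2 * (u * (1 + m) ^+ 2) by ring.
have e2 : 2 * m + 1 <= u * (1 + m) ^+ 2 by nra.
have : 0 <= u * (u * (1 + m) ^+ 2 - (2 * m + 1)) by rewrite mulr_ge0//; lra.
have : 0 <= u ^+ 2 * (1 + m) ^+ 2 by rewrite mulr_ge0 ?sqr_ge0.
lra.
Qed.

Lemma pmom2_le N x :
  M 2 N x <= 5 * (1 + odds x) ^+ 2 * ((1 + M 1 N (x - 1)) ^+ 2 + M 2 N (x - 1)).
Proof.
apply: le_trans (pmom2_rec _ _) _; rewrite exprMn.
have := odds_ge0 x; have := pmom_ge0 2 N (x - 1); set o := odds x; set m2 := M 2 N _.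
move=> m20 o0; rewrite mulrDr mulrA addrC lerD2l ler_wpM2r//.
nra.
Qed.

Lemma pmom3_rec N x :
  M 3 N x <= odds x * M 3 N (x - 1) + 60 * (1 + odds x) ^+ 3 *
     ((1 + M 1 N (x - 1)) * ((1 + M 1 N (x - 1)) ^+ 2 + M 2 N (x - 1))).
Proof.
have /andP[w0 w1] := w01' x.
set m := M 1 N (x - 1); set m' := M 1 N x; set u := 1 + odds x.
set m2 := M 2 N (x - 1); set m2' := M 2 N x.
have m0 : 0 <= m by exact: pmom_ge0.
have m'0 : 0 <= m' by exact: pmom_ge0.
have m20 : 0 <= m2 by exact: pmom_ge0.
have m2'0 : 0 <= m2' by exact: pmom_ge0.
have u1 : 1 <= u by rewrite lerDl odds_ge0.
pose L := 3 * m + 3 * m' + 6 * (m * m') + 3 * m2 + 3 * m2' + 3 * (m2 * m') + 3 * (m * m2').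
have h : M 3 N x <= w x + (1 - w x) * (1 + M 3 N (x - 1) + L + M 3 N x).
  apply: le_trans (pmom_le_box _ _ _) _; rewrite lerD2l ler_wpM2l ?subr_ge0// box3 /L.
  have := MM0 1 N (x - 1) x; have := M0M 1 N (x - 1) x.
  have := MM0 2 N (x - 1) x; have := M0M 2 N (x - 1) x.
  have := MM0 3 N (x - 1) x; have := M0M 3 N (x - 1) x.
  have := MM0 0 N (x - 1) x; have := pmom0_le1 N (x - 1).
  by rewrite -/m -/m' -/m2 -/m2'; lra.
apply: le_trans (div_w 0 h) _; rewrite mulrDr -addrA lerD2l.
have hm' : m' <= u * (1 + m) by exact: pmom1_le.
have hm2' : m2' <= 5 * u ^+ 2 * ((1 + m) ^+ 2 + m2) by exact: pmom2_le.
have o1 : odds x <= u by rewrite lerDr.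
have L0 : 0 <= L by rewrite /L !addr_ge0// !mulr_ge0.
apply: (@le_trans _ _ (u * L + u)); first by rewrite lerD2r ler_wpM2r.
pose A := 1 + m; pose D := A ^+ 2 + m2.
have A1 : 1 <= A by rewrite lerDl.
have mA : m <= A by rewrite lerDr.
have u0 : 0 <= u by lra.
have D0 : 0 <= D by rewrite addr_ge0 ?sqr_ge0.
have AD : A <= D by rewrite /D; nra.
have D1 : 1 <= D by lra.
have uD : D <= u * D by rewrite ler_peMl.
have uuD : u * D <= u ^+ 2 * D by rewrite expr2 -mulrA ler_peMl// mulr_ge0.
have uAD : u ^+ 2 * D <= u ^+ 2 * (A * D) by rewrite ler_wpM2l ?sqr_ge0// ler_peMl.
have b1 : m <= u ^+ 2 * (A * D) by lra.
have b2 : m' <= u ^+ 2 * (A * D).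
  apply: (le_trans hm'); apply: (@le_trans _ _ (u * D)); last by lra.
  by rewrite ler_wpM2l.
have b3 : m * m' <= u ^+ 2 * (A * D).
  apply: (@le_trans _ _ (A * (u * A))); first by rewrite ler_pM.
  apply: (@le_trans _ _ (u * D)); last by lra.
  rewrite mulrCA ler_wpM2l// /D expr2; lra.
have b4 : m2 <= u ^+ 2 * (A * D).
  by apply: (@le_trans _ _ D); [rewrite /D lerDr sqr_ge0|lra].
have b5 : m2' <= 5 * (u ^+ 2 * (A * D)).
  by apply: (le_trans hm2'); rewrite -/A -/D -mulrA ler_pM2l.
have b6 : m2 * m' <= u ^+ 2 * (A * D).
  apply: (@le_trans _ _ (D * (u * A))).
    by rewrite ler_pM// /D lerDr sqr_ge0.
  rewrite (_ : D * (u * A) = u * (A * D)); last by ring.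
  by rewrite expr2 -mulrA ler_peMl// !mulr_ge0//; lra.
have b7 : m * m2' <= 5 * (u ^+ 2 * (A * D)).
  apply: (@le_trans _ _ (A * (5 * u ^+ 2 * D))); first by rewrite ler_pM.
  by apply: le_of_eq; ring.
have b8 : 1 <= u ^+ 2 * (A * D) by lra.
(* The bounds b1 to b8 add up to 3 + 3 + 6 + 3 + 15 + 3 + 15 + 1 = 49 times u^2 A D, which leaves
   room below 60. *)
have : u * L + u <= u * (60 * (u ^+ 2 * (A * D))).
  have -> : u * L + u = u * (L + 1) by ring.
  by rewrite ler_wpM2l// /L; lra.
by move=> /le_trans; apply; rewrite -/A -/D; apply: le_of_eq; ring.
Qed.

(** The one-step expression lies between the truncated moments at N and 2N + 1, so the recursive
    inequalities become equalities in the limit. *)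
Let cvg_box j x (l : R) : M j N x @[N --> \oo] --> l ->
  w x + (1 - w x) * box j N x @[N --> \oo] --> l.
Proof.
move=> hj; apply: (@squeeze_cvgr _ _ _ _ (fun N => M j N x) (fun N => M j N.*2.+1 x)) => //.
  near=> N; rewrite pmom_le_box box_le_pmom//.
  by near: N; exact: nbhs_infty_gt.
apply: cvg_comp hj => //.
move=> A [n _ nA]; exists n => // k /= nk; apply: nA => /=; lia.
Unshelve. all: by end_near. Qed.

Let cvg_affine (f g : nat -> R) (a l y : R) : (forall N, f N = g N) ->
  g N @[N --> \oo] --> l -> a + y * f N @[N --> \oo] --> a + y * l.
Proof.
move=> fg gl; apply: cvgD; first exact: cvg_cst.
by apply: cvgMr; rewrite (_ : f = g)//; apply/funext.
Qed.

Lemma pmom0_lim (m0 : int -> R) : (forall x, M 0 N x @[N --> \oo] --> m0 x) ->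
  forall x, m0 x = w x + (1 - w x) * (m0 (x - 1) * m0 x).
Proof.
move=> c0 x; apply: (cvg_unique _ (cvg_box (@c0 x))) => //.
by apply: cvg_affine; [move=> N; exact: box0|exact: cvgM].
Qed.

Section Limits.
Variables m1 m2 : int -> R.
Hypothesis c0 : forall x, M 0 N x @[N --> \oo] --> (1 : R).
Hypothesis c1 : forall x, M 1 N x @[N --> \oo] --> m1 x.
Hypothesis c2 : forall x, M 2 N x @[N --> \oo] --> m2 x.

Lemma pmom1_lim x : m1 x = 1 + odds x * (1 + m1 (x - 1)).
Proof.
have h : m1 x = w x + (1 - w x) * (1 * 1 + m1 (x - 1) * 1 + 1 * m1 x).
  apply: (cvg_unique _ (cvg_box (@c1 x))) => //.
  apply: cvg_affine; first by move=> N; exact: box1.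
  by apply: cvgD; [apply: cvgD|]; exact: cvgM.
have /andP[w0 w1] := w01 x; have wn0 : w x != 0 by rewrite gt_eqF.
apply: (mulfI wn0); rewrite /odds mulrDr mulr1 mulrCA mulrA mulfVK//.
by lra.
Qed.

(** An exact identity, since the fluctuations of the summed variances around their linear growth are
    read off from it. *)
Lemma pvar_lim x : m2 x - m1 x ^+ 2 =
  odds x * (m2 (x - 1) - m1 (x - 1) ^+ 2) +
  odds x * (1 + odds x) * (1 + m1 (x - 1)) ^+ 2.
Proof.
have h : m2 x = w x + (1 - w x) * (1 * 1 + 2 * (m1 (x - 1) * 1) + 2 * (1 * m1 x) +
     2 * (m1 (x - 1) * m1 x) + m2 (x - 1) * 1 + 1 * m2 x).
  apply: (cvg_unique _ (cvg_box (@c2 x))) => //.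
  apply: cvg_affine; first by move=> N; exact: box2.
  by do 5?[apply: cvgD]; try apply: cvgMr; apply: cvgM.
have /andP[w0 w1] := w01 x; have wn0 : w x != 0 by rewrite gt_eqF.
have hw : w x * (m2 x) = w x + (1 - w x) * (1 + 2 * m1 (x - 1) + 2 * m1 x +
     2 * (m1 (x - 1) * m1 x) + m2 (x - 1)) by lra.
have -> : m2 x = (w x)^-1 * (w x + (1 - w x) * (1 + 2 * m1 (x - 1) + 2 * m1 x +
     2 * (m1 (x - 1) * m1 x) + m2 (x - 1))) by rewrite -hw mulKf.
by rewrite [m1 x]pmom1_lim /odds; field.
Qed.

End Limits.

End CrossingMoments.

(** * Independence of the past *)

Section Independence.
Context {d : measure_display} {Omega : measurableType d} {R : realType}.
Variables (P : probability Omega R) (om : int -> Omega -> R).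
Hypothesis om_meas : forall x, measurable_fun setT (om x).
Hypothesis om_ident : forall x (B : set R), measurable B ->
  P (om x @^-1` B) = P (om 0 @^-1` B).
Hypothesis om_indep : forall (s : seq int) (B : int -> set R), uniq s ->
  (forall x, measurable (B x)) ->
  P (\bigcap_(x in [set` s]) (om x @^-1` B x)) =
  (\prod_(x <- s) P (om x @^-1` B x))%E.

Definition cylinders (x : int) : set (set Omega) :=
  [set A | exists (s : seq int) (B : int -> set R),
    [/\ uniq s, (forall y, y \in s -> y < x), (forall y, measurable (B y)) &
        A = \bigcap_(y in [set` s]) (om y @^-1` B y)]].

(* [Omega] with the sigma-algebra generated by the environment at the sites
   [y < x]. *)
Definition past (x : int) := g_sigma_algebraType (cylinders x).
HB.instance Definition _ x := Measurable.on (past x).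

Let mpre y (B : set R) : measurable B -> measurable (om y @^-1` B).
Proof. by move=> mB; rewrite -[_ @^-1` _]setTI; exact: om_meas. Qed.

Let cylinders_measurable x : cylinders x `<=` measurable.
Proof.
move=> _ [s [B [us _ mB ->]]]; rewrite bigcap_seq.
by apply: bigsetI_measurable => y _; exact: mpre.
Qed.

Let cylinders_setI x : setI_closed (cylinders x).
Proof.
move=> _ _ [s [B [us sx mB ->]]] [s' [B' [us' sx' mB' ->]]].
exists (undup (s ++ s')), (fun y => (if y \in s then B y else setT) `&`
                            (if y \in s' then B' y else setT)).
split.
- exact: undup_uniq.
- by move=> y; rewrite mem_undup mem_cat => /orP[/sx|/sx'].
- by move=> y; apply: measurableI; case: ifP.
- apply/seteqP; split => u /=.
    move=> [h h'] y /= _; split; case: ifP => //; first exact: h.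
    exact: h'.
  move=> h; split => y /= ys.
    by have := h y; rewrite /= mem_undup mem_cat ys /= => /(_ isT)[].
  by have := h y; rewrite /= mem_undup mem_cat ys orbT /= => /(_ isT)[_].
Qed.

Lemma past_measurable x (A : set Omega) :
  measurable (A : set (past x)) -> measurable A.
Proof.
apply: smallest_sub; first exact: sigma_algebra_measurable.
exact: cylinders_measurable.
Qed.

Lemma past_measurable_fun {d'} {T : measurableType d'} x (f : Omega -> T) :
  measurable_fun [set: past x] f -> measurable_fun [set: Omega] f.
Proof. by move=> mf _ A mA; apply: (@past_measurable x); exact: mf. Qed.

Lemma past_le {d'} {T : measurableType d'} x y (f : Omega -> T) : x <= y ->
  measurable_fun [set: past x] f -> measurable_fun [set: past y] f.
Proof.
move=> xy mf _ A mA; have := mf measurableT A mA.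
apply: smallest_sub; first exact: (@sigma_algebra_measurable _ (past y)).
move=> _ [s [B [us sx mB ->]]]; apply: sub_sigma_algebra.
by exists s, B; split => // z /sx zx; exact: lt_le_trans xy.
Qed.

Lemma measurable_om_past x y : y < x -> measurable_fun [set: past x] (om y).
Proof.
move=> yx _ B mB; apply: sub_sigma_algebra; rewrite setTI.
exists [:: y], (fun=> B); split => //.
- by move=> z; rewrite inE => /eqP ->.
- by apply/seteqP; split => u /= h; [move=> z /=; rewrite inE => /eqP ->|apply: h; rewrite /= inE].
Qed.

(** Both sides are finite measures in A; they agree on the cylinders, which are stable under
    intersection and generate the past. *)
Lemma indep_past_sets x (B : set R) (A : set Omega) :
  measurable B -> measurable (A : set (past x)) ->
  P (om x @^-1` B `&` A) = (P (om x @^-1` B) * P A)%E.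
Proof.
move=> mB mA; have mxB := mpre x mB.
have c0 : 0 <= fine (P (om x @^-1` B)) by rewrite fine_ge0.
have fP : P (om x @^-1` B) \is a fin_num by rewrite fin_num_measure.
have scE A0 : mscale (NngNum c0) P A0 = (P (om x @^-1` B) * P A0)%E.
  transitivity ((fine (P (om x @^-1` B)))%:E * P A0)%E; first by [].
  by rewrite fineK.
have m12 : forall A0, <<s cylinders x >> A0 -> mrestr P mxB A0 = mscale (NngNum c0) P A0.
  apply: (@g_sigma_algebra_measure_unique _ R Omega (cylinders x)
    (@cylinders_measurable x) (fun=> setT) _ _ (mrestr P mxB) (mscale (NngNum c0) P)
    (@cylinders_setI x)).
  - move=> _; exists [::], (fun=> setT); split => //.
    by apply/seteqP; split => // u _ y.
  - by apply/seteqP; split => // u _; exists 0%N.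
  - move=> _ [s [C [us sx mC ->]]]; apply: (etrans _ (esym (scE _))); rewrite /= /mrestr.
    have xs : x \notin s by apply/negP => /sx; rewrite ltxx.
    rewrite setIC.
    have -> : om x @^-1` B `&` \bigcap_(y in [set` s]) om y @^-1` C y =
      \bigcap_(y in [set` x :: s]) om y @^-1` (if y == x then B else C y).
      apply/seteqP; split => u /=.
        move=> [Bu h] y /=; rewrite inE; case: eqP => [->//|_ /=]; exact: h.
      move=> h; split; first by have := h x; rewrite /= mem_head eqxx => /(_ isT).
      move=> y /= ys; have := h y; rewrite /= inE ys orbT ifF; first exact.
      by apply/negbTE; apply: contraNneq xs => <-.
    rewrite om_indep/= ?xs//; last by move=> y; case: ifP.
    rewrite big_cons eqxx om_indep//; congr (_ * _)%E.
    rewrite !big_seq; apply: eq_bigr => y ys; rewrite ifF//.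
    by apply/negbTE; apply: contraNneq xs => <-.
  - move=> k; rewrite /= /mrestr; apply: (le_lt_trans (probability_le1 _ _)).
      exact: measurableI.
    exact: ltry.
by have := m12 A mA; rewrite scE /mrestr setIC.
Qed.

(** The identity of [Omega], seen as a random variable with values in [past x], is independent of om
    x. The law of the pair is then a product measure and Tonelli's theorem applies. *)
Lemma indep_past_integral x (h : R -> \bar R) (f : Omega -> \bar R) :
  measurable_fun setT h -> (forall r, 0 <= h r)%E ->
  measurable_fun [set: past x] f -> (forall u, 0 <= f u)%E ->
  (\int[P]_u (h (om x u) * f u) = \int[P]_u h (om x u) * \int[P]_u f u)%E.
Proof.
move=> mh h0 mf f0.
have mid : measurable_fun [set: Omega] (idfun : Omega -> past x).
  by move=> _ A mA; rewrite setTI; exact: (@past_measurable x).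
pose X1 : {mfun Omega >-> R} := HB.pack (om x) (isMeasurableFun.Build _ _ _ _ _ (om_meas x)).
pose X2 : {mfun Omega >-> past x} := HB.pack (idfun : Omega -> past x) (isMeasurableFun.Build _
  _ _ _ _ mid).
have mpair : measurable_fun [set: Omega] (fun u => (X1 u, X2 u)).
  by apply: measurable_fun_pair.
pose X12 : {mfun Omega >-> (R * past x)%type} := HB.pack (fun u => (X1 u, X2 u))
  (isMeasurableFun.Build _ _ _ _ _ mpair).
pose F (z : R * past x) : \bar R := (h z.1 * f z.2)%E.
have mF : measurable_fun setT F.
  apply: emeasurable_funM; first exact: measurableT_comp.
  exact: (measurableT_comp (f := f : past x -> \bar R)).
have F0 z : (0 <= F z)%E by rewrite mule_ge0.
transitivity (\int[distribution P X12]_z F z)%E.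
  by rewrite ge0_integral_pushforward.
transitivity (\int[(distribution P X1 \x distribution P X2)%E]_z F z)%E.
  apply: eq_measure_integral => A mA _; apply/esym; apply: product_measure_unique => //.
  move=> B C mB mC; rewrite /distribution /pushforward/=.
  by rewrite -indep_past_sets.
rewrite fubini_tonelli1// /fubini_F/= /F.
transitivity (\int[distribution P X1]_r (h r * \int[P]_u f u))%E.
  apply: eq_integral => r _.
  rewrite -[LHS]/(\int[distribution P X2]_y (h r * (f : past x -> \bar R) y))%E.
  rewrite ge0_integralZl//.
  by congr (_ * _)%E; rewrite ge0_integral_pushforward.
rewrite ge0_integralZr//; last exact: integral_ge0.
by congr (_ * _)%E; rewrite ge0_integral_pushforward.
Qed.

Lemma ident_integral x (h : R -> \bar R) :
  measurable_fun setT h -> (forall r, 0 <= h r)%E ->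
  (\int[P]_u h (om x u) = \int[P]_u h (om 0 u))%E.
Proof.
move=> mh h0.
pose X1 y : {mfun Omega >-> R} := HB.pack (om y) (isMeasurableFun.Build _ _ _ _ _ (om_meas y)).
transitivity (\int[distribution P (X1 x)]_r h r)%E.
  by rewrite ge0_integral_pushforward.
transitivity (\int[distribution P (X1 (0 : int))]_r h r)%E.
  apply: eq_measure_integral => A mA _; exact: om_ident.
by rewrite ge0_integral_pushforward.
Qed.

End Independence.

(** * Moments under the law of the environment *)

Section NonnegativeMean.
Context {d : measure_display} {Omega : measurableType d} {R : realType}.
Variable P : probability Omega R.
Implicit Types f g : Omega -> R.

Definition EP f : \bar R := (\int[P]_u (f u)%:E)%E.

Lemma EP_ge0 f : (forall u, 0 <= f u) -> (0 <= EP f)%E.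
Proof. by move=> f0; apply: integral_ge0 => u _; rewrite lee_fin. Qed.

Lemma EP_le f g : measurable_fun setT f -> measurable_fun setT g ->
  (forall u, 0 <= f u) -> (forall u, f u <= g u) -> (EP f <= EP g)%E.
Proof.
move=> mf mg f0 fg; apply: ge0_le_integral => //.
- by move=> u _; rewrite lee_fin.
- exact/measurable_EFinP.
- exact/measurable_EFinP.
- by move=> u _; rewrite lee_fin.
Qed.

Lemma EPD f g : measurable_fun setT f -> measurable_fun setT g ->
  (forall u, 0 <= f u) -> (forall u, 0 <= g u) ->
  EP (fun u => f u + g u)%R = (EP f + EP g)%E.
Proof.
move=> mf mg f0 g0; rewrite -ge0_integralD//.
- by move=> u _; rewrite lee_fin.
- exact/measurable_EFinP.
- by move=> u _; rewrite lee_fin.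
- exact/measurable_EFinP.
Qed.

Lemma EPZ (c : R) f : 0 <= c -> measurable_fun setT f -> (forall u, 0 <= f u) ->
  EP (fun u => c * f u)%R = (c%:E * EP f)%E.
Proof.
move=> c0 mf f0; rewrite -ge0_integralZl//.
- exact/measurable_EFinP.
- by move=> u _; rewrite lee_fin.
Qed.

Lemma EP_cst (c : R) : EP (fun=> c)%R = c%:E.
Proof. by rewrite /EP integral_cst//= (probability_setT P) mule1. Qed.

Lemma measurable_powRf f (s : R) : measurable_fun setT f ->
  measurable_fun setT (fun u => f u `^ s).
Proof. by move=> mf; apply: (measurableT_comp (measurable_powR s)). Qed.

Lemma EP_powD f g (s : R) : 0 <= s -> measurable_fun setT f -> measurable_fun setT g ->
  (forall u, 0 <= f u) -> (forall u, 0 <= g u) ->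
  (EP (fun u => (f u + g u) `^ s)%R <=
   (2 `^ s)%:E * (EP (fun u => f u `^ s)%R + EP (fun u => g u `^ s)%R))%E.
Proof.
move=> s0 mf mg f0 g0.
have mfs := measurable_powRf s mf; have mgs := measurable_powRf s mg.
rewrite -EPD//; try by move=> u; exact: powR_ge0.
rewrite -EPZ ?powR_ge0//; last 2 first.
- exact: measurable_funD.
- by move=> u; rewrite addr_ge0 ?powR_ge0.
apply: EP_le.
- by apply: measurable_powRf; exact: measurable_funD.
- by apply: measurable_funM => //; exact: measurable_funD.
- by move=> u; exact: powR_ge0.
move=> u; have := @powRD_le R s 1 _ _ s0 ltr01 (f0 u) (g0 u).
by rewrite invr1 -mulrDr.
Qed.

End NonnegativeMean.

(** * Moments of the odds and contracting random recursions *)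

Section RandomOdds.
Context {d : measure_display} {Omega : measurableType d} {R : realType}.
Variables (P : probability Omega R) (om : int -> Omega -> R).
Hypothesis om_meas : forall x, measurable_fun setT (om x).
Hypothesis om_ident : forall x (B : set R), measurable B ->
  P (om x @^-1` B) = P (om 0 @^-1` B).
Hypothesis om_indep : forall (s : seq int) (B : int -> set R), uniq s ->
  (forall x, measurable (B x)) ->
  P (\bigcap_(x in [set` s]) (om x @^-1` B x)) =
  (\prod_(x <- s) P (om x @^-1` B x))%E.
Hypothesis om01 : forall x u, 0 < om x u <= 1.

Local Notation past := (past om).
Local Notation EP := (EP P).

Definition rho_ x u : R := odds (om ^~ u) x.

(** A version of (1 - r) / r that is measurable and nonnegative on the whole line; it agrees with
    the odds on (0, 1]. *)
Let oddf (r : R) : R := `|(1 - r) * r `^ (- 1)|.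

Let oddf_meas : measurable_fun setT oddf.
Proof.
apply: measurableT_comp => //; apply: measurable_funM.
  by apply: measurable_funB.
exact: measurable_powR.
Qed.

Let rhoE x u : rho_ x u = oddf (om x u).
Proof.
have /andP[w0 w1] := om01 x u.
rewrite /rho_ /odds /oddf powR_inv1 ?ltW// ger0_norm//.
by rewrite mulr_ge0 ?subr_ge0// invr_ge0 ltW.
Qed.

Lemma rho_ge0 x u : 0 <= rho_ x u.
Proof. by rewrite rhoE normr_ge0. Qed.

Lemma rho_past x y : y < x -> measurable_fun [set: past x] (rho_ y).
Proof.
move=> yx; have -> : rho_ y = oddf \o om y by apply/funext => u; rewrite rhoE.
by apply: measurableT_comp => //; exact: measurable_om_past.
Qed.

Lemma past_meas {d'} {T : measurableType d'} x (f : Omega -> T) :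
  measurable_fun [set: past x] f -> measurable_fun [set: Omega] f.
Proof. exact: past_measurable_fun. Qed.

Lemma rho_meas x : measurable_fun setT (rho_ x).
Proof. by apply: (@past_meas _ _ (x + 1)); apply: rho_past; lia. Qed.

Lemma EP_rhoM x (h : R -> R) (f : Omega -> R) :
  measurable_fun setT h -> (forall r, 0 <= h r) ->
  measurable_fun [set: past x] f -> (forall u, 0 <= f u) ->
  EP (fun u => h (rho_ x u) * f u)%R = (EP (fun u => h (rho_ 0 u))%R * EP f)%E.
Proof.
move=> mh h0 mf f0.
have mh' : measurable_fun setT (fun r => (h (oddf r))%:E).
  by apply/measurable_EFinP; exact: measurableT_comp.
have h0' r : (0 <= (h (oddf r))%:E)%E by rewrite lee_fin.
transitivity (\int[P]_u ((h (oddf (om x u)))%:E * (f u)%:E))%E.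
  by apply: eq_integral => u _; rewrite -EFinM rhoE.
rewrite (indep_past_integral om_meas om_indep mh' h0')//; last by exact/measurable_EFinP.
rewrite (ident_integral om_meas om_ident x mh' h0'); congr (_ * _)%E.
by apply: eq_integral => u _; rewrite -rhoE.
Qed.

Variable p : R.
Hypothesis p_gt0 : 0 < p.
Hypothesis rho_p : (EP (fun u => rho_ 0 u `^ p)%R < 1)%E.

Lemma rho_mom_lt1 s : 0 < s <= p -> (EP (fun u => rho_ 0 u `^ s)%R < 1)%E.
Proof.
move=> /andP[s0 sp].
have th : 0 < s / p <= 1 by rewrite divr_gt0//= ler_pdivrMr// mul1r.
have /andP[th0 th1] := th.
have mp := measurable_powRf p (rho_meas 0); have ms := measurable_powRf s (rho_meas 0).
apply: (@le_lt_trans _ _ (EP (fun u => (1 - s / p) + (s / p) * rho_ 0 u `^ p)%R)).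
  apply: EP_le => //.
  - by apply: measurable_funD => //; apply: measurable_funM.
  - by move=> u; exact: powR_ge0.
  move=> u; have -> : rho_ 0 u `^ s = (rho_ 0 u `^ p) `^ (s / p).
    by rewrite -powRrM mulrCA divff ?gt_eqF// mulr1.
  apply: le_trans (powR_bernoulli (powR_ge0 _ _) _) _; first by rewrite ltW.
  by apply: le_of_eq; ring.
rewrite EPD//; last 3 first.
- by apply: measurable_funM.
- by move=> u; rewrite subr_ge0.
- by move=> u; rewrite mulr_ge0 ?powR_ge0// ltW.
rewrite EP_cst EPZ ?(ltW th0)//; last by move=> u; exact: powR_ge0.
have fin : EP (fun u => rho_ 0 u `^ p)%R \is a fin_num.
  by rewrite ge0_fin_numE ?(lt_trans rho_p) ?ltry// EP_ge0// => u; exact: powR_ge0.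
move: rho_p; rewrite -(fineK fin) -EFinM -EFinD !lte_fin.
move: th0 th1; set t := s / p; set r := fine _; nra.
Qed.

Lemma rho1_mom_fin : exists C : R, 0 <= C /\
  (EP (fun u => (1 + rho_ 0 u) `^ p)%R <= C%:E)%E.
Proof.
exists (2 `^ p * (1 + 1)); split; first by rewrite mulr_ge0 ?powR_ge0.
apply: le_trans (EP_powD _ _ _ _ _ _) _ => //.
- exact: ltW.
- exact: rho_meas.
- exact: rho_ge0.
rewrite EFinM lee_pmul2l ?lte_fin ?powR_gt0//.
rewrite powR1 EP_cst EFinD leeD2l//; exact: ltW.
Qed.

(* The bound [K] only serves to kill the initial term of the iterated recursion:
   the constant [C] does not depend on it. *)
Lemma rec_moment s : 0 < s <= p -> exists C : R, 0 <= C /\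
  forall (Y B : int -> Omega -> R) (K b : R),
    (forall x, measurable_fun [set: past x] (Y (x - 1))) ->
    (forall x, measurable_fun setT (B x)) ->
    (forall x u, 0 <= Y x u <= K) -> (forall x u, 0 <= B x u) ->
    (forall x u, Y x u <= rho_ x u * Y (x - 1) u + B x u) -> 0 <= b ->
    (forall x, EP (fun u => B x u `^ s)%R <= b%:E)%E ->
    forall x, (EP (fun u => Y x u `^ s)%R <= (C * b)%:E)%E.
Proof.
move=> sp; have rs1 := rho_mom_lt1 sp; have /andP[s0 sp'] := sp.
have rfin : EP (fun u => rho_ 0 u `^ s)%R \is a fin_num.
  by rewrite ge0_fin_numE ?(lt_trans rs1) ?ltry// EP_ge0// => u; exact: powR_ge0.
set r := fine (EP (fun u => rho_ 0 u `^ s)%R).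
have rE : EP (fun u => rho_ 0 u `^ s)%R = r%:E by rewrite fineK.
have r0 : 0 <= r by rewrite fine_ge0// EP_ge0// => u; exact: powR_ge0.
have r1 : r < 1 by move: rs1; rewrite rE lte_fin.
(* As r may be 0, it is replaced by the positive r' in (r, 1). Then h is chosen with (1 + h)^s = q =
   (1 + r') / (2 r'), so that (1 + h)^s r <= q r' = t < 1. *)
pose r' := (1 + r) / 2.
have r'0 : 0 < r' by rewrite /r'; lra.
have r'1 : r' < 1 by rewrite /r'; lra.
pose q := (1 + r') / (2 * r').
have q1 : 1 < q by rewrite /q ltr_pdivlMr; lra.
pose h := q `^ s^-1 - 1.
have h0 : 0 < h.
  rewrite /h subr_gt0 (_ : 1 = 1 `^ s^-1); last by rewrite powR1.
  by apply: gt0_ltr_powR; rewrite ?invr_gt0 ?nnegrE//; lra.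
pose t := (1 + r') / 2.
have ht : (1 + h) `^ s * r <= t.
  rewrite /h addrCA subrr addr0 -powRrM mulVf ?gt_eqF// powRr1; last lra.
  apply: (@le_trans _ _ (q * r')); first by rewrite ler_wpM2l /r'; lra.
  by rewrite /q /t; apply: le_of_eq; field; rewrite gt_eqF.
have t0 : 0 <= t by rewrite /t; lra.
have t1 : t < 1 by rewrite /t; lra.
pose C2 := (1 + h^-1) `^ s.
exists (C2 / (1 - t)); split.
  by rewrite divr_ge0 ?powR_ge0// subr_ge0 ltW.
move=> Y B K b mY mB YK B0 YB b0 Bb.
have K0 : 0 <= K by have /andP[/le_trans] := YK 0 point; apply.
have mY' x : measurable_fun setT (Y (x - 1)) by apply: past_meas; exact: mY.
have mYx x : measurable_fun setT (Y x) by have := mY' (x + 1); rewrite addrK.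
pose D := C2 / (1 - t) * b.
have C20 : 0 <= C2 by exact: powR_ge0.
(* D is the fixed point of y |-> t y + C2 b: each iteration reproduces D and shrinks only the term
   carrying K. *)
have DE : t * D + C2 * b = D.
  by rewrite /D; field; rewrite subr_eq0 gt_eqF.
have step n x : (EP (fun u => Y x u `^ s)%R <= (t ^+ n * K `^ s + D)%:E)%E.
  elim: n x => [|n IHn] x.
    rewrite expr0 mul1r; apply: (@le_trans _ _ (EP (fun=> K `^ s)%R)).
      apply: EP_le => //; first exact: measurable_powRf.
      - by move=> u; exact: powR_ge0.
      - move=> u; have /andP[Y0 Y1] := YK x u.
        by apply: ge0_ler_powR; rewrite ?nnegrE// ltW.
    rewrite EP_cst lee_fin lerDl /D mulr_ge0// divr_ge0// subr_ge0 ltW//.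
  have m1 : measurable_fun setT (fun u => rho_ x u `^ s * Y (x - 1) u `^ s).
    by apply: measurable_funM; apply: measurable_powRf => //; exact: rho_meas.
  have m2 : measurable_fun setT (fun u => B x u `^ s) by exact: measurable_powRf.
  apply: (@le_trans _ _ (EP (fun u => (1 + h) `^ s * (rho_ x u `^ s * Y (x - 1) u `^ s)
      + C2 * B x u `^ s)%R)).
    apply: EP_le => //; first exact: measurable_powRf.
    - by apply: measurable_funD; apply: measurable_funM.
    - by move=> u; exact: powR_ge0.
    move=> u; have /andP[Y0 _] := YK x u; have /andP[Y'0 _] := YK (x - 1) u.
    apply: (@le_trans _ _ ((rho_ x u * Y (x - 1) u + B x u) `^ s)).
      apply: ge0_ler_powR; rewrite ?nnegrE ?(ltW s0)//.
      by rewrite addr_ge0// mulr_ge0// rho_ge0.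
    rewrite -powRM ?rho_ge0//; apply: powRD_le => //; first exact: ltW.
    by rewrite mulr_ge0// rho_ge0.
  have p0 (f : Omega -> R) u : 0 <= f u `^ s by exact: powR_ge0.
  rewrite EPD//; last 4 first.
  - by apply: measurable_funM.
  - by apply: measurable_funM.
  - by move=> u; rewrite !mulr_ge0 ?powR_ge0.
  - by move=> u; rewrite mulr_ge0 ?powR_ge0.
  rewrite EPZ ?powR_ge0//; last by move=> u; rewrite mulr_ge0.
  rewrite EPZ//.
  rewrite (@EP_rhoM x (fun r => r `^ s) (fun u => Y (x - 1) u `^ s))//; last 2 first.
  - by move=> v; exact: powR_ge0.
  - exact: (measurableT_comp (measurable_powR s) (mY x)).
  rewrite rE muleA -EFinM exprS.
  apply: (@le_trans _ _ (t%:E * (t ^+ n * K `^ s + D)%:E + C2%:E * b%:E)%E).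
    apply: leeD; last by rewrite lee_wpmul2l.
    apply: lee_pmul => //; first by rewrite lee_fin mulr_ge0 ?powR_ge0.
    by rewrite EP_ge0.
  by rewrite -!EFinM -EFinD lee_fin -{2}DE; apply: le_of_eq; ring.
move=> x; apply/lee_addgt0Pr => e e0.
have : t ^+ n * K `^ s @[n --> \oo] --> (0 : R).
  rewrite -(mul0r (K `^ s)); apply: cvgMl; apply: cvg_expr.
  by rewrite ger0_norm.
move=> /cvgrPdist_lt/(_ e e0)[n _ /(_ n (leqnn _))]; rewrite sub0r normrN => hn.
apply: le_trans (step n x) _; rewrite -EFinD lee_fin addrC lerD2l ltW//.
by apply: le_lt_trans hn; exact: ler_norm.
Qed.

End RandomOdds.

(** * Moment bounds uniform in the truncation level *)

Section CrossingMomentBounds.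
Context {d : measure_display} {Omega : measurableType d} {R : realType}.
Variables (P : probability Omega R) (om : int -> Omega -> R).
Hypothesis om_meas : forall x, measurable_fun setT (om x).
Hypothesis om_ident : forall x (B : set R), measurable B ->
  P (om x @^-1` B) = P (om 0 @^-1` B).
Hypothesis om_indep : forall (s : seq int) (B : int -> set R), uniq s ->
  (forall x, measurable (B x)) ->
  P (\bigcap_(x in [set` s]) (om x @^-1` B x)) =
  (\prod_(x <- s) P (om x @^-1` B x))%E.
Hypothesis om01 : forall x u, 0 < om x u <= 1.

Local Notation past := (past om).
Local Notation EP := (EP P).
Local Notation rho_ := (rho_ om).
Local Notation M j N x := (fun u => pmom (om ^~ u) j N x).

Lemma fpass_past n k y : y <= n ->
  measurable_fun [set: past n] (fun u => fpass (om ^~ u) n k y).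
Proof.
elim: k y => [|k IHk] y; first by move=> _ /=; exact: measurable_cst.
rewrite le_eqVlt /= => /predU1P[->|yn].
  by rewrite eqxx; exact: measurable_cst.
rewrite lt_eqF//; have mw : measurable_fun [set: past n] (om y).
  exact: measurable_om_past.
apply: measurable_funD; apply: measurable_funM => //.
- by apply: IHk; lia.
- by apply: measurable_funB => //; exact: measurable_cst.
- by apply: IHk; lia.
Qed.

Lemma pmom_past j N x : measurable_fun [set: past (x + 1)] (M j N x).
Proof.
apply: measurable_sum => k; apply: measurable_funM; first exact: measurable_cst.
by apply: fpass_past; lia.
Qed.

Lemma pmom_meas j N x : measurable_fun setT (M j N x).
Proof. by apply: (@past_meas _ _ _ _ om_meas _ _ (x + 1)); exact: pmom_past. Qed.

Let M_past j N x : measurable_fun [set: past x] (M j N (x - 1)).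
Proof. by have := @pmom_past j N (x - 1); rewrite subrK. Qed.

Let M01 j N x u : 0 <= M j N x u <= N%:R ^+ j.
Proof. by rewrite pmom_ge0 //= pmom_le_pow. Qed.

Let M_ge0 j N x u : 0 <= M j N x u.
Proof. by have /andP[] := M01 j N x u. Qed.

Variable p : R.
Hypothesis p_gt0 : 0 < p.
Hypothesis rho_p : (EP (fun u => rho_ 0 u `^ p)%R < 1)%E.

Let rho1 : exists C : R, 0 <= C /\ forall x (f : Omega -> R) (b : R),
  measurable_fun [set: past x] f -> (forall u, 0 <= f u) -> (EP f <= b%:E)%E ->
  (EP (fun u => (1 + rho_ x u) `^ p * f u)%R <= (C * b)%:E)%E.
Proof.
have [C [C0 HC]] := rho1_mom_fin om_meas om01 p_gt0 rho_p.
exists C; split => // x f b mf f0 fb.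
rewrite (EP_rhoM om_meas om_ident om_indep om01 (h := fun r => (1 + r) `^ p))//.
- rewrite EFinM; apply: lee_pmul => //; apply: EP_ge0 => // u; exact: powR_ge0.
- by apply: measurable_powRf; apply: measurable_funD.
- by move=> r; exact: powR_ge0.
Qed.

Lemma pmom1_moment : exists C : R, 0 <= C /\
  forall N x, (EP (fun u => M 1 N x u `^ p)%R <= C%:E)%E.
Proof.
have pp : 0 < p <= p by rewrite p_gt0 lexx.
have [C1 [C10 HC1]] := rec_moment om_meas om_ident om_indep om01 p_gt0 rho_p pp.
have [C [C0 HC]] := rho1.
exists (C1 * (C * 1)); split; first by rewrite !mulr_ge0.
move=> N; apply: (HC1 (fun x => M 1 N x) (fun x u => 1 + rho_ x u) (N%:R ^+ 1)) => //.
- by move=> x; apply: measurable_funD => //; exact: rho_meas.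
- by move=> x u; rewrite addr_ge0// rho_ge0.
- by move=> x u; apply: pmom1_rec => y; exact: om01.
- by rewrite mulr_ge0.
- move=> x; have h1 : EP (fun u => (1 + rho_ x u) `^ p)%R =
      EP (fun u => (1 + rho_ x u) `^ p * 1)%R.
    by apply: eq_integral => u _; rewrite mulr1.
  by rewrite h1; apply: HC; rewrite ?EP_cst//; exact: measurable_cst.
Qed.

Let A N x u := 1 + M 1 N (x - 1) u.

Let A_past N x : measurable_fun [set: past x] (A N x).
Proof. by apply: measurable_funD => //; exact: M_past. Qed.

Let A_ge1 N x u : 1 <= A N x u.
Proof. by rewrite lerDl. Qed.

Let A_ge0 N x u : 0 <= A N x u.
Proof. exact: le_trans (A_ge1 _ _ _). Qed.

Let A_moment : exists C : R, 0 <= C /\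
  forall N x, (EP (fun u => A N x u `^ p)%R <= C%:E)%E.
Proof.
have [C [C0 HC]] := pmom1_moment.
exists (2 `^ p * (1 + C)); split; first by rewrite mulr_ge0 ?powR_ge0 ?addr_ge0.
move=> N x; apply: le_trans (EP_powD _ _ _ _ _ _) _ => //; first exact: ltW.
  exact: pmom_meas.
rewrite EFinM lee_pmul2l ?lte_fin ?powR_gt0// powR1 EP_cst EFinD leeD2l//.
Qed.

Lemma pmom2_moment : exists C : R, 0 <= C /\
  forall N x, (EP (fun u => M 2 N x u `^ (p / 2))%R <= C%:E)%E.
Proof.
have p2 : 0 < p / 2 by rewrite divr_gt0.
have pp : 0 < p / 2 <= p by rewrite p2; lra.
have [C1 [C10 HC1]] := rec_moment om_meas om_ident om_indep om01 p_gt0 rho_p pp.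
have [C [C0 HC]] := rho1; have [CA [CA0 HCA]] := A_moment.
exists (C1 * (5 `^ (p / 2) * (C * CA))); split; first by rewrite !mulr_ge0 ?powR_ge0.
move=> N; apply: (HC1 (fun x => M 2 N x)
  (fun x u => 5 * ((1 + rho_ x u) * A N x u) ^+ 2) (N%:R ^+ 2)) => //.
- move=> x; apply: measurable_funM => //; apply: measurable_funX.
  apply: measurable_funM; first by apply: measurable_funD => //; exact: rho_meas.
  exact: (past_meas om_meas (@A_past N x)).
- by move=> x u; rewrite mulr_ge0 ?sqr_ge0.
- by move=> x u; apply: pmom2_rec => y; exact: om01.
- by rewrite !mulr_ge0 ?powR_ge0.
- move=> x; have := HC x (fun u => A N x u `^ p) CA.
  have mAp : measurable_fun [set: past x] (fun u => A N x u `^ p).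
    exact: (measurableT_comp (measurable_powR p) (@A_past N x)).
  move=> /(_ mAp (fun u => powR_ge0 _ _) (HCA N x)) h.
  rewrite EFinM; apply: le_trans (lee_wpmul2l _ h); last by rewrite lee_fin powR_ge0.
  rewrite -EPZ ?powR_ge0//; last 2 first.
  - apply: measurable_funM; last exact: (past_meas om_meas mAp).
    by apply: measurable_powRf; apply: measurable_funD => //; exact: rho_meas.
  - by move=> u; rewrite mulr_ge0 ?powR_ge0.
  apply: le_of_eq; apply: eq_integral => u _; congr EFin.
  have r0 : 0 <= 1 + rho_ x u by rewrite addr_ge0// rho_ge0.
  rewrite powRM ?sqr_ge0// -powR_mulrn ?mulr_ge0// -powRrM mulrCA divff// mulr1 powRM//.
Qed.

(** By homogeneity: with S = max(a, sqrt m), the base is at most 2 S^3, and S^p is either a^p or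
    m^(p/2). This is where the moments of order p of the mean and p/2 of the second moment combine
    into order p/3 for the third. *)
Let cubic_power (a m : R) : 1 <= a -> 0 <= m ->
  (a * (a ^+ 2 + m)) `^ (p / 3) <= 2 `^ (p / 3) * (a `^ p + m `^ (p / 2)).
Proof.
move=> a1 m0; have a0 : 0 <= a by lra.
pose S := Num.max a (Num.sqrt m).
have aS : a <= S by rewrite le_max lexx.
have S0 : 0 <= S by exact: le_trans aS.
have mS : m <= S ^+ 2.
  by rewrite -[leLHS]sqr_sqrtr// lerXn2r ?nnegrE ?sqrtr_ge0// le_max lexx orbT.
have a2 : a ^+ 2 <= S ^+ 2 by rewrite lerXn2r ?nnegrE.
have p3 : 0 <= p / 3 by rewrite divr_ge0// ltW.
apply: (@le_trans _ _ ((2 * S ^+ 3) `^ (p / 3))).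
  apply: ge0_ler_powR; rewrite ?nnegrE ?mulr_ge0 ?addr_ge0 ?exprn_ge0//; try exact: (ltW p_gt0).
  apply: (@le_trans _ _ (S * (S ^+ 2 + S ^+ 2))); last by apply: le_of_eq; ring.
  by apply: ler_pM => //; [rewrite addr_ge0 ?sqr_ge0|exact: lerD].
rewrite powRM ?exprn_ge0// ler_wpM2l ?powR_ge0//.
have -> : (S ^+ 3) `^ (p / 3) = S `^ p.
  by rewrite -powR_mulrn// -powRrM mulrCA divff// mulr1.
rewrite /S; case: (lerP a (Num.sqrt m)) => _; last by rewrite lerDl powR_ge0.
by rewrite -powR12_sqrt// -powRrM mulrC lerDr powR_ge0.
Qed.

Lemma pmom3_moment : exists C : R, 0 <= C /\
  forall N x, (EP (fun u => M 3 N x u `^ (p / 3))%R <= C%:E)%E.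
Proof.
have p3 : 0 < p / 3 by rewrite divr_gt0.
have pp : 0 < p / 3 <= p by rewrite p3; lra.
have [C1 [C10 HC1]] := rec_moment om_meas om_ident om_indep om01 p_gt0 rho_p pp.
have [C [C0 HC]] := rho1; have [CA [CA0 HCA]] := A_moment.
have [C2 [C20 HC2]] := pmom2_moment.
pose b := 2 `^ (p / 3) * (CA + C2).
have b0 : 0 <= b by rewrite mulr_ge0 ?powR_ge0 ?addr_ge0.
exists (C1 * (60 `^ (p / 3) * (C * b))); split; first by rewrite !mulr_ge0 ?powR_ge0 ?addr_ge0.
pose D N x u := A N x u * (A N x u ^+ 2 + M 2 N (x - 1) u).
have D0 N x u : 0 <= D N x u by rewrite mulr_ge0 ?addr_ge0 ?sqr_ge0.
have D_past N x : measurable_fun [set: past x] (D N x).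
  apply: measurable_funM => //; apply: measurable_funD => //.
  exact: measurable_funX.
have Db N x : (EP (fun u => D N x u `^ (p / 3))%R <= b%:E)%E.
  have mA : measurable_fun setT (fun u => A N x u `^ p).
    by apply: measurable_powRf; exact: (past_meas om_meas (@A_past N x)).
  have mM : measurable_fun setT (fun u => M 2 N (x - 1) u `^ (p / 2)).
    by apply: measurable_powRf; exact: pmom_meas.
  apply: (@le_trans _ _ (EP (fun u => 2 `^ (p / 3) * (A N x u `^ p + M 2 N (x - 1) u `^ (p /
    2)))%R)).
    apply: EP_le.
    - by apply: measurable_powRf; exact: (past_meas om_meas (@D_past N x)).
    - by apply: measurable_funM => //; exact: measurable_funD.
    - by move=> u; exact: powR_ge0.
    - by move=> u; apply: cubic_power.
  rewrite EPZ ?powR_ge0//; last 2 first.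
  - exact: measurable_funD.
  - by move=> u; rewrite addr_ge0 ?powR_ge0.
  rewrite EPD//; try by move=> u; exact: powR_ge0.
  rewrite /b EFinM EFinD lee_pmul2l ?lte_fin ?powR_gt0//.
  by apply: leeD.
move=> N; apply: (HC1 (fun x => M 3 N x)
  (fun x u => 60 * (1 + rho_ x u) ^+ 3 * D N x u) (N%:R ^+ 3)) => //.
- move=> x; apply: measurable_funM => //; last exact: (past_meas om_meas (@D_past N x)).
  apply: measurable_funM => //; apply: measurable_funX.
  by apply: measurable_funD => //; exact: rho_meas.
- by move=> x u; apply: mulr_ge0 => //; rewrite mulr_ge0 ?exprn_ge0// addr_ge0 ?rho_ge0.
- by move=> x u; apply: pmom3_rec => y; exact: om01.
- by rewrite mulr_ge0 ?powR_ge0// mulr_ge0.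
- move=> x; have := HC x (fun u => D N x u `^ (p / 3)) b.
  have mDp : measurable_fun [set: past x] (fun u => D N x u `^ (p / 3)).
    exact: (measurableT_comp (measurable_powR (p / 3)) (@D_past N x)).
  move=> /(_ mDp (fun u => powR_ge0 _ _) (Db N x)) h.
  rewrite EFinM; apply: le_trans (lee_wpmul2l _ h); last by rewrite lee_fin powR_ge0.
  rewrite -EPZ ?powR_ge0//; last 2 first.
  - apply: measurable_funM; last exact: (past_meas om_meas mDp).
    by apply: measurable_powRf; apply: measurable_funD => //; exact: rho_meas.
  - by move=> u; rewrite mulr_ge0 ?powR_ge0.
  apply: le_of_eq; apply: eq_integral => u _; congr EFin.
  have r0 : 0 <= 1 + rho_ x u by rewrite addr_ge0// rho_ge0.
  rewrite powRM//; last by rewrite mulr_ge0 ?exprn_ge0.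
  rewrite powRM ?exprn_ge0// -mulrA; congr (_ * (_ * _)).
  by rewrite -powR_mulrn// -powRrM [_ * (p / 3)]mulrCA divff// mulr1.
Qed.

End CrossingMomentBounds.

Lemma ae_forallz {d} {T : measurableType d} {R : realType} (mu : measure T R)
    (Q : int -> T -> Prop) : (forall x, {ae mu, forall u, Q x u}) ->
  {ae mu, forall u, forall x, Q x u}.
Proof.
move=> h; have /ae_foralln : forall n : nat, {ae mu, forall u, Q (Posz n) u /\ Q (Negz n) u}.
  by move=> n; apply: filterS2 (h (Posz n)) (h (Negz n)) => u; split.
by apply: filterS => u hu [] n; have [] := hu n.
Qed.

(** * Removal of the truncation *)

Section BoundedSeries.
Context {R : realType}.
Variable v : nat -> R.
Hypothesis v0 : forall k, 0 <= v k.

(* Equal to 0 when the series diverges. *)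
Definition esum_fine : R := fine (\sum_(0 <= k <oo) (v k)%:E)%E.

Lemma esum_fine_ge0 : 0 <= esum_fine.
Proof. by apply: fine_ge0; apply: nneseries_ge0 => k _ _; rewrite lee_fin. Qed.

Lemma cvg_esum (l : R) : \sum_(k < N) v k @[N --> \oo] --> l ->
  (\sum_(0 <= k <oo) (v k)%:E = l%:E)%E.
Proof.
move=> h; apply: cvg_lim => //.
rewrite (_ : (fun n : nat => (\sum_(0 <= k < n) (v k)%:E)%E) =
             EFin \o (fun N => \sum_(k < N) v k)); last first.
  by apply/funext => n /=; rewrite sumEFin big_mkord.
by apply: cvg_EFin => //; exact: nearW.
Qed.

Lemma cvg_esum_fine (L : R) : (forall N, \sum_(k < N) v k <= L) ->
  \sum_(k < N) v k @[N --> \oo] --> esum_fine.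
Proof.
move=> bL.
have h : cvgn (fun N => \sum_(k < N) v k).
  apply: nondecreasing_is_cvgn; last by exists L => _ [N _ <-].
  apply/nondecreasing_seqP => n; by rewrite big_ord_recr lerDl.
by rewrite /esum_fine (cvg_esum h).
Qed.

End BoundedSeries.

Section MonotoneMoments.
Context {d : measure_display} {Omega : measurableType d} {R : realType}.
Variable P : probability Omega R.
Local Notation EP := (EP P).
Variables (f : nat -> Omega -> R) (F : Omega -> R) (s C : R).
Hypothesis mf : forall N, measurable_fun setT (f N).
Hypothesis mF : measurable_fun setT F.
Hypothesis f0 : forall N u, 0 <= f N u.
Hypothesis f_homo : forall u, {homo f ^~ u : m n / (m <= n)%N >-> m <= n}.
Hypothesis s0 : 0 < s.
Hypothesis EPf : forall N, (EP (fun u => f N u `^ s)%R <= C%:E)%E.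
Hypothesis F0 : forall u, 0 <= F u.
Hypothesis fF : forall u L, (forall N, f N u <= L) -> f N u @[N --> \oo] --> F u.

Let g N u : \bar R := (f N u `^ s)%:E.
Let G u : \bar R := limn (g ^~ u).

Let g_homo u : {homo g ^~ u : m n / (m <= n)%N >-> (m <= n)%E}.
Proof.
move=> m n mn; rewrite lee_fin.
by apply: ge0_ler_powR; rewrite ?nnegrE ?(ltW s0)//; exact: f_homo.
Qed.

Let cvg_g u : g ^~ u @ \oo --> G u.
Proof. exact: ereal_nondecreasing_is_cvgn. Qed.

Let g_le N u : (g N u <= G u)%E.
Proof. apply: lime_ge; first exact: cvgP (@cvg_g u).
by near=> n; apply: g_homo; near: n; exact: nbhs_infty_ge.
Unshelve. all: by end_near. Qed.

Let mg N : measurable_fun setT (g N).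
Proof. by apply/measurable_EFinP; exact: measurable_powRf. Qed.

Let mG : measurable_fun setT G.
Proof. apply: (emeasurable_fun_cvg g); [exact: mg|by move=> u _; exact: cvg_g]. Qed.

Let G0 u : (0 <= G u)%E.
Proof. by apply: le_trans (g_le 0 u); rewrite lee_fin powR_ge0. Qed.

Let intG : (\int[P]_u G u <= C%:E)%E.
Proof.
rewrite monotone_convergence//.
- apply: lime_le; last by apply: nearW => N; exact: EPf.
  apply: ereal_nondecreasing_is_cvgn => m n mn; apply: ge0_le_integral => //.
  - by move=> u _; rewrite lee_fin powR_ge0.
  - by move=> u _; exact: g_homo.
- by move=> N u _; rewrite lee_fin powR_ge0.
Qed.

Let aeG : {ae P, forall u, G u \is a fin_num}.
Proof.
have : P.-integrable setT G.
  apply/integrableP; split => //.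
  under eq_integral do rewrite gee0_abs//.
  by apply: le_lt_trans intG _; rewrite ltry.
by move=> /(integrable_ae measurableT); apply: filterS => u; exact.
Qed.

Let bounded u : G u \is a fin_num -> forall N, f N u <= fine (G u) `^ s^-1.
Proof.
move=> fG N; rewrite -[f N u]powRr1//.
rewrite -(divff (x := s)) ?gt_eqF// powRrM; apply: ge0_ler_powR.
- by rewrite invr_ge0 ltW.
- by rewrite nnegrE powR_ge0.
- by rewrite nnegrE fine_ge0.
by rewrite -lee_fin fineK//; exact: g_le.
Qed.

(** By monotone convergence the limit [G] of f^s is integrable, hence almost surely finite; this
    bounds f N u in N, and then [F] is its limit. Where the bound fails, [F] may be any default
    value. *)
Lemma mono_moment_cvg : {ae P, forall u, f N u @[N --> \oo] --> F u}.
Proof. by apply: filterS aeG => u /bounded /fF. Qed.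

Lemma mono_moment_le : (EP (fun u => F u `^ s)%R <= C%:E)%E.
Proof.
apply: le_trans intG; apply: ae_ge0_le_integral => //.
- by move=> u _; rewrite lee_fin powR_ge0.
- by apply/measurable_EFinP; exact: measurable_powRf.
apply: filterS aeG => u fG _.
have FL : F u <= fine (G u) `^ s^-1.
  have c := fF (bounded fG); rewrite -(cvg_lim (@Rhausdorff R) c).
  apply: limr_le; first exact: (cvgP _ c).
  by apply: nearW => N; exact: bounded.
rewrite -[leRHS]fineK// lee_fin.
apply: (@le_trans _ _ ((fine (G u) `^ s^-1) `^ s)).
  by apply: ge0_ler_powR; rewrite ?nnegrE ?powR_ge0 ?(ltW s0).
by rewrite -powRrM mulVf ?gt_eqF// powRr1// fine_ge0.
Qed.

End MonotoneMoments.

Section CrossingMomentLimits.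
Context {d : measure_display} {Omega : measurableType d} {R : realType}.
Variables (P : probability Omega R) (om : int -> Omega -> R).
Hypothesis om_meas : forall x, measurable_fun setT (om x).
Hypothesis om_ident : forall x (B : set R), measurable B ->
  P (om x @^-1` B) = P (om 0 @^-1` B).
Hypothesis om_indep : forall (s : seq int) (B : int -> set R), uniq s ->
  (forall x, measurable (B x)) ->
  P (\bigcap_(x in [set` s]) (om x @^-1` B x)) =
  (\prod_(x <- s) P (om x @^-1` B x))%E.
Hypothesis om01 : forall x u, 0 < om x u <= 1.

Local Notation past := (past om).
Local Notation EP := (EP P).
Local Notation rho_ := (rho_ om).

Definition mom (j : nat) (x : int) u : R :=
  esum_fine (fun k => k%:R ^+ j * pmf (om ^~ u) x k).

Let term_ge0 j x u k : 0 <= k%:R ^+ j * pmf (om ^~ u) x k.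
Proof.
rewrite mulr_ge0 ?exprn_ge0//; apply: pmf_ge0 => y.
by have /andP[/ltW -> ->] := om01 y u.
Qed.

Lemma mom_ge0 j x u : 0 <= mom j x u.
Proof. exact: esum_fine_ge0. Qed.

Lemma mom_past j x : measurable_fun [set: past (x + 1)] (mom j x).
Proof.
apply: (measurableT_comp (f := fine)) => //.
apply: ge0_emeasurable_sum => [k u _ _|k _]; first by rewrite lee_fin.
apply/measurable_EFinP; apply: measurable_funM; first exact: measurable_cst.
by apply: fpass_past; lia.
Qed.

Lemma mom_meas j x : measurable_fun setT (mom j x).
Proof. by apply: (@past_meas _ _ _ _ om_meas _ _ (x + 1)); exact: mom_past. Qed.

Lemma mom_cvg_of_bounded j x u L : (forall N, pmom (om ^~ u) j N x <= L) ->
  pmom (om ^~ u) j N x @[N --> \oo] --> mom j x u.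
Proof. exact: cvg_esum_fine. Qed.

Lemma mom_cvg_ae j s C : 0 < s ->
  (forall N x, EP (fun u => pmom (om ^~ u) j N x `^ s)%R <= C%:E)%E ->
  {ae P, forall u, forall x, pmom (om ^~ u) j N x @[N --> \oo] --> mom j x u}.
Proof.
move=> s0 HC; apply: ae_forallz => x.
apply: (@mono_moment_cvg _ _ _ P _ _ s C) => // [N|N u|u m n mn|u L].
- exact: pmom_meas.
- by apply: pmom_ge0 => y; exact: om01.
- by apply: pmom_homo => // y; exact: om01.
- exact: mom_cvg_of_bounded.
Qed.

Lemma mom_moment_le j s C x : 0 < s ->
  (forall N x, EP (fun u => pmom (om ^~ u) j N x `^ s)%R <= C%:E)%E ->
  (EP (fun u => mom j x u `^ s)%R <= C%:E)%E.
Proof.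
move=> s0 HC.
apply: (@mono_moment_le _ _ _ P (fun N u => pmom (om ^~ u) j N x)) => // [N||N u|u m n mn|u|u L].
- exact: pmom_meas.
- exact: mom_meas.
- by apply: pmom_ge0 => y; exact: om01.
- by apply: pmom_homo => // y; exact: om01.
- exact: mom_ge0.
- exact: mom_cvg_of_bounded.
Qed.

Lemma mom0_cvg x u : pmom (om ^~ u) 0 N x @[N --> \oo] --> mom 0 x u.
Proof. by apply: (@mom_cvg_of_bounded _ _ _ 1) => N; apply: pmom0_le1 => y; exact: om01. Qed.

Lemma mom0_le1 x u : mom 0 x u <= 1.
Proof.
rewrite -(cvg_lim (@Rhausdorff R) (@mom0_cvg x u)); apply: limr_le.
  exact: (cvgP _ (@mom0_cvg x u)).
by apply: nearW => N; apply: pmom0_le1 => y; exact: om01.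
Qed.

Variable p : R.
Hypothesis p_gt0 : 0 < p.
Hypothesis rho_p : (EP (fun u => rho_ 0 u `^ p)%R < 1)%E.

(* The escape probability [1 - mom 0 x] satisfies the recursion of [rec_moment]
   with [B = 0]. *)
Lemma mom0_ae1 : {ae P, forall u, forall x, mom 0 x u = 1}.
Proof.
apply: ae_forallz => x.
have pp : 0 < p <= p by rewrite p_gt0 lexx.
have [C1 [C10 HC1]] := rec_moment om_meas om_ident om_indep om01 p_gt0 rho_p pp.
have := HC1 (fun x u => 1 - mom 0 x u) (fun _ _ => 0) 1 0 _ _ _ _ _ _ _ x.
have mY y : measurable_fun [set: past y] (fun u => 1 - mom 0 (y - 1) u).
  apply: measurable_funB; first exact: measurable_cst.
  by have := @mom_past 0 (y - 1); rewrite subrK.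
have Y0 y u : 0 <= 1 - mom 0 y u by rewrite subr_ge0 mom0_le1.
move=> /(_ mY) h; have {}h : (EP (fun u => (1 - mom 0 x u) `^ p)%R <= (C1 * 0)%:E)%E.
  apply: h => //.
  - by move=> y u; rewrite Y0 gerBl mom_ge0.
  - move=> y u; rewrite addr0.
    have := @pmom0_lim _ (om ^~ u) (om01 ^~ u) (mom 0 ^~ u) (fun y => @mom0_cvg y u) y.
    have /andP[w0 w1] := om01 y u; rewrite /rho_ /odds.
    rewrite mulrAC ler_pdivlMr//.
    have := mom_ge0 0 (y - 1) u; have := mom_ge0 0 y u; have := mom0_le1 y u;
      have := mom0_le1 (y - 1) u.
    set a := mom 0 y u; set b := mom 0 (y - 1) u; set w := om y u in w0 w1 * => b1 a1 a0 b0 e.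
    have : 0 <= (1 - w) * (1 - b) * (1 - a) by rewrite !mulr_ge0 ?subr_ge0.
    lra.
  - by move=> y; rewrite /EP powR0 ?gt_eqF// integral0.
have mYx : measurable_fun setT (fun u => ((1 - mom 0 x u) `^ p)%:E).
  apply/measurable_EFinP; apply: measurable_powRf; apply: measurable_funB => //.
  exact: mom_meas.
have h0 : (\int[P]_u `| ((1 - mom 0 x u) `^ p)%:E | = 0)%E.
  under eq_integral do rewrite gee0_abs ?lee_fin ?powR_ge0//.
  apply/eqP; rewrite eq_le; apply/andP; split; first by rewrite mulr0 in h.
  by apply: EP_ge0 => u; exact: powR_ge0.
have /(_ h0) := (ae_eq_integral_abs P measurableT mYx).1.
apply: filterS => u /(_ I) [] /eqP; rewrite powR_eq0 => /andP[/eqP h1 _].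
by apply/eqP; rewrite eq_sym -subr_eq0 h1.
Qed.

End CrossingMomentLimits.

(** * Almost sure growth of sums *)

Section DyadicChaining.
Context {R : realType}.
Variable S : nat -> R.

(** An interval of length n splits into dyadic blocks with at most one per level, following the
    binary digits of n; hence a factor L + 1 instead of n. *)
Lemma dyadic_chaining H Q :
  (forall l k, (l <= H)%N -> (k.+1 * 2 ^ l <= 2 ^ H)%N ->
     `|S (k.+1 * 2 ^ l)%N - S (k * 2 ^ l)%N| <= Q) ->
  forall L k n, (L <= H)%N -> (k.+1 * 2 ^ L <= 2 ^ H)%N -> (n <= 2 ^ L)%N ->
  `|S (k * 2 ^ L + n)%N - S (k * 2 ^ L)%N| <= L.+1%:R * Q.
Proof.
move=> hQ; have Q0 : 0 <= Q by apply: le_trans (hQ H 0%N _ _); rewrite ?mul1n.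
elim=> [|L IHL] k n LH kH nL.
  rewrite mul1r; move: nL; rewrite expn0 leq_eqVlt ltnS leqn0 => /orP[] /eqP->.
    by have := hQ 0%N k isT kH; rewrite expn0 mulSn addnC.
  by rewrite addn0 subrr normr0.
have kE : (k * 2 ^ L.+1 = k.*2 * 2 ^ L)%N by rewrite expnS -muln2 mulnA.
have kE' : (k.+1 * 2 ^ L.+1 = k.*2.+2 * 2 ^ L)%N by rewrite expnS -doubleS -muln2 mulnA.
have kH' : (k.*2.+1 * 2 ^ L <= 2 ^ H)%N.
  by apply: leq_trans kH; rewrite kE' leq_pmul2r ?expn_gt0.
have LH' : (L <= H)%N by exact: ltnW.
have [nL'|nL'] := leqP n (2 ^ L).
  rewrite kE; apply: (le_trans (IHL _ _ LH' kH' nL')).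
  by rewrite ler_wpM2r// ler_nat.
have -> : (k * 2 ^ L.+1 + n = k.*2.+1 * 2 ^ L + (n - 2 ^ L))%N.
  by rewrite kE mulSn -addnA addnCA subnKC// ltnW.
rewrite kE.
apply: le_trans (ler_distD (S (k.*2.+1 * 2 ^ L)%N) _ _) _.
rewrite -natr1 mulrDl mul1r; apply: lerD; last exact: hQ.
apply: IHL => //; first by rewrite -kE'.
by rewrite leq_subLR addnn -mul2n -expnS.
Qed.

Lemma dyadic_bound (s : R) H n : 0 < s -> (n <= 2 ^ H)%N ->
  `|S n - S 0%N| <= H.+1%:R *
    (\sum_(l < H.+1) \sum_(k < 2 ^ (H - l)) `|S (k.+1 * 2 ^ l)%N - S (k * 2 ^ l)%N| `^ s) `^ s^-1.
Proof.
move=> s0 nH; set M := \sum_(l < _) _.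
have /= := @dyadic_chaining H (M `^ s^-1) _ H 0%N n (leqnn _).
rewrite mul0n mul1n add0n; apply=> // l k lH kH.
have kl : (k < 2 ^ (H - l))%N.
  by rewrite -(@ltn_pmul2r (2 ^ l)) ?expn_gt0// -expnD subnK// (leq_trans _ kH)// ltn_pmul2r
    ?expn_gt0.
set D := `|_|; have D0 : 0 <= D by exact: normr_ge0.
rewrite -[leLHS]powRr1// -(divff (x := s)) ?gt_eqF// powRrM; apply: ge0_ler_powR.
- by rewrite invr_ge0 ltW.
- by rewrite nnegrE powR_ge0.
- by rewrite nnegrE !sumr_ge0// => ? _; rewrite sumr_ge0// => ? _; exact: powR_ge0.
have lH' : (l < H.+1)%N by [].
rewrite /M (bigD1 (Ordinal lH'))//= (bigD1 (Ordinal kl))//= -addrA lerDl.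
apply: addr_ge0; apply: sumr_ge0 => ? _; first exact: powR_ge0.
by rewrite sumr_ge0// => ? _; exact: powR_ge0.
Qed.

Lemma linear_le_geometric (q : R) : 1 < q ->
  exists K : R, 0 <= K /\ forall n, n.+1%:R <= K * q ^+ n.
Proof.
move=> q1; have q0 : 0 < q - 1 by rewrite subr_gt0.
exists (1 + (q - 1)^-1); split; first by rewrite addr_ge0// invr_ge0 ltW.
elim=> [|n IHn]; first by rewrite expr0 mulr1 lerDl invr_ge0 ltW.
have qn : 1 <= q ^+ n by rewrite exprn_ege1// ltW.
rewrite -natr1 exprS; set c := (q - 1)^-1 in IHn *.
have cq : c * q = 1 + c by rewrite -[in LHS](subrK 1 q) mulrDr mulVf ?gt_eqF// mulr1.
have -> : (1 + c) * (q * q ^+ n) = (1 + c) * q ^+ n + ((1 + c) * (q - 1)) * q ^+ n by ring.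
apply: lerD => //; have -> : (1 + c) * (q - 1) = q by rewrite mulrDl mulVf ?gt_eqF//; ring.
by rewrite -[leLHS]mulr1; apply: ler_pM => //; exact: ltW.
Qed.

End DyadicChaining.

Section AlmostSureGrowth.
Context {d : measure_display} {Omega : measurableType d} {R : realType}.
Variable P : probability Omega R.
Local Notation EP := (EP P).

Lemma EP_sum n (f : nat -> Omega -> R) :
  (forall i, measurable_fun setT (f i)) -> (forall i u, 0 <= f i u) ->
  EP (fun u => \sum_(i < n) f i u)%R = (\sum_(i < n) EP (f i))%E.
Proof.
move=> mf f0; elim: n => [|n IHn].
  rewrite big_ord0 /EP; under eq_integral do rewrite big_ord0.
  by rewrite integral0.
rewrite big_ord_recr/= -IHn -EPD//.
- by apply: eq_integral => u _; rewrite big_ord_recr.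
- exact: measurable_sum.
- by move=> u; rewrite sumr_ge0.
Qed.

(** As t < th, the series of M_H / th^H has finite mean, so it converges almost surely; its sum is
    the constant T. *)
Lemma ae_geometric_bound (M : nat -> Omega -> R) (K t th : R) :
  (forall H, measurable_fun setT (M H)) -> (forall H u, 0 <= M H u) ->
  0 <= K -> 0 < t < th -> (forall H, EP (M H) <= (K * t ^+ H)%:E)%E ->
  {ae P, forall u, exists T : R, 0 <= T /\ forall H, M H u <= T * th ^+ H}.
Proof.
move=> mM M0 K0 /andP[t0 tth] HM; have th0 : 0 < th by exact: lt_trans tth.
pose z := t / th; have z0 : 0 <= z by rewrite divr_ge0// ltW.
have z1 : z < 1 by rewrite ltr_pdivrMr// mul1r.
pose f H u := (th ^+ H)^-1 * M H u.
have f0 H u : 0 <= f H u by rewrite mulr_ge0// invr_ge0 exprn_ge0// ltW.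
have mf H : measurable_fun setT (f H) by exact: measurable_funM.
pose G u := (\sum_(0 <= H <oo) (f H u)%:E)%E.
have mG : measurable_fun setT G.
  apply: ge0_emeasurable_sum => [k u _ _|k _]; first by rewrite lee_fin.
  exact/measurable_EFinP.
have G0 u : (0 <= G u)%E by apply: nneseries_ge0 => k _ _; rewrite lee_fin.
have fK H : (EP (f H) <= (geometric K z H)%:E)%E.
  rewrite EPZ ?invr_ge0 ?exprn_ge0 ?(ltW th0)//.
  apply: le_trans (lee_wpmul2l _ (HM H)) _; first by rewrite lee_fin invr_ge0 exprn_ge0// ltW.
  by rewrite -EFinM lee_fin /geometric/= /z expr_div_n mulrCA mulrA mulrAC -mulrA mulrC.
have gE : (\sum_(0 <= H <oo) (geometric K z H)%:E = (K * (1 - z)^-1)%:E)%E.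
  apply: cvg_esum.
  have := @cvg_geometric_series R K z; rewrite ger0_norm// => /(_ z1).
  by rewrite /series/=; under eq_cvg do rewrite big_mkord.
have iG : (\int[P]_u G u < +oo)%E.
  rewrite integral_nneseries//; last 2 first.
  - by move=> n; exact/measurable_EFinP.
  - by move=> n u _; rewrite lee_fin.
  apply: (@le_lt_trans _ _ (K * (1 - z)^-1)%:E); last exact: ltry.
  by rewrite -gE; apply: lee_nneseries => *; [exact: EP_ge0|exact: fK].
have : P.-integrable setT G.
  by apply/integrableP; split => //; under eq_integral do rewrite gee0_abs//.
move=> /(integrable_ae measurableT); apply: filterS => u /(_ I) Gfin.
exists (fine (G u)); split; first exact: fine_ge0.
move=> H; have : (f H u <= fine (G u)).
  rewrite -lee_fin fineK//; apply: le_trans (nneseries_lim_ge H.+1 _); last first.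
    by move=> k _ _; rewrite lee_fin.
  rewrite big_nat_recr//= leeDr// sume_ge0// => k _.
  by rewrite lee_fin.
by rewrite /f mulrC ler_pdivrMr// exprn_gt0.
Qed.

Lemma ae_growth (S : nat -> Omega -> R) (s C e : R) :
  0 < s -> 0 <= C -> 0 < e -> (forall n, measurable_fun setT (S n)) ->
  (forall u, S 0%N u = 0) ->
  (forall a b : nat, (a <= b)%N ->
     EP (fun u => `|S b u - S a u| `^ s)%R <= (C * (b - a)%N%:R)%:E)%E ->
  {ae P, forall u, exists T : R, 0 <= T /\
     forall n, (0 < n)%N -> `|S n u| <= T * n%:R `^ ((1 + e) / s)}.
Proof.
move=> s0 C0 e0 mS S0 HS.
(* With q = 2^e', one factor q^H absorbs the number H + 1 of levels and the factors q in (2 q^2)^H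
   serve the mean of [M] and the summability over H. The resulting exponent e' + (1 + 2 e') / s
   equals (1 + e) / s. *)
pose e' := e / (s + 2).
have e'0 : 0 < e' by rewrite divr_gt0// addr_gt0.
pose q : R := 2 `^ e'.
have q1 : 1 < q.
  have : 1 `^ e' < 2 `^ e' :> R by apply: gt0_ltr_powR; rewrite ?nnegrE// ltr1n.
  by rewrite powR1.
have q0 : 0 < q by exact: lt_trans q1.
have [K [K0 HK]] := linear_le_geometric q1.
pose D l k u := `|S (k.+1 * 2 ^ l)%N u - S (k * 2 ^ l)%N u| `^ s.
have D0 l k u : 0 <= D l k u by exact: powR_ge0.
have mD l k : measurable_fun setT (D l k).
  by apply: measurable_powRf; apply: measurableT_comp => //; exact: measurable_funB.
pose M H u := \sum_(l < H.+1) \sum_(k < 2 ^ (H - l)) D l k u.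
have M0 H u : 0 <= M H u by rewrite sumr_ge0// => l _; rewrite sumr_ge0.
have mM H : measurable_fun setT (M H).
  by apply: measurable_sum => l; apply: measurable_sum => k.
have EM H : (EP (M H) <= (C * K * (2 * q) ^+ H)%:E)%E.
  rewrite /M (@EP_sum _ (fun l u => \sum_(k < 2 ^ (H - l)) D l k u)); last 2 first.
  - by move=> l; apply: measurable_sum.
  - by move=> l u; rewrite sumr_ge0.
  apply: (@le_trans _ _ (\sum_(l < H.+1) (C * 2 ^+ H)%:E)%E).
    apply: lee_sum => l _; rewrite (@EP_sum _ (fun k u => D l k u))//.
    apply: (@le_trans _ _ (\sum_(k < 2 ^ (H - l)) (C * 2 ^+ l)%:E)%E).
      apply: lee_sum => k _; apply: (le_trans (HS _ _ _)).
        by rewrite leq_pmul2r ?expn_gt0.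
      by rewrite -mulnBl subSnn mul1n natrX.
    rewrite sumEFin lee_fin sumr_const card_ord -[leLHS]mulr_natr natrX -mulrA -exprD.
    by rewrite subnKC// -ltnS.
  rewrite sumEFin lee_fin sumr_const card_ord -[leLHS]mulr_natr -!mulrA ler_wpM2l//.
  by rewrite exprMn mulrCA ler_wpM2l ?exprn_ge0.
have CK : 0 <= C * K by rewrite mulr_ge0.
have tt : 0 < 2 * q < 2 * q ^+ 2.
  by rewrite mulr_gt0//= ltr_pM2l// expr2 ltr_pMr.
have := ae_geometric_bound mM M0 CK tt EM; apply: filterS => u [T [T0 HT]].
exists (K * T `^ s^-1 * 2 `^ ((1 + e) / s)); split; first by rewrite !mulr_ge0 ?powR_ge0.
move=> n n0; have /andP[nl nu] := trunc_log_bounds (isT : (1 < 2)%N) n0.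
set H := (trunc_log 2 n).+1 in nu; have n2H : 2 ^+ H <= 2 * n%:R :> R.
  by rewrite exprS ler_pM2l// -natrX ler_nat.
have H0 : 0 <= 2 ^+ H :> R by rewrite exprn_ge0.
have := @dyadic_bound _ (S ^~ u) s H n s0 (ltnW nu); rewrite S0 subr0 -/(M H u).
move=> /le_trans; apply.
have si0 : 0 <= s^-1 by rewrite invr_ge0 ltW.
have qH : q ^+ H = (2 ^+ H) `^ e'.
  by rewrite -[LHS]powR_mulrn ?powR_ge0// /q -powRrM mulrC powRrM powR_mulrn.
apply: (@le_trans _ _ ((K * q ^+ H) * (T * (2 * q ^+ 2) ^+ H) `^ s^-1)).
  apply: ler_pM => //; first exact: powR_ge0.
  apply: ge0_ler_powR => //; rewrite ?nnegrE ?M0 //.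
  by rewrite mulr_ge0 ?exprn_ge0 ?mulr_ge0 ?exprn_ge0 ?(ltW q0).
rewrite powRM//; last by rewrite exprn_ge0 ?mulr_ge0 ?exprn_ge0 ?(ltW q0).
have -> : ((2 * q ^+ 2) ^+ H) `^ s^-1 = (2 ^+ H) `^ ((1 + 2 * e') / s).
  rewrite exprMn -exprM mulnC exprM qH -(powR_mulrn 2) ?powR_ge0// -powRrM.
  rewrite -[X in X * _ `^ _]powRr1// -powRD; last by rewrite expf_neq0 ?implybT.
  by rewrite -powRrM [e' * 2]mulrC.
rewrite qH; set h : R := 2 ^+ H in n2H H0 *.
have hn0 : h != 0 by rewrite expf_neq0.
have -> : K * h `^ e' * (T `^ s^-1 * h `^ ((1 + 2 * e') / s)) =
    K * T `^ s^-1 * (h `^ e' * h `^ ((1 + 2 * e') / s)) by ring.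
rewrite -powRD; last by rewrite hn0 implybT.
have -> : e' + (1 + 2 * e') / s = (1 + e) / s.
  by rewrite /e'; field; rewrite !gt_eqF// addr_gt0.
rewrite -[leRHS]mulrA -powRM// ler_wpM2l ?mulr_ge0 ?powR_ge0//.
have e1 : 0 <= (1 + e) / s by rewrite divr_ge0 ?(ltW s0)// addr_ge0 ?(ltW e0).
by apply: ge0_ler_powR => //; rewrite nnegrE// mulr_ge0.
Qed.

Lemma ae_growth_nonneg (Y : nat -> Omega -> R) (s C e : R) :
  0 < s -> 0 <= C -> 0 < e -> (forall n, measurable_fun setT (Y n)) ->
  (forall n u, 0 <= Y n u) -> (forall n, EP (fun u => Y n u `^ s)%R <= C%:E)%E ->
  {ae P, forall u, exists T : R, 0 <= T /\
     forall n, (0 < n)%N -> \sum_(i < n) Y i u `^ s <= T * n%:R `^ (1 + e)}.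
Proof.
move=> s0 C0 e0 mY Y0 HY.
pose S n u := \sum_(i < n) Y i u `^ s.
have mYs i : measurable_fun setT (fun u => Y i u `^ s) by exact: measurable_powRf.
have mS n : measurable_fun setT (S n) by exact: measurable_sum.
have S0 u : S 0%N u = 0 by rewrite /S big_ord0.
have := @ae_growth S 1 C e ltr01 C0 e0 mS S0.
have HS (a b : nat) : (a <= b)%N ->
    (EP (fun u => `|S b u - S a u| `^ 1)%R <= (C * (b - a)%N%:R)%:E)%E.
  move=> ab; have -> : EP (fun u => `|S b u - S a u| `^ 1)%R =
      EP (fun u => \sum_(i < b - a) Y (a + i)%N u `^ s)%R.
    apply: eq_integral => u _; congr EFin.
    have -> : S b u - S a u = \sum_(i < b - a) Y (a + i)%N u `^ s.
      have -> : S b u = S (a + (b - a))%N u by rewrite subnKC.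
      by rewrite /S big_split_ord/= addrAC subrr add0r.
    by rewrite powRr1// ger0_norm// sumr_ge0// => i _; exact: powR_ge0.
  rewrite (@EP_sum _ (fun i u => Y (a + i)%N u `^ s))//; last by move=> i u; exact: powR_ge0.
  apply: (@le_trans _ _ (\sum_(i < b - a) C%:E)%E); first by apply: lee_sum.
  by rewrite sumEFin lee_fin sumr_const card_ord mulr_natr.
move=> /(_ HS); apply: filterS => u [T [T0 HT]]; exists T; split => // n n0.
have := HT n n0; rewrite divr1 ger0_norm// sumr_ge0// => i _; exact: powR_ge0.
Qed.

End AlmostSureGrowth.

(** * Martingales driven by the centered odds *)

Section PowerMartingale.
Context {d : measure_display} {Omega : measurableType d} {R : realType}.
Variables (P : probability Omega R) (om : int -> Omega -> R).
Hypothesis om_meas : forall x, measurable_fun setT (om x).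
Hypothesis om_ident : forall x (B : set R), measurable B ->
  P (om x @^-1` B) = P (om 0 @^-1` B).
Hypothesis om_indep : forall (s : seq int) (B : int -> set R), uniq s ->
  (forall x, measurable (B x)) ->
  P (\bigcap_(x in [set` s]) (om x @^-1` B x)) =
  (\prod_(x <- s) P (om x @^-1` B x))%E.
Hypothesis om01 : forall x u, 0 < om x u <= 1.

Local Notation past := (past om).
Local Notation EP := (EP P).
Local Notation rho_ := (rho_ om).

Variables (h : R -> R) (s : R) (Y : int -> Omega -> R) (Ch CY : R).
Hypothesis mh : measurable_fun setT h.
Hypothesis h0 : forall r, 0 <= h r.
Hypothesis s12 : 1 < s <= 2.
Hypothesis Eh : (EP (fun u => h (rho_ 0 u) `^ s)%R <= Ch%:E)%E.
Hypothesis Y_past : forall x, measurable_fun [set: past x] (Y x).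
Hypothesis Y0 : forall x u, 0 <= Y x u.
Hypothesis EY : forall x, (EP (fun u => Y x u `^ s)%R <= CY%:E)%E.

Let s1 : 1 < s. Proof. by case/andP: s12. Qed.
Let s0 : 0 < s. Proof. exact: lt_trans s1. Qed.

Definition rho_mean : R := fine (EP (fun u => h (rho_ 0 u))).

Let mhr x : measurable_fun setT (fun u => h (rho_ x u)).
Proof. by apply: measurableT_comp => //; exact: rho_meas. Qed.

Let EP_rho_mean : EP (fun u => h (rho_ 0 u)) = rho_mean%:E.
Proof.
rewrite fineK// ge0_fin_numE; last exact: EP_ge0.
apply: (@le_lt_trans _ _ (1%:E + EP (fun u => h (rho_ 0 u) `^ s)%R)%E).
  rewrite -(EP_cst P 1) -EPD//; last first.
  - by move=> u; exact: powR_ge0.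
  - exact: measurable_powRf.
  apply: EP_le => //.
  - by apply: measurable_funD => //; exact: measurable_powRf.
  move=> u; have := @powR_le1D _ s^-1 (h (rho_ 0 u) `^ s).
  rewrite -powRrM divff ?gt_eqF// powRr1//; apply; last exact: powR_ge0.
  by rewrite invr_ge0 (ltW s0) invf_le1 ?(ltW s1)// ltW.
by apply: (@le_lt_trans _ _ (1%:E + Ch%:E)%E); [exact: leeD2l|rewrite -EFinD ltry].
Qed.

Let eta0 : 0 <= rho_mean.
Proof. by rewrite fine_ge0// EP_ge0. Qed.

Let zeta r := h r - rho_mean.
Let zp r := Num.max (zeta r) 0.
Let zm r := Num.max (- zeta r) 0.

Let mzeta : measurable_fun setT zeta.
Proof. exact: measurable_funB. Qed.
Let mzp : measurable_fun setT zp.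
Proof. exact: measurable_maxr. Qed.
Let mzm : measurable_fun setT zm.
Proof. by apply: measurable_maxr => //; exact: measurable_funN. Qed.
Let zp0 r : 0 <= zp r. Proof. by rewrite le_max lexx orbT. Qed.
Let zm0 r : 0 <= zm r. Proof. by rewrite le_max lexx orbT. Qed.
Let zpm r : zp r - zm r = zeta r.
Proof. by rewrite /zp /zm; case: (lerP (zeta r) 0) => z; case: (lerP (- zeta r) 0) => z'; lra. Qed.

Let mrho (g : R -> R) x : measurable_fun setT g -> measurable_fun setT (fun u => g (rho_ x u)).
Proof. by move=> mg; apply: measurableT_comp => //; exact: rho_meas. Qed.

(** [zeta] is centered, so its two parts have a common mean; adding [rho_mean] on one side and [zm]
    on the other shows this within nonnegative integrands. *)
Let zE : exists z : R, [/\ 0 <= z, EP (fun u => zp (rho_ 0 u)) = z%:E &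
   EP (fun u => zm (rho_ 0 u)) = z%:E].
Proof.
have fp : EP (fun u => zp (rho_ 0 u)) \is a fin_num.
  rewrite ge0_fin_numE; last exact: EP_ge0.
  apply: (@le_lt_trans _ _ (EP (fun u => h (rho_ 0 u)))); last by rewrite EP_rho_mean ltry.
  apply: EP_le => //; first exact: mrho.
  by move=> u; rewrite ge_max h0 gerBl eta0.
exists (fine (EP (fun u => zp (rho_ 0 u)))); rewrite fineK//; split => //.
  by rewrite fine_ge0// EP_ge0.
have : EP (fun u => zp (rho_ 0 u) + rho_mean)%R = EP (fun u => h (rho_ 0 u) + zm (rho_ 0 u))%R.
  apply: eq_integral => u _; congr EFin.
  by have := zpm (rho_ 0 u); rewrite /zeta; lra.
rewrite !EPD//; try exact: mrho.
rewrite EP_rho_mean EP_cst [RHS]addeC => /(congr1 (fun e => e - rho_mean%:E)%E).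
by rewrite !addeK.
Qed.

Let EzS : exists Cz : R, 0 <= Cz /\
  (EP (fun u => `|zeta (rho_ 0 u)| `^ s)%R <= Cz%:E)%E.
Proof.
have Ch0 : 0 <= Ch.
  by rewrite -lee_fin; apply: le_trans Eh; apply: EP_ge0 => u; exact: powR_ge0.
exists (2 `^ s * (Ch + rho_mean `^ s)); split.
  by rewrite mulr_ge0 ?powR_ge0// addr_ge0 ?powR_ge0.
apply: (@le_trans _ _ (EP (fun u => (h (rho_ 0 u) + rho_mean) `^ s)%R)).
  apply: EP_le.
  - by apply: measurable_powRf; apply: measurableT_comp => //; exact: mrho.
  - by apply: measurable_powRf; apply: measurable_funD.
  - by move=> u; exact: powR_ge0.
  move=> u; apply: ge0_ler_powR; rewrite ?nnegrE ?(ltW s0)// ?addr_ge0//.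
  by rewrite ler_norml /zeta; have := h0 (rho_ 0 u); have := eta0; lra.
apply: le_trans (EP_powD _ _ _ _ _ _) _ => //; first exact: ltW.
by rewrite EFinM lee_pmul2l ?lte_fin ?powR_gt0// EP_cst EFinD leeD2r.
Qed.

Let part_split (a : R) : Num.sg a * `|a| `^ (s - 1) =
  Num.max a 0 `^ (s - 1) - Num.max (- a) 0 `^ (s - 1).
Proof.
have sn : s - 1 != 0 by rewrite gt_eqF// subr_gt0.
case: (ltrgtP a 0) => [a0|a0|->]; last by rewrite oppr0 sgr0 mul0r maxxx subrr.
  rewrite max_l; last by rewrite oppr_ge0 ltW.
  by rewrite powR0// ltr0_sg// ltr0_norm// mulN1r sub0r.
rewrite max_r; last by rewrite oppr_le0 ltW.
by rewrite powR0// gtr0_sg// gtr0_norm// mul1r subr0.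
Qed.

(** Split on which of y and |a| is larger. It gives both parts of the linear term a finite mean, so
    that they can be cancelled. *)
Let cross_le (a m y : R) : 0 <= y -> 0 <= m -> m <= `|a| ->
  s * m `^ (s - 1) * y <= s * (`|a| `^ s + y `^ s).
Proof.
move=> y0 m0 ma; rewrite -mulrA ler_wpM2l ?(ltW s0)//.
have sE (t : R) : 0 <= t -> t `^ s = t `^ (s - 1) * t.
  move=> t0; rewrite -[X in _ * X]powRr1// -powRD ?subrK//.
  by rewrite gt_eqF.
have s10 : 0 <= s - 1 by rewrite subr_ge0 ltW.
have [yl|ly] := leP y `|a|.
  rewrite -[leLHS]addr0; apply: lerD; last exact: powR_ge0.
  rewrite sE//; apply: ler_pM => //; rewrite ?powR_ge0//.
  by apply: ge0_ler_powR.
rewrite -[leLHS]add0r; apply: lerD; first exact: powR_ge0.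
rewrite sE// ler_wpM2r//; apply: ge0_ler_powR => //.
by apply: ltW; exact: le_lt_trans ly.
Qed.

(* Expanding [|T + D|^s] to first order, the linear term has mean 0. To stay with
   nonnegative integrands, its positive and negative parts are put on opposite
   sides of the inequality; they have the same finite mean. *)
Let mart_step : exists C1 : R, 0 <= C1 /\ forall x (T : Omega -> R) (c : R),
  measurable_fun [set: past x] T -> (EP (fun u => `|T u| `^ s)%R <= c%:E)%E ->
  (EP (fun u => `|T u + zeta (rho_ x u) * Y x u| `^ s)%R <= (c + C1)%:E)%E.
Proof.
have [Cz [Cz0 HCz]] := EzS; have [z [z0 Ezp Ezm]] := zE.
have CY0 : 0 <= CY.
  by rewrite -lee_fin; apply: le_trans (EY 0); apply: EP_ge0 => u; exact: powR_ge0.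
exists (13 * (Cz * CY)); split; first by rewrite !mulr_ge0.
move=> x T c pT HT.
have mT := past_meas om_meas pT; have mY := past_meas om_meas (@Y_past x).
pose Gp u := s * Num.max (T u) 0 `^ (s - 1) * Y x u.
pose Gm u := s * Num.max (- T u) 0 `^ (s - 1) * Y x u.
have max0 (a : R) : 0 <= Num.max a 0 by rewrite le_max lexx orbT.
have Gp0 u : 0 <= Gp u by rewrite !mulr_ge0 ?powR_ge0// ltW.
have Gm0 u : 0 <= Gm u by rewrite !mulr_ge0 ?powR_ge0// ltW.
have pGp : measurable_fun [set: past x] Gp.
  apply: measurable_funM => //; apply: measurable_funM; first exact: measurable_cst.
  apply: (measurableT_comp (measurable_powR (s - 1))).
  by apply: measurable_maxr => //; exact: measurable_cst.
have pGm : measurable_fun [set: past x] Gm.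
  apply: measurable_funM => //; apply: measurable_funM; first exact: measurable_cst.
  apply: (measurableT_comp (measurable_powR (s - 1))).
  by apply: measurable_maxr; [exact: measurable_funN|exact: measurable_cst].
have mGp := past_meas om_meas pGp; have mGm := past_meas om_meas pGm.
have mTs : measurable_fun setT (fun u => `|T u| `^ s).
  by apply: measurable_powRf; exact: measurableT_comp.
have mYs : measurable_fun setT (fun u => Y x u `^ s) by exact: measurable_powRf.
have fG (G : Omega -> R) : measurable_fun setT G -> (forall u, 0 <= G u) ->
    (forall u, G u <= s * (`|T u| `^ s + Y x u `^ s)) -> EP G \is a fin_num.
  move=> mG G0 GT; rewrite ge0_fin_numE ?EP_ge0//.
  apply: (@le_lt_trans _ _ (s%:E * (c%:E + CY%:E))%E); last by rewrite -EFinD -EFinM ltry.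
  apply: (@le_trans _ _ (EP (fun u => s * (`|T u| `^ s + Y x u `^ s))%R)).
    by apply: EP_le => //; apply: measurable_funM => //; exact: measurable_funD.
  rewrite EPZ ?(ltW s0)//; last 2 first.
  - exact: measurable_funD.
  - by move=> u; rewrite addr_ge0 ?powR_ge0.
  rewrite lee_pmul2l ?lte_fin//.
  rewrite EPD//; try by move=> u; exact: powR_ge0.
  exact: leeD.
have fGp : EP Gp \is a fin_num.
  apply: fG => // u; apply: cross_le => //.
  by rewrite ge_max ler_norm normr_ge0.
have fGm : EP Gm \is a fin_num.
  apply: fG => // u; apply: cross_le => //.
  by rewrite ge_max -normrN ler_norm normr_ge0.
have mz (g : R -> R) (G : Omega -> R) : measurable_fun setT g -> measurable_fun setT G ->
    measurable_fun setT (fun u => g (rho_ x u) * G u).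
  by move=> mg mG; apply: measurable_funM => //; exact: mrho.
pose LL u := zp (rho_ x u) * Gm u + zm (rho_ x u) * Gp u.
pose RR u := zp (rho_ x u) * Gp u + zm (rho_ x u) * Gm u.
have mLL : measurable_fun setT LL by apply: measurable_funD; exact: mz.
have mRR : measurable_fun setT RR by apply: measurable_funD; exact: mz.
have LL0 u : 0 <= LL u by rewrite addr_ge0// mulr_ge0.
have RR0 u : 0 <= RR u by rewrite addr_ge0// mulr_ge0.
have indep (g : R -> R) (G : Omega -> R) : measurable_fun setT g -> (forall r, 0 <= g r) ->
    measurable_fun [set: past x] G -> (forall u, 0 <= G u) ->
    EP (fun u => g (rho_ x u) * G u)%R = (EP (fun u => g (rho_ 0 u)) * EP G)%E.
  exact: (EP_rhoM om_meas om_ident om_indep om01).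
have [a Ea] : exists a, EP Gp = a%:E by exists (fine (EP Gp)); exact: (esym (fineK fGp)).
have [b Eb] : exists b, EP Gm = b%:E by exists (fine (EP Gm)); exact: (esym (fineK fGm)).
have ELL : EP LL = (z * b + z * a)%:E.
  rewrite EPD//; try exact: mz; try by move=> u; rewrite mulr_ge0.
  rewrite (indep zp Gm mzp zp0 pGm Gm0) (indep zm Gp mzm zm0 pGp Gp0) Ezp Ezm Ea Eb.
  by rewrite -!EFinM -EFinD.
have ERR : EP RR = (z * b + z * a)%:E.
  rewrite EPD//; try exact: mz; try by move=> u; rewrite mulr_ge0.
  rewrite (indep zp Gp mzp zp0 pGp Gp0) (indep zm Gm mzm zm0 pGm Gm0) Ezp Ezm Ea Eb.
  by rewrite -!EFinM -EFinD addrC.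
pose W u := `|T u + zeta (rho_ x u) * Y x u| `^ s.
have mW : measurable_fun setT W.
  apply: measurable_powRf; apply: measurableT_comp => //.
  by apply: measurable_funD => //; exact: mz.
pose Q u := `|zeta (rho_ x u)| `^ s * Y x u `^ s.
have mzs : measurable_fun setT (fun r => `|zeta r| `^ s).
  by apply: measurable_powRf; exact: measurableT_comp.
have mQ : measurable_fun setT Q by exact: (mz (fun r => `|zeta r| `^ s)).
have EQ : (EP Q <= (Cz * CY)%:E)%E.
  rewrite (indep (fun r => `|zeta r| `^ s) (fun u => Y x u `^ s))//.
  - rewrite EFinM; apply: lee_pmul => //; apply: EP_ge0 => u; exact: powR_ge0.
  - exact: (measurableT_comp (measurable_powR s) (@Y_past x)).
  - by move=> r; exact: powR_ge0.
have Q0 u : 0 <= Q u by rewrite mulr_ge0 ?powR_ge0.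
have key : (EP (fun u => W u + LL u)%R <= EP (fun u => (`|T u| `^ s + RR u) + 13 * Q u)%R)%E.
  apply: EP_le.
  - exact: measurable_funD.
  - by apply: measurable_funD; [exact: measurable_funD|exact: measurable_funM].
  - by move=> u; rewrite addr_ge0 ?powR_ge0.
  move=> u; have := @powR_normD_le _ s (T u) (zeta (rho_ x u) * Y x u) s12.
  rewrite part_split normrM (ger0_norm (Y0 _ _)) powRM// -/(W u) -/(Q u).
  rewrite /LL /RR /Gp /Gm -zpm.
  set gp := Num.max _ _ `^ _; set gm := Num.max _ _ `^ _.
  move=> hW; rewrite -subr_ge0; move: hW; rewrite -subr_ge0.
  by congr (is_true (0 <= _)); ring.
have Wfin : (EP W + EP LL <= c%:E + EP LL + (13 * (Cz * CY))%:E)%E.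
  rewrite -EPD//; last by move=> u; exact: powR_ge0.
  apply: (le_trans key); rewrite EPD//; first last.
  - by move=> u; rewrite mulr_ge0.
  - by move=> u; rewrite addr_ge0 ?powR_ge0.
  - exact: measurable_funM.
  - exact: measurable_funD.
  rewrite EPD//; try by move=> u; exact: powR_ge0.
  rewrite ERR ELL EPZ//; apply: leeD; first exact: leeD2r.
  by rewrite EFinM lee_pmul2l.
move: Wfin; rewrite ELL => hW.
rewrite -(@leeD2rE _ (z * b + z * a)%:E)//; apply: (le_trans hW).
by rewrite -!EFinD lee_fin addrAC.
Qed.

(** A block of increments with indices below a + k belongs to the past of a + k, so [mart_step] adds
    one constant per increment, whatever the start a. The chaining argument needs this
    uniformity. *)
Lemma martingale_moment : exists C : R, 0 <= C /\ forall a k : nat,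
  (EP (fun u => `|\sum_(i < k) (h (rho_ (a + i)%N u) - rho_mean) * Y (a + i)%N u| `^ s)%R
    <= (C * k%:R)%:E)%E.
Proof.
have [C [C0 HC]] := mart_step; exists C; split => // a; elim=> [|k IHk].
  rewrite mulr0 -[leRHS](EP_cst P 0); apply: le_of_eq.
  by apply: eq_integral => u _; rewrite big_ord0 normr0 powR0 ?gt_eqF.
have pT : measurable_fun [set: past (a + k)%N]
    (fun u => \sum_(i < k) (h (rho_ (a + i)%N u) - rho_mean) * Y (a + i)%N u).
  apply: measurable_sum => i; apply: measurable_funM.
    apply: (measurableT_comp mzeta); apply: rho_past => //.
    by have := ltn_ord i; lia.
  by apply: (past_le _ (@Y_past _)); have := ltn_ord i; lia.
rewrite -natr1 mulrDr mulr1; apply: le_trans (HC _ _ _ pT IHk).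
apply: le_of_eq.
by apply: eq_integral => u _; rewrite big_ord_recr.
Qed.

Lemma martingale_growth (e : R) : 0 < e ->
  {ae P, forall u, exists T : R, 0 <= T /\ forall n : nat, (0 < n)%N ->
    `|\sum_(i < n) (h (rho_ i%:Z u) - rho_mean) * Y i%:Z u| <= T * n%:R `^ ((1 + e) / s)}.
Proof.
move=> e0; have [C [C0 HC]] := martingale_moment.
pose S (n : nat) u := \sum_(i < n) (h (rho_ i%:Z u) - rho_mean) * Y i%:Z u.
apply: (@ae_growth _ _ _ P S s C e s0 C0 e0) => [n|u|a b ab].
- apply: measurable_sum => i; apply: measurable_funM.
    by apply: (measurableT_comp mzeta); exact: rho_meas.
  exact: (past_meas om_meas (@Y_past _)).
- by rewrite /S big_ord0.
apply: le_trans (HC a (b - a)%N); apply: EP_le.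
- apply: measurable_powRf; apply: measurableT_comp => //; apply: measurable_funB;
  apply: measurable_sum => i; apply: measurable_funM.
  + by apply: (measurableT_comp mzeta); exact: rho_meas.
  + exact: (past_meas om_meas (@Y_past _)).
  + by apply: (measurableT_comp mzeta); exact: rho_meas.
  + exact: (past_meas om_meas (@Y_past _)).
- apply: measurable_powRf; apply: measurableT_comp => //.
  apply: measurable_sum => i; apply: measurable_funM.
  + by apply: (measurableT_comp mzeta); exact: rho_meas.
  + exact: (past_meas om_meas (@Y_past _)).
- by move=> u; exact: powR_ge0.
move=> u; apply: le_of_eq; congr (`|_| `^ s).
have -> : S b u = S (a + (b - a))%N u by rewrite subnKC.
by rewrite /S big_split_ord/= addrAC subrr add0r.
Qed.

End PowerMartingale.

(** * Sums of the variances *)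

Section PowerGrowthOrder.
Context {R : realType}.
Variable g : R.
Hypothesis g0 : 0 <= g.
Implicit Types f : nat -> R.

(** The index 0 is left out because 0^g vanishes for g <> 0. *)
Definition powO f := exists T : R, 0 <= T /\ forall n, (0 < n)%N -> `|f n| <= T * n%:R `^ g.

Lemma powO_eq f1 f2 : (forall n, f1 n = f2 n) -> powO f1 -> powO f2.
Proof. by move=> h [T [T0 H]]; exists T; split => // n; rewrite -h; exact: H. Qed.

Lemma powOD f1 f2 : powO f1 -> powO f2 -> powO (fun n => f1 n + f2 n).
Proof.
move=> [T1 [T10 H1]] [T2 [T20 H2]]; exists (T1 + T2); split; first by rewrite addr_ge0.
move=> n n0; rewrite mulrDl; apply: le_trans (ler_normD _ _) _.
by apply: lerD; [exact: H1|exact: H2].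
Qed.

Lemma powOZ (c : R) f : powO f -> powO (fun n => c * f n).
Proof.
move=> [T [T0 H]]; exists (`|c| * T); split; first by rewrite mulr_ge0.
by move=> n n0; rewrite normrM -mulrA ler_wpM2l// H.
Qed.

Lemma powO_cst (c : R) : powO (fun=> c).
Proof.
exists `|c|; split => // n n0; rewrite ler_peMr//.
have : 1 `^ g <= n%:R `^ g :> R by apply: ge0_ler_powR; rewrite ?nnegrE// ler1n.
by rewrite powR1.
Qed.

End PowerGrowthOrder.

Section VarianceRecursion.
Context {R : realType}.
Variables (g r1 r2 : R) (r a V : nat -> R).
Hypothesis g0 : 0 <= g.
Hypotheses (r1_lt1 : r1 < 1) (r2_lt1 : r2 < 1).
Hypothesis aS : forall i, a i.+1 = 2 + r i * a i.
Hypothesis VS : forall i, V i.+1 = r i * V i + (r i + r i ^+ 2) * a i ^+ 2.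

(** The stationary solution of the recursions when r and r^2 are averaged to r1 and r2: a has mean
    A1 = 2 / (1 - r1), a^2 has mean A2 = (4 + 4 r1 A1) / (1 - r2), and V has mean (r1 + r2) A2 / (1
    - r1). *)
Definition crossing_var : R :=
  (r1 + r2) * ((4 + 4 * r1 * (2 / (1 - r1))) / (1 - r2)) / (1 - r1).

Let sumS (f : nat -> R) n : \sum_(i < n) f i.+1 = \sum_(i < n) f i + f n - f 0%N.
Proof.
rewrite -(big_mkord xpredT (fun i => f i.+1)) -(big_mkord xpredT f).
have := telescope_sumr f (leq0n n); rewrite sumrB => /eqP; rewrite subr_eq => /eqP ->.
ring.
Qed.

Hypothesis N1 : powO g (fun n => \sum_(i < n) (r i - r1) * a i).
Hypothesis N2 : powO g (fun n => \sum_(i < n) (r i ^+ 2 - r2) * a i ^+ 2).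
Hypothesis N3 : powO g (fun n => \sum_(i < n) (r i - r1) * V i).
Hypothesis N4 : powO g (fun n => \sum_(i < n) (r i - r1) * a i ^+ 2).
Hypothesis Oa : powO g a.
Hypothesis Oa2 : powO g (fun n => a n ^+ 2).
Hypothesis OV : powO g V.

Let d1 : 1 - r1 != 0. Proof. by rewrite subr_eq0 eq_sym lt_eqF. Qed.
Let d2 : 1 - r2 != 0. Proof. by rewrite subr_eq0 eq_sym lt_eqF. Qed.

Let sum_cst (c : R) n : \sum_(i < n) c = c * n%:R.
Proof. by rewrite sumr_const card_ord mulr_natr. Qed.

Let A1 : R := 2 / (1 - r1).
Let A2 : R := (4 + 4 * r1 * A1) / (1 - r2).

(** Write r i = (r i - r1) + r1 and sum the recursion: the index shift leaves only boundary terms,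
    and solving for the sum divides by 1 - r1. The same is then done for a^2 and for V. *)
Let O1 : powO g (fun n => \sum_(i < n) a i - A1 * n%:R).
Proof.
have h := powOZ (1 - r1)^-1 (powOD (powOD N1 (powO_cst g0 (a 0%N))) (powOZ (-1) Oa)).
apply: powO_eq h => n; apply: (mulfI d1); rewrite mulVKf//.
have e : \sum_(i < n) a i.+1 = 2 * n%:R + \sum_(i < n) (r i - r1) * a i + r1 * \sum_(i < n) a i.
  rewrite -sum_cst mulr_sumr -!big_split/=; apply: eq_bigr => i _; rewrite aS; ring.
move: e; rewrite sumS /A1 => e; rewrite mulrBr mulrA (mulrC _ (2 / _)) divfK//.
lra.
Qed.

Let O2 : powO g (fun n => \sum_(i < n) a i ^+ 2 - A2 * n%:R).
Proof.
have h := powOZ (1 - r2)^-1 (powOD (powOD (powOD (powOD (powOZ 4 N1) (powOZ (4 * r1) O1)) N2)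
  (powO_cst g0 (a 0%N ^+ 2))) (powOZ (-1) Oa2)).
apply: powO_eq h => n; apply: (mulfI d2); rewrite mulVKf//.
have e : \sum_(i < n) a i.+1 ^+ 2 = 4 * n%:R + 4 * \sum_(i < n) (r i - r1) * a i +
    4 * r1 * \sum_(i < n) a i + \sum_(i < n) (r i ^+ 2 - r2) * a i ^+ 2 +
    r2 * \sum_(i < n) a i ^+ 2.
  rewrite -sum_cst !mulr_sumr -!big_split/=; apply: eq_bigr => i _; rewrite aS; ring.
move: e; rewrite (sumS (fun i => a i ^+ 2)) => e.
have d : (1 - r2) * A2 = 4 + 4 * r1 * A1 by rewrite /A2 mulrC divfK.
rewrite [RHS]mulrBr [(_ * (_ * n%:R))%R in RHS]mulrA d; lra.
Qed.

Lemma sum_var_growth : powO g (fun n => \sum_(i < n) V i.+1 - crossing_var * n%:R).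
Proof.
have h := powOZ (1 - r1)^-1 (powOD (powOD (powOD (powOD (powOD N3 N4) N2)
  (powOZ (r1 + r2) O2)) (powO_cst g0 (r1 * V 0%N))) (powOZ (- r1) OV)).
apply: powO_eq h => n; apply: (mulfI d1); rewrite mulVKf//.
have e : \sum_(i < n) V i.+1 = \sum_(i < n) (r i - r1) * V i + r1 * \sum_(i < n) V i +
    \sum_(i < n) (r i - r1) * a i ^+ 2 + \sum_(i < n) (r i ^+ 2 - r2) * a i ^+ 2 +
    (r1 + r2) * \sum_(i < n) a i ^+ 2.
  rewrite !mulr_sumr -!big_split/=; apply: eq_bigr => i _; rewrite VS; ring.
have d : (1 - r1) * crossing_var = (r1 + r2) * A2 by rewrite /crossing_var -/A1 -/A2 mulrC divfK.
have e' := sumS V n; rewrite [RHS]mulrBr [(_ * (_ * n%:R))%R in RHS]mulrA d.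
set X := \sum_(i < n) V i.+1 in e e' *; set W := \sum_(i < n) V i in e e' *.
move: e; have -> : W = X - V n + V 0%N by rewrite e'; ring.
move=> e; lra.
Qed.

End VarianceRecursion.

Section FixpointMean.
Context {R : realType}.

(** Every point of a bounded two-sided orbit of an affine contraction has infinitely many steps
    behind it, so it sits at the fixed point. Applied to means at the various sites, this shows that
    they do not depend on the site. *)
Lemma bounded_fixpoint (al : int -> R) (c r K : R) : 0 <= r < 1 ->
  (forall x, 0 <= al x <= K) -> (forall x, al (x + 1) = c + r * al x) ->
  forall x, al x = c / (1 - r).
Proof.
move=> /andP[r0 r1] alK alS x.
have d1 : 1 - r != 0 by rewrite subr_eq0 eq_sym lt_eqF.
pose b := c / (1 - r); pose be y := `|al y - b|.
have beS y : be (y + 1) = r * be y.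
  rewrite /be -[in RHS](ger0_norm r0) -normrM; congr `|_|; rewrite alS.
  have -> : c = b * (1 - r) by rewrite /b divfK.
  ring.
have beK y : be y <= K + `|b|.
  rewrite /be; apply: le_trans (ler_normB _ _) _; rewrite lerD2r.
  by have /andP[a0 aK] := alK y; rewrite ger0_norm.
have step n y : be y <= r ^+ n * (K + `|b|).
  elim: n y => [|n IHn] y; first by rewrite mul1r.
  by rewrite -[y](subrK 1) beS exprS -mulrA ler_wpM2l.
apply/eqP; rewrite -subr_eq0 -normr_le0; apply/ler_addgt0Pr => e e0; rewrite add0r.
have : r ^+ n * (K + `|b|) @[n --> \oo] --> (0 : R).
  rewrite -(mul0r (K + `|b|)); apply: cvgMl; apply: cvg_expr.
  by rewrite ger0_norm.
move=> /cvgrPdist_lt/(_ e e0)[n _ /(_ n (leqnn _))]; rewrite sub0r normrN => hn.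
by apply: le_trans (step n x) _; apply: ltW; apply: le_lt_trans hn; exact: ler_norm.
Qed.

End FixpointMean.

Section AlmostSurePowerBounds.
Context {d : measure_display} {Omega : measurableType d} {R : realType}.
Variable P : probability Omega R.
Local Notation EP := (EP P).
Variables (Y : nat -> Omega -> R) (s C e : R).
Hypotheses (s0 : 0 < s) (C0 : 0 <= C) (e0 : 0 < e).
Hypothesis mY : forall n, measurable_fun setT (Y n).
Hypothesis Y0 : forall n u, 0 <= Y n u.
Hypothesis EY : forall n, (EP (fun u => Y n u `^ s)%R <= C%:E)%E.

Let root (a b : R) : 0 <= a -> 0 <= b -> a `^ s <= b -> a <= b `^ s^-1.
Proof.
move=> a0 b0 ab; rewrite -[a]powRr1// -(divff (x := s)) ?gt_eqF// powRrM.
by apply: ge0_ler_powR; rewrite ?nnegrE ?powR_ge0// invr_ge0 ltW.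
Qed.

Lemma ae_pointwise_growth : {ae P, forall u, powO ((1 + e) / s) (Y ^~ u)}.
Proof.
have := ae_growth_nonneg s0 C0 e0 mY Y0 EY; apply: filterS => u [T [T0 HT]].
exists (T `^ s^-1 * 2 `^ ((1 + e) / s)); split; first by rewrite mulr_ge0 ?powR_ge0.
move=> n n0; rewrite ger0_norm//.
have e1 : 0 <= 1 + e by rewrite addr_ge0// ltW.
have si : 0 <= s^-1 by rewrite invr_ge0 ltW.
(* The term of index n first enters the sum of n + 1 terms, and n + 1 <= 2 n; hence the factor 2. *)
have hT : Y n u `^ s <= T * (2 * n%:R) `^ (1 + e).
  have := HT n.+1 isT; rewrite big_ord_recr/= => h.
  apply: (@le_trans _ _ (T * n.+1%:R `^ (1 + e))).
    by apply: le_trans h; rewrite lerDr sumr_ge0// => i _; exact: powR_ge0.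
  rewrite ler_wpM2l//; apply: ge0_ler_powR => //; rewrite ?nnegrE ?mulr_ge0//.
  by rewrite -natrM ler_nat mul2n -addnn -addn1 leq_add2l.
have Tn0 : 0 <= T * (2 * n%:R) `^ (1 + e) by rewrite mulr_ge0 ?powR_ge0.
apply: (le_trans (root (Y0 _ _) Tn0 hT)).
by rewrite powRM ?powR_ge0// -powRrM powRM// mulrA.
Qed.

Lemma ae_sum_growth : s <= 1 ->
  {ae P, forall u, powO ((1 + e) / s) (fun n => \sum_(i < n) Y i u)}.
Proof.
move=> s1; have := ae_growth_nonneg s0 C0 e0 mY Y0 EY; apply: filterS => u [T [T0 HT]].
exists (T `^ s^-1); split; first exact: powR_ge0.
have si : 0 <= s^-1 by rewrite invr_ge0 ltW.
move=> n n0; rewrite ger0_norm; last by rewrite sumr_ge0.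
apply: (@le_trans _ _ ((T * n%:R `^ (1 + e)) `^ s^-1)).
  apply: root; [by rewrite sumr_ge0|by rewrite mulr_ge0 ?powR_ge0|].
  apply: le_trans (HT n n0); apply: (@powR_sum_subadd _ s n (fun i => Y i u)) => //.
  by rewrite s0.
by rewrite powRM ?powR_ge0// -powRrM.
Qed.

End AlmostSurePowerBounds.

(** * Mean and fluctuations of the quenched variance *)

Section CrossingVariance.
Context {d : measure_display} {Omega : measurableType d} {R : realType}.
Variables (P : probability Omega R) (om : int -> Omega -> R).
Hypothesis om_meas : forall x, measurable_fun setT (om x).
Hypothesis om_ident : forall x (B : set R), measurable B ->
  P (om x @^-1` B) = P (om 0 @^-1` B).
Hypothesis om_indep : forall (s : seq int) (B : int -> set R), uniq s ->
  (forall x, measurable (B x)) ->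
  P (\bigcap_(x in [set` s]) (om x @^-1` B x)) =
  (\prod_(x <- s) P (om x @^-1` B x))%E.
Hypothesis om01 : forall x u, 0 < om x u <= 1.

Local Notation past := (past om).
Local Notation EP := (EP P).
Local Notation rho_ := (rho_ om).
Local Notation mom := (mom om).

Variable p : R.
Hypothesis p24 : 2 < p <= 4.
Hypothesis rho_p : (EP (fun u => rho_ 0 u `^ p)%R < 1)%E.

Let p2 : 2 < p. Proof. by case/andP: p24. Qed.
Let p0 : 0 < p. Proof. by have := p2; lra. Qed.

Definition vmom x u : R := mom 2 x u - mom 1 x u ^+ 2.

Definition regular u := forall x,
  [/\ pmom (om ^~ u) 0 N x @[N --> \oo] --> (1 : R),
      pmom (om ^~ u) 1 N x @[N --> \oo] --> mom 1 x u,
      pmom (om ^~ u) 2 N x @[N --> \oo] --> mom 2 x u &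
      pmom (om ^~ u) 3 N x @[N --> \oo] --> mom 3 x u].

Lemma regular_ae : {ae P, forall u, regular u}.
Proof.
have [C1 [C10 H1]] := pmom1_moment om_meas om_ident om_indep om01 p0 rho_p.
have [C2 [C20 H2]] := pmom2_moment om_meas om_ident om_indep om01 p0 rho_p.
have [C3 [C30 H3]] := pmom3_moment om_meas om_ident om_indep om01 p0 rho_p.
have p2' : 0 < p / 2 by rewrite divr_gt0.
have p3' : 0 < p / 3 by rewrite divr_gt0.
have c1 := mom_cvg_ae om_meas om01 p0 H1.
have c2 := mom_cvg_ae om_meas om01 p2' H2.
have c3 := mom_cvg_ae om_meas om01 p3' H3.
have c0 := mom0_ae1 om_meas om_ident om_indep om01 p0 rho_p.
apply: filterS2 (filterI c0 c1) (filterI c2 c3) => u [h0 h1] [h2 h3] x; split => //.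
by rewrite -(h0 x); exact: mom0_cvg.
Qed.

Lemma mom1_rec u x : regular u -> mom 1 x u = 1 + rho_ x u * (1 + mom 1 (x - 1) u).
Proof.
move=> h; apply: (@pmom1_lim _ _ (om01 ^~ u) (fun y => mom 1 y u)) => y;
by have [] := h y.
Qed.

Lemma vmom_rec u x : regular u -> vmom x u =
  rho_ x u * vmom (x - 1) u + (rho_ x u + rho_ x u ^+ 2) * (1 + mom 1 (x - 1) u) ^+ 2.
Proof.
move=> h.
have := @pvar_lim _ _ (om01 ^~ u) (fun y => mom 1 y u) (fun y => mom 2 y u) _ _ _ x.
move=> /(_ (fun y => let: And4 a _ _ _ := h y in a)
          (fun y => let: And4 _ a _ _ := h y in a)
          (fun y => let: And4 _ _ a _ := h y in a)).
by rewrite -/(vmom x u) -/(vmom (x - 1) u) => ->; rewrite /rho_; ring.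
Qed.

(** With m the truncated mean and m0 <= 1 the truncated mass, the sum of (k - m)^2 weighted by [pmf]
    is m2 - 2 m^2 + m^2 m0 >= 0, so m^2 <= m2 already before the limit. *)
Lemma vmom_ge0 u x : regular u -> 0 <= vmom x u.
Proof.
move=> /(_ x)[_ c1 c2 _]; rewrite /vmom -(cvg_lim (@Rhausdorff R) c2).
have c12 : pmom (om ^~ u) 1 N x ^+ 2 @[N --> \oo] --> mom 1 x u ^+ 2.
  by rewrite expr2; under eq_cvg do rewrite expr2; exact: cvgM.
rewrite -(cvg_lim (@Rhausdorff R) c12) subr_ge0.
apply: ler_lim; [exact: cvgP c12|exact: cvgP c2|apply: nearW => N].
have w01 y : 0 <= om y u <= 1 by have /andP[/ltW -> ->] := om01 y u.
set m := pmom _ 1 N x.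
have expand (t : R) : \sum_(k < N) (k%:R - t) ^+ 2 * pmf (om ^~ u) x k =
    pmom (om ^~ u) 2 N x + (- 2 * t) * pmom (om ^~ u) 1 N x + t ^+ 2 * pmom (om ^~ u) 0 N x.
  by rewrite /pmom !mulr_sumr -!big_split/=; apply: eq_bigr => k _; ring.
have : 0 <= \sum_(k < N) (k%:R - m) ^+ 2 * pmf (om ^~ u) x k.
  by apply: sumr_ge0 => k _; rewrite mulr_ge0 ?sqr_ge0// pmf_ge0.
rewrite expand -/m.
have := @pmom0_le1 _ (om ^~ u) (om01 ^~ u) N x; have := sqr_ge0 m.
set m0 := pmom _ 0 N x; set m2 := pmom _ 2 N x; move=> h1 h2 h3.
have : 0 <= m ^+ 2 * (1 - m0) by rewrite mulr_ge0// subr_ge0.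
lra.
Qed.

Let a_ x u := 1 + mom 1 (x - 1) u.
(* The absolute value is superfluous on the almost sure event [regular]. *)
Let V_ x u := `|vmom (x - 1) u|.

Let mom_past' j x : measurable_fun [set: past x] (mom j (x - 1)).
Proof. by have := @mom_past _ _ _ _ om01 j (x - 1); rewrite subrK. Qed.

Let a_past x : measurable_fun [set: past x] (a_ x).
Proof. by apply: measurable_funD => //; exact: measurable_cst. Qed.

Let a2_past x : measurable_fun [set: past x] (fun u => a_ x u ^+ 2).
Proof. exact: measurable_funX. Qed.

Let V_past x : measurable_fun [set: past x] (V_ x).
Proof.
apply: measurableT_comp => //; apply: measurable_funB => //.
exact: measurable_funX.
Qed.

Let a_ge1 x u : 1 <= a_ x u. Proof. by rewrite lerDl mom_ge0. Qed.
Let a_ge0 x u : 0 <= a_ x u. Proof. exact: le_trans (a_ge1 x u). Qed.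
Let V_ge0 x u : 0 <= V_ x u. Proof. exact: normr_ge0. Qed.

Let ma x : measurable_fun setT (a_ x). Proof. exact: (past_meas om_meas (@a_past x)). Qed.
Let ma2 x : measurable_fun setT (fun u => a_ x u ^+ 2).
Proof. exact: (past_meas om_meas (@a2_past x)). Qed.
Let mV x : measurable_fun setT (V_ x). Proof. exact: (past_meas om_meas (@V_past x)). Qed.

Lemma moment_bounds : exists C : R, 0 <= C /\ forall x,
  [/\ (EP (fun u => a_ x u `^ p)%R <= C%:E)%E,
      (EP (fun u => V_ x u `^ (p / 2))%R <= C%:E)%E &
      (EP (fun u => mom 1 x u `^ p)%R <= C%:E)%E].
Proof.
have [C1 [C10 H1]] := pmom1_moment om_meas om_ident om_indep om01 p0 rho_p.
have [C2 [C20 H2]] := pmom2_moment om_meas om_ident om_indep om01 p0 rho_p.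
have p2' : 0 < p / 2 by rewrite divr_gt0.
have B1 x := mom_moment_le om_meas om01 x p0 H1.
have B2 x := mom_moment_le om_meas om01 x p2' H2.
pose Ca := 2 `^ p * (1 + C1); pose CV := 2 `^ (p / 2) * (C2 + C1).
have Ca0 : 0 <= Ca by rewrite mulr_ge0 ?powR_ge0// addr_ge0.
have CV0 : 0 <= CV by rewrite mulr_ge0 ?powR_ge0// addr_ge0.
exists (Ca + CV + C1); split; first by rewrite !addr_ge0.
move=> x; split.
- apply: (@le_trans _ _ Ca%:E); last by rewrite lee_fin; lra.
  apply: le_trans (EP_powD _ _ _ _ _ _) _ => //; [exact: ltW|exact: mom_meas|exact: mom_ge0|].
  rewrite EFinM lee_pmul2l ?lte_fin ?powR_gt0// powR1 EP_cst EFinD leeD2l//.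
- apply: (@le_trans _ _ CV%:E); last by rewrite lee_fin; lra.
  have m2 := mom_meas om_meas om01 2 (x - 1); have m1 := mom_meas om_meas om01 1 (x - 1).
  apply: (@le_trans _ _ (EP (fun u => (mom 2 (x - 1) u + mom 1 (x - 1) u ^+ 2) `^ (p / 2))%R)).
    apply: EP_le.
    + exact: measurable_powRf.
    + by apply: measurable_powRf; apply: measurable_funD => //; exact: measurable_funX.
    + by move=> u; exact: powR_ge0.
    move=> u; have := mom_ge0 om01 2 (x - 1) u; have := sqr_ge0 (mom 1 (x - 1) u).
    rewrite /V_ /vmom; set m := _ ^+ 2; set m' := mom 2 _ _ => h1 h2.
    apply: ge0_ler_powR; rewrite ?nnegrE ?(ltW p2') ?addr_ge0//.
    by rewrite ler_norml; lra.
  apply: le_trans (EP_powD _ _ _ _ _ _) _ => //.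
  + exact: ltW.
  + exact: measurable_funX.
  + exact: mom_ge0.
  + by move=> u; exact: sqr_ge0.
  rewrite EFinM lee_pmul2l ?lte_fin ?powR_gt0// EFinD leeD//.
  apply: le_trans (B1 (x - 1)); apply: le_of_eq.
  apply: eq_integral => u _; congr EFin.
  by rewrite -powR_mulrn ?mom_ge0// -powRrM mulrCA divff// mulr1.
- by apply: le_trans (B1 x) _; rewrite lee_fin; lra.
Qed.

(** The independence and martingale lemmas take functions that are nonnegative on the whole line,
    hence the absolute value; [h1] is the identity on the odds. *)
Let h1 (r : R) : R := `|r|.
Let h2 (r : R) : R := r ^+ 2.
Let mh1 : measurable_fun setT h1. Proof. exact: normr_measurable. Qed.
Let mh2 : measurable_fun setT h2. Proof. exact: measurable_funX. Qed.
Let h10 r : 0 <= h1 r. Proof. exact: normr_ge0. Qed.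
Let h20 r : 0 <= h2 r. Proof. exact: sqr_ge0. Qed.

Let h1E x u : h1 (rho_ x u) = rho_ x u.
Proof. by rewrite /h1 ger0_norm// rho_ge0. Qed.

Local Notation r1 := (rho_mean P om h1).
Local Notation r2 := (rho_mean P om h2).

Let rho_lt1 (h : R -> R) s : (forall u, h (rho_ 0 u) = rho_ 0 u `^ s) -> (forall r, 0 <= h r) ->
  0 < s <= p -> [/\ EP (fun u => h (rho_ 0 u)) = (rho_mean P om h)%:E,
    0 <= rho_mean P om h & rho_mean P om h < 1].
Proof.
move=> hs h0 sp.
have := rho_mom_lt1 om_meas om01 p0 rho_p sp.
have -> : EP (fun u => rho_ 0 u `^ s)%R = EP (fun u => h (rho_ 0 u)).
  by apply: eq_integral => u _; rewrite hs.
move=> l1.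
have fE : EP (fun u => h (rho_ 0 u)) = (rho_mean P om h)%:E.
  rewrite /rho_mean fineK// ge0_fin_numE; last by apply: EP_ge0.
  by apply: lt_trans l1 _; rewrite ltry.
split => //; first by rewrite /rho_mean fine_ge0// EP_ge0.
by rewrite -lte_fin -fE.
Qed.

Let R1 : [/\ EP (fun u => h1 (rho_ 0 u)) = r1%:E, 0 <= r1 & r1 < 1].
Proof.
apply: (@rho_lt1 h1 1) => //; last by have := p2; lra.
by move=> u; rewrite h1E powRr1// rho_ge0.
Qed.

Let R2 : [/\ EP (fun u => h2 (rho_ 0 u)) = r2%:E, 0 <= r2 & r2 < 1].
Proof.
apply: (@rho_lt1 h2 2) => //; last by have := p2; lra.
by move=> u; rewrite powR_mulrn// rho_ge0.
Qed.

Let EP_ae_eq (f g : Omega -> R) : measurable_fun setT f -> measurable_fun setT g ->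
  (forall u, 0 <= f u) -> (forall u, 0 <= g u) -> {ae P, forall u, f u = g u} -> EP f = EP g.
Proof.
move=> mf mg f0 g0 fg; apply: ge0_ae_eq_integral => //.
- exact/measurable_EFinP.
- exact/measurable_EFinP.
- by move=> u _; rewrite lee_fin.
- by move=> u _; rewrite lee_fin.
- by apply: filterS fg => u -> _.
Qed.

Let finite_mean : exists K : R, forall x,
  [/\ (EP (a_ x) <= K%:E)%E, (EP (fun u => a_ x u ^+ 2)%R <= K%:E)%E & (EP (V_ x) <= K%:E)%E].
Proof.
have [C [C0 HC]] := moment_bounds.
have ap x s u : s <= p -> a_ x u `^ s <= a_ x u `^ p by move=> sp; rewrite ler_powR.
exists (1 + C) => x; have [Ha HV _] := HC x; split.
- apply: (@le_trans _ _ C%:E); last by rewrite lee_fin; lra.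
  apply: le_trans Ha; apply: EP_le => //; first exact: measurable_powRf.
  by move=> u; rewrite -[leLHS]powRr1//; apply: ap; have := p2; lra.
- apply: (@le_trans _ _ C%:E); last by rewrite lee_fin; lra.
  apply: le_trans Ha; apply: EP_le => //; first exact: measurable_powRf.
    by move=> u; exact: sqr_ge0.
  by move=> u; rewrite -powR_mulrn//; apply: ap; exact: ltW.
- apply: (@le_trans _ _ (1%:E + EP (fun u => V_ x u `^ (p / 2))%R)%E); last by rewrite EFinD leeD2l.
  rewrite -(EP_cst P 1) -EPD//; last first.
  + by move=> u; exact: powR_ge0.
  + exact: measurable_powRf.
  apply: EP_le => //.
  + by apply: measurable_funD => //; exact: measurable_powRf.
  move=> u; have := @powR_le1D _ (p / 2)^-1 (V_ x u `^ (p / 2)).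
  rewrite -powRrM divff ?gt_eqF ?divr_gt0// powRr1//; apply; last exact: powR_ge0.
  by rewrite invr_ge0 divr_ge0 ?(ltW p0)// invf_le1 ?divr_gt0//; have := p2; lra.
Qed.

Let mrho x : measurable_fun setT (rho_ x). Proof. exact: rho_meas. Qed.

Let aS u x : regular u -> a_ (x + 1) u = 2 + rho_ x u * a_ x u.
Proof. by move=> h; rewrite /a_ addrK mom1_rec//; ring. Qed.

Let VS u x : regular u -> V_ (x + 1) u =
  rho_ x u * V_ x u + (rho_ x u + rho_ x u ^+ 2) * a_ x u ^+ 2.
Proof.
by move=> h; rewrite /V_ addrK !ger0_norm ?vmom_ge0// vmom_rec.
Qed.

Let EPh1 x (f : Omega -> R) : measurable_fun [set: past x] f -> (forall u, 0 <= f u) ->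
  EP (fun u => rho_ x u * f u)%R = (r1%:E * EP f)%E.
Proof.
move=> mf f0; have [<- _ _] := R1.
rewrite -(EP_rhoM om_meas om_ident om_indep om01 mh1 h10 mf f0).
by apply: eq_integral => u _; rewrite h1E.
Qed.

Let EPh2 x (f : Omega -> R) : measurable_fun [set: past x] f -> (forall u, 0 <= f u) ->
  EP (fun u => rho_ x u ^+ 2 * f u)%R = (r2%:E * EP f)%E.
Proof.
move=> mf f0; have [<- _ _] := R2.
by rewrite -(EP_rhoM om_meas om_ident om_indep om01 mh2 h20 mf f0).
Qed.

Definition walk_var : R := crossing_var r1 r2.

(** The means of a, a^2 and V solve affine recursions in the site with ratios E[rho], E[rho^2] and
    E[rho], and are bounded uniformly; [bounded_fixpoint] determines each of them. This identifies
    sigma^2 with [walk_var]. *)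
Lemma EP_vmom x : EP (fun u => `|vmom x u|) = walk_var%:E.
Proof.
have [K HK] := finite_mean; have [E1 r10 r11] := R1; have [E2 r20 r21] := R2.
have r1b : 0 <= r1 < 1 by rewrite r10 r11.
have r2b : 0 <= r2 < 1 by rewrite r20 r21.
have fin (f : Omega -> R) : (forall u, 0 <= f u) -> (EP f <= K%:E)%E -> EP f = (fine (EP f))%:E.
  by move=> f0 fK; rewrite fineK// ge0_fin_numE ?EP_ge0// (le_lt_trans fK)// ltry.
have Ea y : EP (a_ y) = (fine (EP (a_ y)))%:E by apply: fin => //; have [] := HK y.
have Ea2 y : EP (fun u => a_ y u ^+ 2)%R = (fine (EP (fun u => a_ y u ^+ 2)%R))%:E.
  by apply: fin => [u|]; [exact: sqr_ge0|have [] := HK y].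
have EV y : EP (V_ y) = (fine (EP (V_ y)))%:E by apply: fin => //; have [] := HK y.
have bnd (f : Omega -> R) : (forall u, 0 <= f u) -> (EP f <= K%:E)%E -> 0 <= fine (EP f) <= K.
  by move=> f0 fK; rewrite fine_ge0 ?EP_ge0//= -lee_fin -fin.
have rr0 y u : 0 <= rho_ y u by exact: rho_ge0.
have A1 : forall y, fine (EP (a_ y)) = 2 / (1 - r1).
  apply: (bounded_fixpoint (K := K) r1b).
    by move=> y; apply: bnd => //; have [] := HK y.
  move=> y; apply: EFin_inj; rewrite -Ea EFinD EFinM -Ea -(EPh1 (@a_past y))// -(EP_cst P 2) -EPD//.
  - apply: EP_ae_eq => //.
    + by apply: measurable_funD => //; exact: measurable_funM.
    + by move=> u; rewrite addr_ge0// mulr_ge0.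
    + by apply: filterS regular_ae => u h; exact: aS.
  - exact: measurable_funM.
  - by move=> u; rewrite mulr_ge0.
have A2 : forall y, fine (EP (fun u => a_ y u ^+ 2)%R) = (4 + 4 * r1 * (2 / (1 - r1))) / (1 - r2).
  apply: (bounded_fixpoint (K := K) r2b).
    by move=> y; apply: bnd => [u|]; [exact: sqr_ge0|have [] := HK y].
  move=> y; apply: EFin_inj; rewrite -Ea2.
  rewrite EFinD (EFinD 4) (EFinM r2) -Ea2 -(EPh2 (@a2_past y)); last by move=> u; exact: sqr_ge0.
  have -> : (4 * r1 * (2 / (1 - r1)))%:E = EP (fun u => 4 * (rho_ y u * a_ y u))%R.
    rewrite EPZ//; last 2 first.
    + exact: measurable_funM.
    + by move=> u; rewrite mulr_ge0.
    by rewrite EPh1// Ea A1 -!EFinM mulrA.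
  have m1 : measurable_fun setT (fun u => 4 * (rho_ y u * a_ y u)).
    by apply: measurable_funM => //; exact: measurable_funM.
  have m2 : measurable_fun setT (fun u => rho_ y u ^+ 2 * a_ y u ^+ 2).
    by apply: measurable_funM => //; exact: measurable_funX.
  have n1 u : 0 <= 4 * (rho_ y u * a_ y u) by apply: mulr_ge0 => //; exact: mulr_ge0.
  have n2 u : 0 <= rho_ y u ^+ 2 * a_ y u ^+ 2 by rewrite mulr_ge0 ?sqr_ge0.
  rewrite -(EP_cst P 4) -EPD// -EPD//.
  - apply: EP_ae_eq => //.
    + by apply: measurable_funD => //; exact: measurable_funD.
    + by move=> u; exact: sqr_ge0.
    + by move=> u; rewrite !addr_ge0.
    + by apply: filterS regular_ae => u h; rewrite aS//; ring.
  - exact: measurable_funD.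
  - by move=> u; rewrite addr_ge0.
suff A3 : forall y, fine (EP (V_ y)) = walk_var.
  by have := A3 (x + 1); rewrite /V_ addrK => <-; have := EV (x + 1); rewrite /V_ addrK.
rewrite /walk_var /crossing_var; apply: (bounded_fixpoint (K := K) r1b).
  by move=> y; apply: bnd => //; have [] := HK y.
move=> y; apply: EFin_inj; rewrite -EV [X in _ = X%:E]addrC -(A2 y).
have a20 u : 0 <= a_ y u ^+ 2 by exact: sqr_ge0.
have m1 : measurable_fun setT (fun u => rho_ y u * V_ y u) by exact: measurable_funM.
have m2 : measurable_fun setT (fun u => rho_ y u * a_ y u ^+ 2) by exact: measurable_funM.
have m3 : measurable_fun setT (fun u => rho_ y u ^+ 2 * a_ y u ^+ 2).
  by apply: measurable_funM => //; exact: measurable_funX.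
have n1 u : 0 <= rho_ y u * V_ y u by rewrite mulr_ge0.
have n2 u : 0 <= rho_ y u * a_ y u ^+ 2 by rewrite mulr_ge0.
have n3 u : 0 <= rho_ y u ^+ 2 * a_ y u ^+ 2 by rewrite mulr_ge0 ?sqr_ge0.
rewrite mulrDl !EFinD !EFinM -EV -Ea2 -(EPh1 (@V_past y))// -(EPh1 (@a2_past y))// -(EPh2
  (@a2_past y))// -EPD// -EPD//.
- apply: EP_ae_eq => //.
  + by apply: measurable_funD => //; exact: measurable_funD.
  + by move=> u; rewrite !addr_ge0.
  + by apply: filterS regular_ae => u h; rewrite VS//; ring.
- exact: measurable_funD.
- by move=> u; rewrite addr_ge0.
Qed.

Lemma walk_var_gt0 : (0 < EP (rho_ 0))%E -> 0 < walk_var.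
Proof.
move=> h; have [E1 r10 r11] := R1; have [E2 r20 r21] := R2.
have r1p : 0 < r1.
  rewrite -lte_fin -E1; apply: lt_le_trans h _; apply: le_of_eq.
  by apply: eq_integral => u _; rewrite h1E.
rewrite /walk_var /crossing_var divr_gt0 ?subr_gt0// mulr_gt0//.
  by rewrite ltr_wpDr.
rewrite divr_gt0 ?subr_gt0// ltr_wpDr// !mulr_ge0// invr_ge0 subr_ge0 ltW//.
Qed.

Lemma sum_vmom_growth e : 0 < e -> {ae P, forall u,
  powO ((1 + e) / (p / 2)) (fun n => \sum_(i < n) vmom i%:Z u - walk_var * n%:R)}.
Proof.
move=> e0; have [C [C0 HC]] := moment_bounds.
have [E1 r10 r11] := R1; have [E2 r20 r21] := R2.
(* The exponent at which all four martingales are controlled: rho^2, a^2 and V have moments of order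
   p/2, and p in (2,4] is exactly what puts it in (1,2]. *)
have s12 : 1 < p / 2 <= 2 by move: p24 => /andP[? ?]; apply/andP; split; lra.
have s0 : 0 < p / 2 by case/andP: s12; lra.
have sp : 0 < p / 2 <= p by rewrite s0; have := p0; lra.
have g0 : 0 <= (1 + e) / (p / 2) by rewrite divr_ge0 ?(ltW s0)// addr_ge0// ltW.
have p_half : (2 : R) * (p / 2) = p by rewrite mulrCA divff// mulr1.
have sqr_half (t : R) : 0 <= t -> (t ^+ 2) `^ (p / 2) = t `^ p.
  by move=> t0; rewrite -powR_mulrn// -powRrM p_half.
have Eh1 : (EP (fun u => h1 (rho_ 0 u) `^ (p / 2))%R <= 1%:E)%E.
  apply: le_trans (ltW (rho_mom_lt1 om_meas om01 p0 rho_p sp)).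
  by apply: le_of_eq; apply: eq_integral => u _; rewrite h1E.
have Eh2 : (EP (fun u => h2 (rho_ 0 u) `^ (p / 2))%R <= 1%:E)%E.
  apply: le_trans (ltW rho_p).
  apply: le_of_eq; apply: eq_integral => u _.
  by rewrite sqr_half// rho_ge0.
have Ea2 x : (EP (fun u => (a_ x u ^+ 2) `^ (p / 2))%R <= C%:E)%E.
  have [Ha _ _] := HC x; apply: le_trans Ha.
  apply: le_of_eq; apply: eq_integral => u _.
  by rewrite sqr_half.
have Ea x : (EP (fun u => a_ x u `^ (p / 2))%R <= C%:E)%E.
  have [Ha _ _] := HC x; apply: le_trans Ha; apply: EP_le; try exact: measurable_powRf.
    by move=> u; exact: powR_ge0.
  by move=> u; rewrite ler_powR//; case/andP: sp.
have EV x : (EP (fun u => V_ x u `^ (p / 2))%R <= C%:E)%E by have [] := HC x.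
have a20 x u : 0 <= a_ x u ^+ 2 by exact: sqr_ge0.
have mart (h : R -> R) := @martingale_growth _ _ _ P om om_meas om_ident om_indep om01 h (p / 2).
have N1 := mart h1 a_ 1 C mh1 h10 s12 Eh1 a_past a_ge0 Ea e e0.
have N2 := mart h2 (fun x u => a_ x u ^+ 2) 1 C mh2 h20 s12 Eh2 a2_past a20 Ea2 e e0.
have N3 := mart h1 V_ 1 C mh1 h10 s12 Eh1 V_past V_ge0 EV e e0.
have N4 := mart h1 (fun x u => a_ x u ^+ 2) 1 C mh1 h10 s12 Eh1 a2_past a20 Ea2 e e0.
have Oa2 := @ae_pointwise_growth _ _ _ P (fun n u => a_ n%:Z u ^+ 2) (p / 2) C e s0 C0 e0
  (fun n => ma2 n%:Z) (fun n => a20 n%:Z) (fun n => Ea2 n%:Z).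
have Oa := @ae_pointwise_growth _ _ _ P (fun n u => a_ n%:Z u) (p / 2) C e s0 C0 e0
  (fun n => ma n%:Z) (fun n => a_ge0 n%:Z) (fun n => Ea n%:Z).
have OV := @ae_pointwise_growth _ _ _ P (fun n u => V_ n%:Z u) (p / 2) C e s0 C0 e0
  (fun n => mV n%:Z) (fun n => V_ge0 n%:Z) (fun n => EV n%:Z).
apply: filterS2 (filterI (filterI regular_ae (filterI N1 N2)) (filterI N3 N4))
  (filterI Oa2 (filterI Oa OV)) => u [[h [n1 n2]] [n3 n4]] [oa2 [oa oV]].
have i1 (i : nat) : i.+1%:Z = i%:Z + 1 by rewrite intS addrC.
have h1u x : h1 (rho_ x u) = rho_ x u by exact: h1E.
have drop_h1 (f : int -> R) :
    (exists T : R, 0 <= T /\ forall n : nat, (0 < n)%N ->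
      `|\sum_(i < n) (h1 (rho_ i%:Z u) - r1) * f i%:Z| <= T * n%:R `^ ((1 + e) / (p / 2))) ->
    powO ((1 + e) / (p / 2)) (fun n => \sum_(i < n) (rho_ i%:Z u - r1) * f i%:Z).
  move=> [T [T0 HT]]; exists T; split => // n n0; apply: le_trans (HT n n0).
  by under [in leLHS]eq_bigr do rewrite -h1u.
have := @sum_var_growth _ ((1 + e) / (p / 2)) r1 r2 (fun i => rho_ i%:Z u)
  (fun i => a_ i%:Z u) (fun i => V_ i%:Z u) g0 r11 r21 _ _
  (drop_h1 (a_ ^~ u) n1) n2 (drop_h1 (V_ ^~ u) n3) (drop_h1 (fun x => a_ x u ^+ 2) n4) oa oa2 oV.
have H1 i : a_ i.+1%:Z u = 2 + rho_ i%:Z u * a_ i%:Z u by rewrite i1 aS.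
have H2 i : V_ i.+1%:Z u = rho_ i%:Z u * V_ i%:Z u + (rho_ i%:Z u + rho_ i%:Z u ^+ 2) * a_ i%:Z
  u ^+ 2.
  by rewrite i1 VS.
move=> /(_ H1 H2); apply: powO_eq => n; congr (_ - _).
by apply: eq_bigr => i _; rewrite i1 /V_ addrK ger0_norm// vmom_ge0.
Qed.

Lemma sum_third_moment_growth e : 0 < e -> let q := Num.min p 3 / 3 in {ae P, forall u,
  powO ((1 + e) / q) (fun n => \sum_(i < n) (mom 3 i%:Z u + mom 1 i%:Z u ^+ 3))}.
Proof.
move=> e0 q; pose p3 := Num.min p 3.
have p30 : 0 < p3 by rewrite lt_min p0 ltr0n.
have p3p : p3 <= p by rewrite ge_min lexx.
have q0 : 0 < q by rewrite divr_gt0.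
have q1 : q <= 1 by rewrite ler_pdivrMr// mul1r ge_min lexx orbT.
have p3pb : 0 < p3 <= p by rewrite p30.
have rho3 := rho_mom_lt1 om_meas om01 p0 rho_p p3pb.
have [C1 [C10 H1]] := pmom1_moment om_meas om_ident om_indep om01 p30 rho3.
have [C3 [C30 H3]] := pmom3_moment om_meas om_ident om_indep om01 p30 rho3.
have B1 x := mom_moment_le om_meas om01 x p30 H1.
have B3 x := mom_moment_le om_meas om01 x q0 H3.
have m3 := mom_meas om_meas om01 3; have m1 := mom_meas om_meas om01 1.
pose C := 2 `^ q * (C3 + C1).
have C0 : 0 <= C by rewrite mulr_ge0 ?powR_ge0 ?addr_ge0.
have m10 x u : 0 <= mom 1 x u ^+ 3 by rewrite exprn_ge0// mom_ge0.
have m30 x u : 0 <= mom 3 x u by exact: mom_ge0.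
apply: (@ae_sum_growth _ _ _ P (fun n u => mom 3 n%:Z u + mom 1 n%:Z u ^+ 3) q C e q0 C0 e0) => //.
- by move=> n; apply: measurable_funD => //; exact: measurable_funX.
- by move=> n u; rewrite addr_ge0.
move=> n; apply: le_trans (EP_powD _ _ _ _ _ _) _ => //; [exact: ltW|exact: measurable_funX|].
rewrite EFinM lee_pmul2l ?lte_fin ?powR_gt0// EFinD leeD//.
apply: le_trans (B1 n%:Z); apply: le_of_eq.
apply: eq_integral => u _; congr EFin.
by rewrite -powR_mulrn ?mom_ge0// -powRrM mulrCA divff// mulr1.
Qed.

End CrossingVariance.

(** * Rate of convergence *)

Section ConvolutionMoments.
Context {R : realType}.
Variables a b : nat -> R.
Hypotheses (a0 : forall i, 0 <= a i) (b0 : forall i, 0 <= b i).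

Let box (h : nat -> R) N := \sum_(j < N) \sum_(i < N) h (i + j)%N * (a j * b i).

Let cvg_convol h l : (forall i, 0 <= h i) -> box h N @[N --> \oo] --> l ->
  \sum_(k < N) h k * convol a b k @[N --> \oo] --> (l : R).
Proof.
move=> h0 hl.
apply: (@squeeze_cvgr _ _ _ _ (fun N => box h N./2) (box h)) => //.
  apply: nearW => N; rewrite sum_convol_le// andbT.
  apply: le_trans (sum_convol_ge h0 a0 b0 _) _.
  have N2 : (N./2.*2 <= N)%N by rewrite -{2}(odd_double_half N) leq_addl.
  rewrite (big_ord_widen _ (fun k => h k * convol a b k) N2) big_mkcond/=.
  apply: ler_sum => k _; case: ifP => // _.
  by rewrite mulr_ge0// sumr_ge0// => j _; rewrite mulr_ge0.
apply: (cvg_comp _ _ _ hl) => A [m _ mA]; exists m.*2 => // k /= mk; apply: mA => /=.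
by rewrite -(doubleK m) half_leq.
Qed.

Variables (la lb : R).
Hypothesis ha : \sum_(k < N) a k @[N --> \oo] --> (1 : R).
Hypothesis hb : \sum_(k < N) b k @[N --> \oo] --> (1 : R).
Hypothesis hka : \sum_(k < N) k%:R * a k @[N --> \oo] --> la.
Hypothesis hkb : \sum_(k < N) k%:R * b k @[N --> \oo] --> lb.

Lemma convol_mass : \sum_(k < N) convol a b k @[N --> \oo] --> (1 : R).
Proof.
have h : \sum_(k < N) 1 * convol a b k @[N --> \oo] --> (1 : R).
  apply: (@cvg_convol (fun=> 1)) => //.
  rewrite (_ : box _ = fun N => (\sum_(k < N) a k) * (\sum_(k < N) b k)).
    by rewrite -[X in _ --> X](mulr1 1); exact: cvgM.
  apply/funext => N; rewrite /box mulr_suml; apply: eq_bigr => j _.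
  by rewrite mulr_sumr; apply: eq_bigr => i _; rewrite mul1r.
rewrite (_ : (fun N => _) = (fun N => \sum_(k < N) 1 * convol a b k))//.
by apply/funext => N; apply: eq_bigr => k _; rewrite mul1r.
Qed.

Lemma convol_mean : \sum_(k < N) k%:R * convol a b k @[N --> \oo] --> la + lb.
Proof.
apply: (@cvg_convol (fun k => k%:R)) => //.
rewrite (_ : box _ = fun N => (\sum_(k < N) k%:R * a k) * (\sum_(k < N) b k) +
   (\sum_(k < N) a k) * (\sum_(k < N) k%:R * b k)).
  by rewrite -[X in X + _](mulr1 la) -[X in _ + X](mul1r lb); apply: cvgD; exact: cvgM.
apply/funext => N; rewrite /box !mulr_suml -big_split/=; apply: eq_bigr => j _.
by rewrite !mulr_sumr -big_split/=; apply: eq_bigr => i _; rewrite natrD; ring.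
Qed.

End ConvolutionMoments.

(** * Sensitivity of Phi to a change of scale *)

Section PhiScaling.
Context {R : realType}.

Lemma mul_gpdf_le (x : R) : `|x| * gpdf x <= normal_peak 1.
Proof.
rewrite gpdfE mulrCA ler_piMr//; first exact: normal_peak_ge0.
have h : `|x| <= expR (x ^+ 2 / 2).
  apply: le_trans (expR_ge1Dx _); rewrite -real_normK ?num_real//.
  by have := sqr_ge0 (`|x| - 1); set t := `|x|; rewrite sqrrB; nra.
by rewrite expRN ler_pdivrMr ?expR_gt0// mul1r.
Qed.

Let is_derive_scale (x t : R) : is_derive t 1 (fun s => Phi (s * x)) (x * gpdf (t * x)).
Proof.
have h : is_derive t 1 (fun s : R => s * x) x.
  have -> : (fun s : R => s * x) = x *: (@idfun R).
    by apply/funext => s; rewrite !fctE /GRing.scale/= mulrC.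
  by apply: is_derive_eq; rewrite /GRing.scale/= mulr1.
have := @is_derive1_comp R (@Phi R) (fun s => s * x) t (gpdf (t * x)) x
  (is_derive_Phi _) h.
by rewrite mulrC.
Qed.

(** The derivative x gpdf (c x) of the scaling is bounded uniformly in x: c |x| gpdf (c x) is at
    most the peak, and c >= 1/2. *)
Lemma Phi_scale_lt (u v x : R) : 2^-1 <= u -> u < v ->
  `|Phi (v * x) - Phi (u * x)| <= 2 * normal_peak 1 * (v - u).
Proof.
move=> u2 uv; have u0 : 0 < u by apply: lt_le_trans u2; rewrite invr_gt0.
have [c /andP[uc cv] ->] := is_derive_MVT uv (fun t _ => is_derive_scale x t).
have c0 : 0 < c by exact: lt_trans uc.
have vu : 0 < v - u by rewrite subr_gt0.
rewrite normrM (gtr0_norm vu) ler_pM2r//.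
rewrite normrM (gtr0_norm (gpdf_gt0 _)).
have := mul_gpdf_le (c * x); rewrite normrM (gtr0_norm c0) -mulrA.
have : 0 <= `|x| * gpdf (c * x) by rewrite mulr_ge0// ltW// gpdf_gt0.
have : 2^-1 <= c by apply: ltW; exact: le_lt_trans uc.
set G := _ * gpdf _ => c2 G0 hG.
have : 2^-1 * G <= c * G by rewrite ler_wpM2r.
lra.
Qed.

Lemma Phi_scale (a x : R) : 2^-1 <= a -> `|Phi (a * x) - Phi x| <= 2 * normal_peak 1 * `|a - 1|.
Proof.
move=> a2; case: (ltgtP a 1) => [a1|a1|->].
- have h : 0 < 1 - a by rewrite subr_gt0.
  rewrite distrC [in leRHS]distrC (gtr0_norm h) -{1}[x]mul1r.
  exact: Phi_scale_lt.
- have h : 0 < a - 1 by rewrite subr_gt0.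
  rewrite (gtr0_norm h) -{2}[x]mul1r.
  by apply: Phi_scale_lt => //; rewrite invf_le1// ler1n.
- by rewrite mul1r !subrr normr0 mulr0.
Qed.

End PhiScaling.

(** * Quenched mean, variance and Berry-Esseen bound of the hitting times *)

Section QuenchedHittingTime.
Context {R : realType} {d : measure_display} {S : measurableType d}.
Variables (X : nat -> S -> int) (w : int -> R) (Q : probability S R).
Hypothesis w01 : forall x, 0 < w x <= 1.
Hypothesis walk : is_walk X w 0 Q.

Let w01' x : 0 <= w x <= 1.
Proof. by have /andP[/ltW -> ->] := w01 x. Qed.

Variables m1 m2 m3 : int -> R.
Hypothesis c0 : forall x, pmom w 0 N x @[N --> \oo] --> (1 : R).
Hypothesis c1 : forall x, pmom w 1 N x @[N --> \oo] --> m1 x.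
Hypothesis c2 : forall x, pmom w 2 N x @[N --> \oo] --> m2 x.
Hypothesis c3 : forall x, pmom w 3 N x @[N --> \oo] --> m3 x.

Local Notation T n := (hitting_time R X n).

Let sum_mass x : \sum_(k < N) pmf w x k @[N --> \oo] --> (1 : R).
Proof.
rewrite (_ : (fun N => _) = pmom w 0 ^~ x); first exact: c0.
by apply/funext => N; apply: eq_bigr => k _; rewrite expr0 mul1r.
Qed.

Let sum_mean x : \sum_(k < N) k%:R * pmf w x k @[N --> \oo] --> m1 x.
Proof.
rewrite (_ : (fun N => _) = pmom w 1 ^~ x); first exact: c1.
by apply/funext => N; apply: eq_bigr => k _; rewrite expr1.
Qed.

Let iconvol_ge0 (n k : nat) : 0 <= iconvol (fun i => pmf w i%:Z) n k.
Proof. by rewrite -fpass_iconvol fpass_ge0. Qed.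

Let hit_mass_mean (n : nat) :
  \sum_(k < N) iconvol (fun i => pmf w i%:Z) n k @[N --> \oo] --> (1 : R) /\
  \sum_(k < N) k%:R * iconvol (fun i => pmf w i%:Z) n k @[N --> \oo] --> \sum_(i < n) m1 i%:Z.
Proof.
elim: n => [|n [h1 h2]].
  split; apply: cvg_near_cst; near=> N.
  - have [M ->] : exists M, N = M.+1.
      by exists N.-1; rewrite prednK//; near: N; exact: nbhs_infty_gt.
    by rewrite big_ord_recl/= big1 ?addr0.
  - rewrite big_ord0 big1// => k _ /=.
    by case: (k : nat) => [|j]; rewrite ?mul0r ?mulr0.
split.
  by apply: convol_mass => //; exact: pmf_ge0.
rewrite big_ord_recr/= addrC.
by apply: convol_mean => //; exact: pmf_ge0.
Unshelve. all: by end_near. Qed.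

Let fpassE (n : nat) : (fun k => fpass w n%:Z k 0) = iconvol (fun i => pmf w i%:Z) n.
Proof. by apply/funext => k; exact: fpass_iconvol. Qed.

Let hit_mass (n : nat) : (\sum_(0 <= k <oo) (fpass w n%:Z k 0)%:E = 1)%E.
Proof. by apply: cvg_esum; have [+ _] := hit_mass_mean n; rewrite -fpassE. Qed.

Lemma integral_hitting_time_real (n : nat) (g : \bar R -> \bar R) (f : nat -> R) (l : R) :
  (forall e, 0 <= e -> 0 <= g e)%E -> (forall k, g k%:R%:E = (f k)%:E) ->
  \sum_(k < N) f k * fpass w n%:Z k 0 @[N --> \oo] --> l ->
  (\int[Q]_t g (T n t) = l%:E)%E.
Proof.
(* The walk hits n almost surely, so the value of g at +oo has weight 0 and drops out even if it is
   infinite. *)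
move=> g0 gf fl; rewrite (integral_hitting_time w01' walk)// hit_mass subee// mule0 adde0.
transitivity (\sum_(0 <= k <oo) (f k * fpass w n%:Z k 0)%:E)%E; last exact: cvg_esum.
by apply: eq_eseriesr => k _; rewrite gf EFinM.
Qed.

Lemma mean_hitting_time (n : nat) : mean Q (T n) = (\sum_(i < n) m1 i%:Z)%:E.
Proof.
apply: (@integral_hitting_time_real n idfun (fun k => k%:R)) => //.
by have [_ +] := hit_mass_mean n; rewrite -fpassE.
Qed.

Lemma var_hitting_time1 : var Q (T 1) = (m2 0 - m1 0 ^+ 2)%:E.
Proof.
rewrite /var mean_hitting_time big_ord1 EFinB EFin_expe; congr (_ - _)%E.
apply: (@integral_hitting_time_real 1 (fun e => e ^+ 2)%E (fun k => k%:R ^+ 2)) => //.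
- by move=> e e0; exact: expe_ge0.
- by have := @c2 0.
Qed.

Lemma hitting_cdfE (sigma x : R) (n : nat) : 0 < sigma -> (0 < n)%N ->
  hitting_cdf X Q sigma n x =
  fine (Q [set t | (T n t <= (\sum_(i < n) m1 i%:Z + x * (sigma * Num.sqrt n%:R))%:E)%E]).
Proof.
move=> s0 n0; rewrite /hitting_cdf mean_hitting_time; set M := \sum_(i < n) _.
set c := sigma * _; have cc0 : 0 < c by rewrite mulr_gt0// sqrtr_gt0 ltr0n.
congr (fine (Q _)); apply/seteqP; split => t /=;
  case: (@hitting_timeP R _ _ X n t) => [[k _ ->]|[_ ->]].
- by rewrite inver gt_eqF// -EFinB -EFinM !lee_fin ler_pdivrMr// lerBlDl.
- by rewrite inver gt_eqF// addye// gt0_mulye ?lte_fin ?invr_gt0// leye_eq.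
- by rewrite inver gt_eqF// -EFinB -EFinM !lee_fin ler_pdivrMr// lerBlDl.
- by rewrite leye_eq.
Qed.

(** The Berry-Esseen bound normalizes by sqrt V, the statement by sigma sqrt n; the mismatch is left
    as a factor in front of x inside Phi. *)
Lemma hitting_cdf_berry_esseen (sigma x B : R) (n : nat) : 0 < sigma -> (0 < n)%N ->
  0 < B -> \sum_(i < n) (m3 i%:Z + m1 i%:Z ^+ 3) <= B ->
  let V := \sum_(i < n) (m2 i%:Z - m1 i%:Z ^+ 2) in 0 < V ->
  `|hitting_cdf X Q sigma n x - Phi ((sigma * Num.sqrt n%:R) / Num.sqrt V * x)| <=
  (36 + 2 * (1 + (gpdf (1 : R))^-1)) * (B / Num.sqrt V ^+ 3).
Proof.
move=> s0 n0 B0 HB V V0; rewrite hitting_cdfE//.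
set M := \sum_(i < n) m1 _; set c := sigma * _; set y := M + x * c.
pose L := (Num.trunc `|y|).+1.
have yL : y < L%:R.
  by apply: le_lt_trans (ler_norm y) _; rewrite truncnS_gt.
rewrite (Q_hitting_le w01' walk n yL)/=.
under eq_bigr do rewrite fpass_iconvol.
have := @berry_esseen_nat R (fun i => pmf w i%:Z) n (fun i => m1 i%:Z) (fun i => m2 i%:Z)
  (fun i => m3 i%:Z) _ _ _ _ _ B B0 HB V0 L y yL.
have yM : (y - M) / Num.sqrt V = c / Num.sqrt V * x.
  by rewrite /y [M + _]addrC addrK; ring.
move=> /=; rewrite -/M -/V yM; apply.
- by move=> i k; exact: pmf_ge0.
- move=> i; rewrite (_ : series _ = fun N => \sum_(k < N) pmf w i%:Z k)//.
  by apply/funext => N; rewrite /series/= big_mkord.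
- move=> i; rewrite (_ : series _ = pmom w 1 ^~ i%:Z); first exact: c1.
  by apply/funext => N; rewrite /series/= big_mkord; apply: eq_bigr => k _; rewrite expr1.
- move=> i; rewrite (_ : series _ = pmom w 2 ^~ i%:Z); first exact: c2.
  by apply/funext => N; rewrite /series/= big_mkord.
- move=> i; rewrite (_ : series _ = pmom w 3 ^~ i%:Z); first exact: c3.
  by apply/funext => N; rewrite /series/= big_mkord.
Qed.

End QuenchedHittingTime.

(** * From growth of moments to a rate of convergence *)

Section Rate.
Context {R : realType}.

Lemma supnorm_le (G : R -> R) b : (forall x, `|G x| <= b) -> 0 <= supnorm G <= b.
Proof.
move=> Gb; apply/andP; split.
  apply: (le_trans (normr_ge0 (G 0))); apply: ub_le_sup; last by exists 0.
  by exists b => _ [x _ <-].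
by apply: ge_sup; [exists `|G 0|, 0|move=> _ [x _ <-]].
Qed.

Lemma cvg_powR_neg (a : R) : a < 0 -> n%:R `^ a @[n --> \oo] --> (0 : R).
Proof.
move=> a0; apply/cvgrPdist_lt => e e0; near=> n.
have n0 : 0 < n%:R :> R by rewrite ltr0n; near: n; exact: nbhs_infty_gt.
rewrite sub0r normrN ger0_norm ?powR_ge0//.
pose b := - a; have b0 : 0 < b by rewrite oppr_gt0.
have h : e^-1 `^ b^-1 < n%:R by near: n; exact: nbhs_infty_gtr.
have : (e^-1 `^ b^-1) `^ b < n%:R `^ b by apply: gt0_ltr_powR; rewrite ?nnegrE ?powR_ge0.
rewrite -powRrM mulVf ?gt_eqF// powRr1 ?invr_ge0 ?(ltW e0)// => hb.
by rewrite -[a]opprK powRN invf_plt ?posrE ?powR_gt0.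
Unshelve. all: by end_near. Qed.

Variables (F : nat -> R -> R) (V B3 : nat -> R) (s K g g3 al : R).
Hypotheses (s0 : 0 < s) (K0 : 0 <= K).
Hypothesis HV : powO g (fun n => V n - s ^+ 2 * n%:R).
Hypothesis HB : powO g3 B3.
Hypothesis HF : forall n x B, (0 < n)%N -> 0 < V n -> 0 < B -> B3 n <= B ->
  `|F n x - Phi (s * Num.sqrt n%:R / Num.sqrt (V n) * x)| <= K * (B / Num.sqrt (V n) ^+ 3).
Hypotheses (g1 : g < 1) (alg : al + g - 1 < 0) (alg3 : al + g3 - 3 / 2 < 0).

Let scale_dist (n : nat) (T : R) : (0 < n)%N -> 0 <= T -> `|V n - s ^+ 2 * n%:R| <= T * n%:R ->
  T <= s ^+ 2 / 2 ->
  [/\ s ^+ 2 / 2 * n%:R <= V n, 2^-1 <= s * Num.sqrt n%:R / Num.sqrt (V n) &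
     `|s * Num.sqrt n%:R / Num.sqrt (V n) - 1| <= 2 / s ^+ 2 * T].
Proof.
move=> n0 T0 hV hT; have nR : 0 < n%:R :> R by rewrite ltr0n.
have s2 : 0 < s ^+ 2 by rewrite exprn_gt0.
set N : R := n%:R in nR hV *; set v := V n in hV *.
have Tn : T * N <= s ^+ 2 / 2 * N by rewrite ler_wpM2r// ltW.
have sN : 0 < s ^+ 2 * N by rewrite mulr_gt0.
have [hV1 hV2] : v - s ^+ 2 * N <= T * N /\ - (T * N) <= v - s ^+ 2 * N.
  by move: hV; rewrite ler_norml => /andP[].
have vl : s ^+ 2 / 2 * N <= v by lra.
have v0 : 0 < v by apply: lt_le_trans vl; rewrite !mulr_gt0// invr_gt0.
set a := s * Num.sqrt N / Num.sqrt v;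
  have a0 : 0 <= a by rewrite divr_ge0 ?mulr_ge0 ?sqrtr_ge0// ltW.
have a2 : a ^+ 2 = s ^+ 2 * N / v.
  by rewrite /a expr_div_n exprMn !sqr_sqrtr// ltW.
have a2v : a ^+ 2 * v = s ^+ 2 * N by rewrite a2 divfK// gt_eqF.
split => //.
  rewrite -(@ler_pXn2r _ 2)// ?nnegrE ?invr_ge0// a2 ler_pdivlMr//.
  by rewrite exprVn; lra.
(* As a >= 0, the factor a + 1 of a^2 - 1 is at least 1; squaring removes the square roots and
   leaves V n - s^2 n over V n. *)
have h1 : `|a - 1| <= `|a ^+ 2 - 1|.
  rewrite -[X in a ^+ 2 - X](expr1n _ 2) subr_sqr normrM ler_peMr//.
  by rewrite ger0_norm ?addr_ge0// lerDr.
apply: (le_trans h1); rewrite -(ler_pM2r v0) -{1}(gtr0_norm v0) -normrM mulrBl mul1r a2v distrC.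
apply: (le_trans hV).
have -> : 2 / s ^+ 2 * T * v = T * (v * (2 / s ^+ 2)) by ring.
rewrite ler_wpM2l// mulrA ler_pdivlMr//; lra.
Qed.

(** Two errors add up: Berry-Esseen gives n^(g3 - 3/2), the change of scale n^(g - 1). The condition
    g < 1 makes V n comparable with n, which both estimates use. *)
Lemma cvg_rate : n%:R `^ al * supnorm (fun x => F n x - Phi x) @[n --> \oo] --> (0 : R).
Proof.
have [T [T0 HT]] := HV; have [T3 [T30 HT3]] := HB.
have s2 : 0 < s ^+ 2 by rewrite exprn_gt0.
pose k := Num.sqrt (s ^+ 2 / 2).
have k0 : 0 < k by rewrite sqrtr_gt0 divr_gt0.
pose K1 := K * ((T3 + 1) / k ^+ 3).
pose K2 := 2 * normal_peak 1 * (2 / s ^+ 2 * T).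
have K20 : 0 <= K2.
  by apply: mulr_ge0; [rewrite mulr_ge0 ?normal_peak_ge0|rewrite mulr_ge0// divr_ge0// ltW].
have T1 : 0 < T + 1 by rewrite ltr_wpDl.
have c1 := cvg_powR_neg alg; have c3 := cvg_powR_neg alg3.
have lim : K1 * n%:R `^ (al + g3 - 3 / 2) + K2 * n%:R `^ (al + g - 1) @[n --> \oo] --> (0 : R).
  have l3 : K1 * n%:R `^ (al + g3 - 3 / 2) @[n --> \oo] --> K1 * 0 by exact: cvgMr.
  have l1 : K2 * n%:R `^ (al + g - 1) @[n --> \oo] --> K2 * 0 by exact: cvgMr.
  have -> : (0 : R) = K1 * 0 + K2 * 0 by rewrite !mulr0 addr0.
  exact: cvgD.
apply: (squeeze_cvgr _ (cvg_cst 0) lim); near=> n.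
have n0 : (0 < n)%N by near: n; exact: nbhs_infty_gt.
have nR : 0 < n%:R :> R by rewrite ltr0n.
have nR0 : (n%:R : R) != 0 by rewrite gt_eqF.
have pn a : 0 <= (n%:R : R) `^ a by exact: powR_ge0.
have Tg : T * n%:R `^ (g - 1) <= s ^+ 2 / 2.
  apply: (@le_trans _ _ ((T + 1) * n%:R `^ (g - 1))); first by rewrite ler_wpM2r// lerDl.
  rewrite mulrC -ler_pdivlMr//; apply: ltW; near: n.
  have e0 : 0 < s ^+ 2 / 2 / (T + 1) by apply: divr_gt0 => //; exact: divr_gt0.
  have g1' : g - 1 < 0 by rewrite subr_lt0.
  have /cvgrPdist_lt/(_ _ e0) := cvg_powR_neg g1'.
  by apply: filterS => n; rewrite sub0r normrN ger0_norm// powR_ge0.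
have powS a b : (n%:R : R) `^ (a + b) = n%:R `^ a * n%:R `^ b.
  by rewrite powRD// nR0 implybT.
have hVn : `|V n - s ^+ 2 * n%:R| <= T * n%:R `^ (g - 1) * n%:R.
  apply: le_trans (HT n n0) _; rewrite -mulrA [X in _ * (_ * X)](_ : _ = n%:R `^ 1) -?powS ?subrK//.
  by rewrite powRr1// ltW.
have Tp : 0 <= T * n%:R `^ (g - 1) by rewrite mulr_ge0.
have [vl al2 dist] := scale_dist n0 Tp hVn Tg.
have v0 : 0 < V n by apply: lt_le_trans vl; rewrite !mulr_gt0// invr_gt0.
(* T3 may vanish, whereas [HF] asks for a positive bound; hence T3 + 1. *)
have B0 : 0 < (T3 + 1) * n%:R `^ g3 by rewrite mulr_gt0 ?powR_gt0// ltr_wpDl.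
have B3n : B3 n <= (T3 + 1) * n%:R `^ g3.
  apply: le_trans (ler_norm _) _; apply: le_trans (HT3 n n0) _.
  by rewrite ler_wpM2r// lerDl.
have sq3 : k ^+ 3 * n%:R `^ (3 / 2) <= Num.sqrt (V n) ^+ 3.
  have -> : (n%:R : R) `^ (3 / 2) = Num.sqrt n%:R ^+ 3.
    by rewrite -powR12_sqrt ?ltW// -powR_mulrn ?powR_ge0// -powRrM mulrC.
  rewrite -exprMn lerXn2r ?nnegrE ?mulr_ge0 ?sqrtr_ge0 ?(ltW k0)//.
  rewrite /k -sqrtrM ?divr_ge0// ?(ltW s2)//; exact: ler_wsqrtr.
have bound x : `|F n x - Phi x| <= K1 * n%:R `^ (g3 - 3 / 2) + K2 * n%:R `^ (g - 1).
  have := HF x n0 v0 B0 B3n; set a := s * Num.sqrt _ / Num.sqrt _ => hF.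
  rewrite -[F n x - Phi x](subrKA (Phi (a * x))).
  apply: le_trans (ler_normD _ _) _; apply: lerD.
    apply: (le_trans hF); rewrite /K1 -mulrA ler_wpM2l//.
    rewrite powS powRN mulrACA -invfM; apply: ler_pM => //.
    - exact: ltW.
    - by rewrite lef_pV2// posrE ?exprn_gt0 ?sqrtr_gt0// mulr_gt0 ?exprn_gt0 ?powR_gt0.
  apply: le_trans (Phi_scale _ al2) _; rewrite /K2 -[leRHS]mulrA.
  by rewrite ler_wpM2l ?mulr_ge0 ?normal_peak_ge0// -[leRHS]mulrA.
have /andP[s_ge0 s_le] := supnorm_le bound.
rewrite mulr_ge0//=; apply: le_trans (ler_wpM2l (pn al) s_le) _.
rewrite mulrDr; apply: lerD; rewrite mulrCA ler_wpM2l//.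
- by rewrite /K1 mulr_ge0// divr_ge0 ?exprn_ge0 ?addr_ge0// ltW.
- by rewrite -powS addrA.
- by rewrite -powS addrA.
Unshelve. all: by end_near. Qed.

End Rate.

Section QuenchedCLT.
Context {d : measure_display} {Omega : measurableType d} {R : realType}.
Variables (P : probability Omega R) (om : int -> Omega -> R).
Hypothesis om_meas : forall x, measurable_fun setT (om x).
Hypothesis om_ident : forall x (B : set R), measurable B ->
  P (om x @^-1` B) = P (om 0 @^-1` B).
Hypothesis om_indep : forall (s : seq int) (B : int -> set R), uniq s ->
  (forall x, measurable (B x)) ->
  P (\bigcap_(x in [set` s]) (om x @^-1` B x)) =
  (\prod_(x <- s) P (om x @^-1` B x))%E.
Hypothesis om01 : forall x u, 0 < om x u <= 1.
Local Notation EP := (EP P).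
Local Notation rho_ := (rho_ om).
Variable p : R.
Hypothesis p24 : 2 < p <= 4.
Hypothesis rho_p : (EP (fun u => rho_ 0 u `^ p)%R < 1)%E.
Hypothesis rho_gt0 : (0 < EP (rho_ 0))%E.

Variables (d' : measure_display) (S : measurableType d').
Variables (X : nat -> S -> int) (Q : Omega -> probability S R).
Hypothesis walk : forall u, is_walk X (om ^~ u) 0 (Q u).

Lemma var_hitting_time1_ae :
  {ae P, forall u, var (Q u) (hitting_time R X 1) = `|vmom om 0 u|%:E}.
Proof.
apply: filterS (regular_ae om_meas om_ident om_indep om01 p24 rho_p) => u h.
rewrite ger0_norm ?(vmom_ge0 om01)//.
apply: (@var_hitting_time1 _ _ _ _ _ _ (om01 ^~ u) (walk u)
  (fun x => mom om 1 x u) (fun x => mom om 2 x u)) => x; by have [] := h x.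
Qed.

Lemma quenched_clt_rate (al : R) : al < 1 - 2 / p ->
  let sigma := Num.sqrt (walk_var P om) in
  {ae P, forall u,
     n%:R `^ al * supnorm (fun x => hitting_cdf X (Q u) sigma n x - Phi x)
       @[n --> \oo] --> (0 : R)}.
Proof.
move=> hal sigma; have /andP[p2 p4] := p24.
have p0 : 0 < p by lra.
pose dl := 1 - 2 / p - al; have dl0 : 0 < dl by rewrite subr_gt0.
have ip : p * p^-1 = 1 by rewrite divff// gt_eqF.
have ip2 : p^-1 < 2^-1 by rewrite ltf_pV2// posrE.
have ip4 : 4^-1 <= p^-1 by rewrite lef_pV2// posrE.
have ip0 : 0 < p^-1 by rewrite invr_gt0.
(* Below dl / 4, the loss e stays within the margin dl in both exponents; below p/2 - 1, it keeps
   the growth exponent of the variance under 1. *)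
pose e := Num.min (dl / 4) (p / 2 - 1) / 2.
have e0 : 0 < e by rewrite divr_gt0// lt_min divr_gt0//= subr_gt0; lra.
have e1 : e < dl / 4.
  by rewrite /e; have := ge_min (dl / 4) (dl / 4) (p / 2 - 1); rewrite lexx /=; lra.
have e2 : e < p / 2 - 1.
  have : Num.min (dl / 4) (p / 2 - 1) <= p / 2 - 1 by rewrite ge_min lexx orbT.
  by rewrite /e; lra.
have wv := walk_var_gt0 om_meas om01 p24 rho_p rho_gt0.
have s0 : 0 < sigma by rewrite sqrtr_gt0.
have s2 : sigma ^+ 2 = walk_var P om by rewrite sqr_sqrtr// ltW.
have H1 := sum_vmom_growth om_meas om_ident om_indep om01 p24 rho_p e0.
have H3 := sum_third_moment_growth om_meas om_ident om_indep om01 p24 rho_p e0.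
have K0 : 0 <= 36 + 2 * (1 + (gpdf (1 : R))^-1).
  by rewrite addr_ge0// mulr_ge0// addr_ge0// invr_ge0 ltW// gpdf_gt0.
apply: filterS2 (filterI (regular_ae om_meas om_ident om_indep om01 p24 rho_p) H1) H3 => u [h
  HV] HB.
have gE : (1 + e) / (p / 2) = 2 * p^-1 * (1 + e) by field; rewrite gt_eqF.
have dlE : dl = 1 - 2 * p^-1 - al by [].
have ee : 2 * p^-1 * e <= e.
  by have : 0 <= e * (1 - 2 * p^-1); [rewrite mulr_ge0 ?(ltW e0)//; lra|lra].
apply: (cvg_rate s0 K0 (F := fun n x => hitting_cdf X (Q u) sigma n x) (B3 := fun n => \sum_(i
  < n) (mom om 3 i%:Z u + mom om 1 i%:Z u ^+ 3))
  (V := fun n => \sum_(i < n) vmom om i%:Z u) (g := (1 + e) / (p / 2))) HB _ _ _ _.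
- by rewrite s2.
- move=> n x B n0 V0 B0 HBn.
  have c j : (j < 4)%N -> forall y, pmom (om ^~ u) j N y @[N --> \oo] --> (if j == 0%N then 1
    else mom om j y u).
    by case: j => [|[|[|[|]]]] // _ y; have [] := h y.
  exact: (@hitting_cdf_berry_esseen _ _ _ _ _ _ (om01 ^~ u) (walk u)
    (fun x => mom om 1 x u) (fun x => mom om 2 x u) (fun x => mom om 3 x u)
    (c 0%N isT) (c 1%N isT) (c 2%N isT) (c 3%N isT) sigma x B n s0 n0 B0 HBn V0).
- rewrite ltr_pdivrMr ?divr_gt0// mul1r; lra.
- by rewrite gE; lra.
(* The third moments are never the bottleneck: 3/p - 3/2 <= 2/p - 1 since p > 2, and 1 - 3/2 <= 2/p
   - 1 since p <= 4. *)
- have [p3|p3] := leP p 3.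
    have -> : (1 + e) / (p / 3) = 3 * p^-1 * (1 + e) by field; rewrite gt_eqF.
    lra.
  by rewrite divff// divr1; lra.
Qed.

End QuenchedCLT.

(** * Measurability in the environment *)

Section EnvironmentMeasurability.
Context {d : measure_display} {Omega : measurableType d} {R : realType}.
Variables (P : probability Omega R) (om : int -> Omega -> R).
Hypothesis om_meas : forall x, measurable_fun setT (om x).
Hypothesis om01 : forall x u, 0 <= om x u <= 1.
Variables (d' : measure_display) (S : measurableType d').
Variables (X : nat -> S -> int) (Q : Omega -> probability S R).
Hypothesis walk : forall u, is_walk X (om ^~ u) 0 (Q u).

Lemma fpass_meas n k y : measurable_fun setT (fun u => fpass (om ^~ u) n k y).
Proof.
elim: k y => [|k IHk] y /=; first exact: measurable_cst.
case: (y == n); first exact: measurable_cst.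
by apply: measurable_funD; apply: measurable_funM => //; exact: measurable_funB.
Qed.

(** Only the Markov property links [Q u] to u. Measurability comes from the explicit series in
    [fpass], whose terms are polynomials in finitely many coordinates of the environment. *)
Lemma integral_hitting_time_meas n (g : \bar R -> \bar R) :
  (forall e, 0 <= e -> 0 <= g e)%E ->
  measurable_fun setT (fun u => \int[Q u]_t g (hitting_time R X n t))%E.
Proof.
move=> g0.
have gk (k : nat) : (0 <= g k%:R%:E)%E by apply: g0; rewrite lee_fin.
have fp u k : 0 <= fpass (om ^~ u) n%:Z k 0 by apply: fpass_ge0 => x; exact: om01.
have -> : (fun u => \int[Q u]_t g (hitting_time R X n t))%E =
  (fun u => \sum_(k <oo) (g k%:R%:E * (fpass (om ^~ u) n%:Z k 0)%:E) +
   g +oo * (1 - \sum_(k <oo) (fpass (om ^~ u) n%:Z k 0)%:E))%E.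
  by apply/funext => u; apply: integral_hitting_time => // x; exact: om01.
apply: emeasurable_funD.
  apply: ge0_emeasurable_sum => [k u _ _|k _]; first by rewrite mule_ge0// lee_fin.
  apply: emeasurable_funM; first exact: measurable_cst.
  by apply/measurable_EFinP; exact: fpass_meas.
apply: emeasurable_funM; first exact: measurable_cst.
apply: emeasurable_funB; first exact: measurable_cst.
apply: ge0_emeasurable_sum => [k u _ _|k _]; first by rewrite lee_fin.
by apply/measurable_EFinP; exact: fpass_meas.
Qed.

Lemma var_hitting_time_meas n :
  measurable_fun setT (fun u => var (Q u) (hitting_time R X n)).
Proof.
apply: emeasurable_funB.
  by apply: (@integral_hitting_time_meas n (fun e => e ^+ 2)%E) => e e0; exact: expe_ge0.
apply: emeasurable_funM; exact: (@integral_hitting_time_meas n idfun).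
Qed.

End EnvironmentMeasurability.

(** * Reduction to a positive environment *)

Section RhoExtended.
Context {R : realType}.

Lemma rhoE (w : R) : rho w = if w == 0 then +oo%E else ((1 - w) / w)%:E.
Proof.
rewrite /rho inver; case: eqP => [->|_]; last by rewrite EFinM.
by rewrite subr0 mul1e.
Qed.

(* Replacing 0 by 1 makes the environment positive everywhere; it changes it on a
   null set only, since [rho 0 = +oo], and keeps it i.i.d. *)
Definition zero_to_one (r : R) : R := if r == 0 then 1 else r.

Lemma zero_to_one_meas : measurable_fun setT zero_to_one.
Proof.
apply: measurable_fun_ifT; [|exact: measurable_cst|exact: measurable_id].
by apply: measurable_fun_eqr; [exact: measurable_id|exact: measurable_cst].
Qed.

Lemma zero_to_one01 r : 0 <= r <= 1 -> 0 < zero_to_one r <= 1.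
Proof.
move=> /andP[r0 r1]; rewrite /zero_to_one; case: eqP => [_|/eqP rn0].
  by rewrite ltr01 lexx.
by rewrite lt_neqAle eq_sym rn0 r0.
Qed.

End RhoExtended.

Section PositiveEnvironment.
Context {R : realType} {d : measure_display} {Omega : measurableType d}.
Variables (P : probability Omega R) (omega : int -> {RV P >-> R}).
Hypothesis omega01 : forall x u, 0 <= omega x u <= 1.
Hypothesis omega_iid : iid P omega.

Definition positive_env (x : int) (u : Omega) : R := zero_to_one (omega x u).

Lemma positive_env_meas x : measurable_fun setT (positive_env x).
Proof. by apply: measurableT_comp => //; exact: zero_to_one_meas. Qed.

Let mpre (B : set R) : measurable B -> measurable (@zero_to_one R @^-1` B).
Proof. by move=> mB; rewrite -[_ @^-1` _]setTI; exact: zero_to_one_meas. Qed.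

Lemma positive_env_ident x (B : set R) : measurable B ->
  P (positive_env x @^-1` B) = P (positive_env 0 @^-1` B).
Proof. by move=> mB; exact: (omega_iid.1 x _ (mpre mB)). Qed.

Lemma positive_env_indep (s : seq int) (B : int -> set R) : uniq s ->
  (forall x, measurable (B x)) ->
  P (\bigcap_(x in [set` s]) (positive_env x @^-1` B x)) =
  (\prod_(x <- s) P (positive_env x @^-1` B x))%E.
Proof. by move=> us mB; exact: (omega_iid.2 s _ us (fun x => mpre (mB x))). Qed.

Lemma positive_env01 x u : 0 < positive_env x u <= 1.
Proof. exact: zero_to_one01. Qed.

Variable p : R.
Hypothesis p0 : 0 < p.
Hypothesis rho_p : (\int[P]_u (rho (omega 0%R u) `^ p) < 1)%E.

Let f u : \bar R := (rho (omega 0%R u) `^ p)%E.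

Let fE u : f u = if omega 0 u == 0 then +oo%E else ((rho_ positive_env 0 u) `^ p)%:E.
Proof.
rewrite /f rhoE /rho_ /odds /positive_env /zero_to_one.
by case: eqP => [_|_]; rewrite ?poweRyr ?gt_eqF.
Qed.

Let mrho : measurable_fun setT (fun u => (rho_ positive_env 0 u) `^ p).
Proof.
apply: measurable_powRf; apply: rho_meas; first exact: positive_env_meas.
exact: positive_env01.
Qed.

Let mf : measurable_fun setT f.
Proof.
rewrite (_ : f = fun u => if omega 0 u == 0 then +oo%E else ((rho_ positive_env 0 u) `^ p)%:E).
  apply: measurable_fun_ifT; [|exact: measurable_cst|exact/measurable_EFinP].
  by apply: measurable_fun_eqr => //; exact: measurable_cst.
by apply/funext => u; rewrite fE.
Qed.

Let f0 u : (0 <= f u)%E. Proof. exact: poweR_ge0. Qed.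

Lemma positive_env_rho : (EP P (fun u => (rho_ positive_env 0 u) `^ p)%R < 1)%E.
Proof.
apply: le_lt_trans rho_p; apply: ge0_le_integral => //.
- by move=> u _; rewrite lee_fin powR_ge0.
- exact/measurable_EFinP.
by move=> u _; rewrite -/(f u) fE; case: eqP => _ //; rewrite leey.
Qed.

Lemma omega0_ae_neq0 : {ae P, forall u, omega 0 u != 0}.
Proof.
have : P.-integrable setT f.
  apply/integrableP; split => //; under eq_integral do rewrite gee0_abs//.
  by apply: lt_trans rho_p _; rewrite ltry.
move=> /(integrable_ae measurableT); apply: filterS => u /(_ I).
by rewrite fE; case: eqP.
Qed.

(** The moment of the odds concerns site 0 only; identical distribution carries the null event to
    every other site. *)
Lemma omega_ae_neq0 : {ae P, forall u, forall x, omega x u != 0}.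
Proof.
apply: ae_forallz => x; have [N [mN N0 sN]] := omega0_ae_neq0.
have m0 y : measurable (omega y @^-1` [set 0]).
  by rewrite -[_ @^-1` _]setTI; exact: measurable_funPT.
exists (omega x @^-1` [set 0]); split => //.
  apply: (etrans (omega_iid.1 x _ (measurable_set1 0))).
  apply/eqP; rewrite eq_le measure_ge0 andbT -N0; apply: le_measure; rewrite ?inE//.
  by move=> u /= u0; apply: sN => /=; rewrite u0 eqxx.
by move=> u /= /negP; rewrite negbK => /eqP.
Qed.

Lemma positive_env_ae : {ae P, forall u, positive_env ^~ u = omega ^~ u}.
Proof.
apply: filterS omega_ae_neq0 => u h; apply/funext => x.
by rewrite /positive_env /zero_to_one (negbTE (h x)).
Qed.

(** A vanishing mean would force omega 0 = 1 almost surely. This is how P(omega_0 = 1) < 1 yields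
    sigma > 0. *)
Lemma EP_rho_gt0 : (P [set u | omega 0%R u = 1%R] < 1)%E -> (0 < EP P (rho_ positive_env 0))%E.
Proof.
move=> h1; rewrite lt_neqAle EP_ge0 ?andbT; last first.
  by move=> u; apply: rho_ge0; exact: positive_env01.
apply/negP => /eqP h; move: h1; apply/negP; rewrite -leNgt.
have mr : measurable_fun setT (fun u => (rho_ positive_env 0 u)%:E).
  apply/measurable_EFinP; apply: rho_meas; first exact: positive_env_meas.
  exact: positive_env01.
have h0 : (\int[P]_u `| (rho_ positive_env 0 u)%:E | = 0)%E.
  rewrite [RHS]h; apply: eq_integral => u _; rewrite gee0_abs// lee_fin rho_ge0//.
  exact: positive_env01.
have z := (ae_eq_integral_abs P measurableT mr).1 h0.
have [N [mN N0 sN]] := filterI z omega0_ae_neq0.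
have m1 : measurable [set u | omega 0%R u = 1%R].
  have : measurable (omega 0 @^-1` [set 1]) by rewrite -[_ @^-1` _]setTI; exact: measurable_funPT.
  by [].
rewrite -(probability_setT P) -[leRHS]adde0 -N0; apply: le_trans (measureU2 _ m1 mN).
apply: le_measure; rewrite ?inE//; first exact: measurableU.
move=> u _; have [Nu|Nu] := pselect (N u); [by right|left].
have [/(_ I) [hr] hw] : ((setT u -> (rho_ positive_env 0 u)%:E = 0%E) /\ omega 0 u != 0).
  by apply: contrapT => h'; apply: Nu; exact: sN.
move: hr; rewrite /rho_ /odds /positive_env /zero_to_one (negbTE hw) => /eqP.
by rewrite mulf_eq0 invr_eq0 (negbTE hw) orbF subr_eq0 => /eqP.
Qed.

End PositiveEnvironment.

Theorem theorem1p4 (R : realType)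
    (d : measure_display) (Omega : measurableType d) (P : probability Omega R)
    (omega : int -> {RV P >-> R})
    (d' : measure_display) (S : measurableType d') (X : nat -> S -> int)
    (Pq : (int -> R) -> int -> probability S R)
    (omega01 : forall (x : int) (u : Omega), 0 <= omega x u <= 1)
    (omega_iid : iid P omega)
    (quenched : quenched_laws X Pq)
    (omega_neq1 : (P [set u | omega 0%R u = 1%R] < 1)%E)
    (kappa_gt2 : (2%:E < kappa P omega)%E) :
  let sigma : R := Num.sqrt (fine (sigma2 P omega X Pq)) in
  let F (n : nat) (u : Omega) : R -> R :=
    hitting_cdf X (Pq (fun x => omega x u) 0) sigma n in
  ((4%:E < kappa P omega)%E ->
     forall eps : R, 0 < eps ->
     {ae P, forall u : Omega,
        n%:R `^ (1 / 2 - eps) * supnorm (fun x => F n u x - Phi x)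
          @[n --> \oo] --> (0 : R)}) /\
  ((kappa P omega <= 4%:E)%E ->
     forall eps : R, 0 < eps ->
     {ae P, forall u : Omega,
        n%:R `^ (1 - 2 / fine (kappa P omega) - eps)
          * supnorm (fun x => F n u x - Phi x)
          @[n --> \oo] --> (0 : R)}).
Proof.
move=> sigma F.
pose om := positive_env omega.
have om_meas := positive_env_meas omega.
have om_ident := positive_env_ident omega_iid.
have om_indep := positive_env_indep omega_iid.
have om01 := positive_env01 omega01.
have om01' x u : 0 <= om x u <= 1 by have /andP[/ltW -> ->] := om01 x u.
pose Q u := Pq (om ^~ u) 0.
have walk u : is_walk X (om ^~ u) 0 (Q u) by exact: quenched.
(* Both claims follow from this one: p is capped at 4, and interpolation keeps E[rho^p'] < 1 for p'
   = min(p, 4). *)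
have core p al : 2 < p -> (\int[P]_u (rho (omega 0%R u) `^ p) < 1)%E ->
    al < 1 - 2 / Num.min p 4 ->
    {ae P, forall u, n%:R `^ al * supnorm (fun x => F n u x - Phi x) @[n --> \oo] --> (0 : R)}.
  move=> p2 rp hal; have p0 : 0 < p by lra.
  have rho_p := positive_env_rho omega01 p0 rp.
  have hae := positive_env_ae omega01 omega_iid p0 rp.
  have rho_gt0 := EP_rho_gt0 omega01 p0 rp omega_neq1.
  pose p' := Num.min p 4.
  have p24 : 2 < p' <= 4 by rewrite lt_min p2 ge_min lexx orbT ltr_nat.
  have p'p : 0 < p' <= p by rewrite ge_min lexx andbT; case/andP: p24; lra.
  have rho_p' := rho_mom_lt1 om_meas om01 p0 rho_p p'p.
  (* [sigma] is computed under [omega] and [walk_var] under the modified environment; the integrands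
     agree almost surely, and their measurability gives equal integrals. *)
  have sE : sigma = Num.sqrt (walk_var P om).
    congr Num.sqrt; rewrite -[RHS]/(fine (walk_var P om)%:E); congr fine.
    rewrite -(EP_vmom om_meas om_ident om_indep om01 p24 rho_p' 0).
    apply: ae_eq_integral => //.
    - apply: (@var_hitting_time_meas _ _ _ (fun x u => omega x u) _ omega01 _ _ X (fun u => Pq
      (fun x => omega x u) 0)) => //.
      by move=> u; exact: quenched.
    - apply/measurable_EFinP; apply: measurableT_comp => //.
      apply: measurable_funB; first exact: mom_meas.
      by apply: measurable_funX; exact: mom_meas.
    apply: filterS2 hae (var_hitting_time1_ae om_meas om_ident om_indep om01 p24 rho_p' walk)
      => u hu hv _.
    by rewrite -hv /Q -hu.
  have := quenched_clt_rate om_meas om_ident om_indep om01 p24 rho_p' rho_gt0 walk hal.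
  move=> hc; apply: filterS2 hae hc => u hu.
  by rewrite /F sE /Q -hu.
split=> [k4 eps eps0|k4 eps eps0].
- have /ereal_sup_gt[_ [p [p0 rp] <-]] := k4; rewrite lte_fin => p4.
  apply: (core p) => //; first lra.
  by rewrite min_r ?ltW//; lra.
- set k := fine _.
  have kE : kappa P omega = k%:E.
    rewrite fineK// fin_numElt; apply/andP; split.
      by apply: lt_trans kappa_gt2; rewrite ltNyr.
    by apply: le_lt_trans k4 _; rewrite ltry.
  have k2 : 2 < k by rewrite -lte_fin -kE.
  have ik0 : 0 < 2 / k by rewrite divr_gt0//; lra.
  (* The supremum kappa = k need not be attained: a p in (t, k] is taken instead. The bound p > 2 /
     (2/k + eps) means 2/p < 2/k + eps, and such p exist because t < k. *)
  pose t := Num.max 2 (2 / (2 / k + eps)).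
  have tk : t < k.
    rewrite gt_max k2/= ltr_pdivrMr; last by rewrite addr_gt0.
    rewrite mulrDr mulrCA divff; last by rewrite gt_eqF//; lra.
    by rewrite mulr1 ltrDl mulr_gt0//; lra.
  have : (t%:E < kappa P omega)%E by rewrite kE lte_fin.
  move=> /ereal_sup_gt[_ [p [p0 rp] <-]]; rewrite lte_fin gt_max => /andP[p2 tp].
  have pk : p <= k.
    by rewrite -lee_fin -kE; apply: ereal_sup_ubound; exists p.
  have k4' : k <= 4 by rewrite -lee_fin -kE.
  apply: (core p) => //.
  rewrite min_l; last lra.
  move: tp; rewrite ltr_pdivrMr ?addr_gt0// mulrC -ltr_pdivrMr; last lra.
  lra.
Qed.
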